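(* Let $N \geq 3$, let $\mathbb{H}^N$ be the $N$-dimensional hyperbolic space, fix a point $o\in\mathbb{H}^N$ and set $r=r(x):=\varrho(x,o)$, the geodesic distance from $o$. Then for all $u \in C_c^\infty(\mathbb{H}^N)$ $$\int_{\mathbb{H}^N} |\nabla_{\mathbb{H}^N} u|^2 \, dv_{\mathbb{H}^N} - \frac{(N-1)^2}{4} \int_{\mathbb{H}^N} u^2 \, dv_{\mathbb{H}^N} \geq \frac{1}{4} \int_{\mathbb{H}^N} \frac{u^2}{r^2} \, dv_{\mathbb{H}^N} + \frac{(N-1)(N-3)}{4} \int_{\mathbb{H}^N} \frac{u^2}{\sinh^2 r} \, dv_{\mathbb{H}^N}.$$ Moreover, the operator $$H = -\Delta_{\mathbb{H}^N} - \frac{(N-1)^2}{4} - \frac{1}{4r^2} - \frac{(N-1)(N-3)}{4} \frac{1}{\sinh^2 r}$$ is critical in $\mathbb{H}^N\setminus\{o\}$; that is, the inequality $$\int_{\mathbb{H}^N} |\nabla_{\mathbb{H}^N} u|^2 \, dv_{\mathbb{H}^N} - \frac{(N-1)^2}{4} \int_{\mathbb{H}^N} u^2 \, dv_{\mathbb{H}^N} \geq \int_{\mathbb{H}^N} V u^2 \, dv_{\mathbb{H}^N} \quad \forall u \in C_c^\infty(\mathbb{H}^N\setminus\{o\})$$ is not valid for any $V > \frac{1}{4r^2} + \frac{(N-1)(N-3)}{4\sinh^2 r}$. In particular: no inequality of the form $\int_{\mathbb{H}^N} |\nabla_{\mathbb{H}^N} u|^2 dv_{\mathbb{H}^N} -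 \frac{(N-1)^2}{4}\int_{\mathbb{H}^N} u^2 dv_{\mathbb{H}^N} \ge c\int_{\mathbb{H}^N} \frac{u^2}{r^2} dv_{\mathbb{H}^N}$ holds for all $u\in C_c^\infty(\mathbb{H}^N)$ when $c>1/4$; and for every $\varepsilon>0$, no inequality of the form $$\int_{\mathbb{H}^N} |\nabla_{\mathbb{H}^N} u|^2 dv_{\mathbb{H}^N} - \frac{(N-1)^2}{4}\int_{\mathbb{H}^N} u^2 dv_{\mathbb{H}^N} \ge \frac14\int_{\mathbb{H}^N} \frac{u^2}{r^2} dv_{\mathbb{H}^N} + c\int_{\mathbb{H}^N} \frac{u^2}{\sinh^2 r} dv_{\mathbb{H}^N}$$ holds for all $u\in C_c^\infty(B_\varepsilon)$ when $c>(N-1)(N-3)/4$, where $B_\varepsilon=\{x\in\mathbb{H}^N:\varrho(x,o)<\varepsilon\}$.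
   Context: $\nabla_{\mathbb{H}^N}$, $\Delta_{\mathbb{H}^N}$, $dv_{\mathbb{H}^N}$ denote the Riemannian gradient, Laplace–Beltrami operator and volume measure of $\mathbb{H}^N$. A Schrödinger operator $P=-\Delta-V$ on a domain $\Omega$ is called critical in $\Omega$ (in the sense of Devyver–Fraas–Pinchover) if its quadratic form is nonnegative on $C_c^\infty(\Omega)$ and there is no nonnegative, not identically zero weight $W$ such that $\int_\Omega|\nabla u|^2-\int_\Omega Vu^2\ge\int_\Omega Wu^2$ for all $u\in C_c^\infty(\Omega)$. *)

(* Defs.v *)
(* Hyperbolic space H^N realised as the Poincare ball model. *)
From HB Require Import structures.
From mathcomp Require Import all_boot all_order all_algebra.
From mathcomp Require Import all_classical all_reals all_analysis.
Set Implicit Arguments. Unset Strict Implicit. Unset Printing Implicit Defensive.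
Import Order.TTheory GRing.Theory Num.Theory.
Import numFieldNormedType.Exports.
Local Open Scope classical_set_scope.
Local Open Scope ring_scope.

Section HyperbolicDefs.
Variable R : realType.

Definition enorm2 {N : nat} (x : 'rV[R]_N) : R := \sum_(i < N) (x 0 i) ^+ 2.

Definition ebasis {N : nat} (i : 'I_N) : 'rV[R]_N := delta_mx 0 i.

Definition partial {N : nat} (i : 'I_N) (u : 'rV[R]_N -> R) : 'rV[R]_N -> R :=
  fun x => 'D_(ebasis i) u x.

Fixpoint iter_partial {N : nat} (s : seq 'I_N) (u : 'rV[R]_N -> R) : 'rV[R]_N -> R :=
  match s with
  | [::] => u
  | i :: s' => partial i (iter_partial s' u)
  end.

Definition smooth {N : nat} (u : 'rV[R]_N -> R) : Prop :=
  forall (s : seq 'I_N) (x : 'rV[R]_N), differentiable (iter_partial s u) x.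

Definition borel_fun {N : nat} (W : 'rV[R]_N -> R) : Prop :=
  forall a : R, <<s [set A : set 'rV[R]_N | open A] >> (W @^-1` [set y | a < y]).

Definition upd (g : nat -> R) (k : nat) (t : R) : nat -> R :=
  fun j => if j == k then t else g j.

Fixpoint iter_int (n : nat) (F : (nat -> R) -> \bar R) : \bar R :=
  match n with
  | 0 => F (fun _ => 0)
  | n'.+1 => (\int[@lebesgue_measure R]_(t in [set: R])
                iter_int n' (fun g => F (upd g n' t)))%E
  end.

(* Lebesgue integral over R^N (for nonnegative Borel functions, by Tonelli) *)
Definition lebesgue_int {N : nat} (f : 'rV[R]_N -> \bar R) : \bar R :=
  iter_int N (fun g => f (\row_(i < N) g (nat_of_ord i))).

(* Poincare ball model: points x with |x| < 1, metric (2/(1-|x|^2))^2 |dx|^2 *)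
Definition in_ball {N : nat} (x : 'rV[R]_N) : bool := enorm2 x < 1.

(* integral w.r.t. the hyperbolic volume dv = (2/(1-|x|^2))^N dx over H^N *)
Definition hint {N : nat} (f : 'rV[R]_N -> \bar R) : \bar R :=
  lebesgue_int (fun x => if in_ball x then (f x * ((2 / (1 - enorm2 x)) ^+ N)%:E)%E
                         else 0%E).

Definition hgrad2 {N : nat} (u : 'rV[R]_N -> R) (x : 'rV[R]_N) : R :=
  ((1 - enorm2 x) / 2) ^+ 2 * \sum_(i < N) (partial i u x) ^+ 2.

Definition acosh (t : R) : R := ln (t + Num.sqrt (t ^+ 2 - 1)).
Definition sinh (t : R) : R := (expR t - expR (- t)) / 2.

Definition hdist {N : nat} (x y : 'rV[R]_N) : R :=
  acosh (1 + 2 * enorm2 (x - y) / ((1 - enorm2 x) * (1 - enorm2 y))).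

(* C_c^infty(H^N): smooth, support a compact subset of the open ball *)
Definition test_H {N : nat} (u : 'rV[R]_N -> R) : Prop :=
  smooth u /\ exists rho : R, rho < 1 /\ forall x, rho <= enorm2 x -> u x = 0.

Definition test_punct {N : nat} (o : 'rV[R]_N) (u : 'rV[R]_N -> R) : Prop :=
  test_H u /\ exists delta : R, 0 < delta /\ forall x, hdist x o < delta -> u x = 0.

Definition test_ball {N : nat} (o : 'rV[R]_N) (eps : R) (u : 'rV[R]_N -> R) : Prop :=
  smooth u /\ exists eps' : R, eps' < eps /\
    forall x, ~ (in_ball x /\ hdist x o <= eps') -> u x = 0.

Definition form_ge {N : nat} (test : ('rV[R]_N -> R) -> Prop) (V : 'rV[R]_N -> R) : Prop :=
  forall u, test u ->
    (hint (fun x => (V x * u x ^+ 2)%:E) <= hint (fun x => (hgrad2 u x)%:E))%E.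

(* Criticality (Devyver-Fraas-Pinchover) of -Delta - V in Omega = ball minus o:
   the form is nonnegative, and no nonnegative (Borel) weight W, not a.e. zero,
   can be added. *)
Definition critical_punct {N : nat} (o : 'rV[R]_N) (V : 'rV[R]_N -> R) : Prop :=
  form_ge (test_punct o) V /\
  ~ (exists W : 'rV[R]_N -> R,
        borel_fun W /\
        (forall x, in_ball x -> x != o -> 0 <= W x) /\
        (0 < hint (fun x => if x == o then 0%E else (W x)%:E))%E /\
        form_ge (test_punct o) (fun x => V x + W x)).

End HyperbolicDefs.

(* Main.v *)
(* With [s = cosh r] one has [|grad s|^2 = s^2 - 1] and [div grad s = N s], so for
   every compactly supported [w] the divergence theorem reads
   [int (<grad w, grad s> + N s w) dv = 0].  In the ball model this is an
   algebraic identity plus a coordinatewise integration by parts.  Everything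
   follows from it.  The radial ground state [phi = r^(1/2) (sinh r)^(-(N-1)/2)]
   solves [phi' = - g phi] (derivative in [s]), and the Riccati equation for [g]
   turns the choice [w = u^2 g] into the Hardy inequality by completing a square;
   shifting [s] to [s + e] removes the singularity at the pole, and Fatou's lemma
   lets [e] tend to [0].  For [u = phi * psi (log r)] the deficit of the
   inequality is [int (psi')^2], up to a constant, with respect to [d(log r)]:
   choosing [w = phi^2 / (r sinh r) * H (log r)] in the same identity replaces
   polar coordinates.  Cut-offs [psi] of logarithmic length [k] have energy
   [O(1/k)], which yields criticality and both sharp constants. *)
Require Import Defs.
From HB Require Import structures.
From mathcomp Require Import all_boot all_order all_algebra.
From mathcomp Require Import all_classical all_reals all_analysis.
From mathcomp Require Import measurable_realfun.
From mathcomp Require Import ring lra.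
Set Implicit Arguments. Unset Strict Implicit. Unset Printing Implicit Defensive.
Import Order.TTheory GRing.Theory Num.Theory.
Import numFieldNormedType.Exports.
Local Open Scope classical_set_scope.
Local Open Scope ring_scope.

(** * Lebesgue measure on row vectors *)

(** The variable [cosh r] is preferred to [r] because it is rational in the coordinates and smooth
    through the pole, so that the vector field needs no excision around [o]. The integral of the
    statement is an iterated one, tied to Lebesgue measure by Tonelli for nonnegative integrands,
    whereas the divergence identity is signed: hence a measure [mu] that reproduces the iterated
    integral and carries an integration by parts in each coordinate. The shift to [s + e] costs only
    a factor [1 - O(e)] in front of the potential, because [g] is nonincreasing and at most a
    multiple of the potential; both facts rest on [tanh r <= r <= sinh r] and on [(N - 1) / 2 >= 1].
    The bounds on the cut-off ground state depend on the length of the window in [log r] but not on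
    its position. The window is centred to rule out an extra weight, pushed to large [r], where
    [1 / sinh^2 r] is negligible against [1 / r^2], for the constant [1/4], and pushed to the pole,
    where the two weights are comparable, for the other constant. *)

Notation borelRV R N := (g_sigma_algebraType (@open 'rV[R]_N)).

Section BorelRV.
Variables (R : realType) (N : nat).
Local Notation E := 'rV[R]_N.
Local Notation BE := (borelRV R N).

Lemma open_measurableRV (U : set E) : open U -> measurable (U : set BE).
Proof. by move=> oU; exact: sub_sigma_algebra. Qed.

Lemma closed_measurableRV (U : set E) : closed U -> measurable (U : set BE).
Proof.
by move=> cU; rewrite -[U]setCK; apply: measurableC; apply: open_measurableRV;
  rewrite openC.
Qed.

Lemma open_continuous_measurableRV (D : set E) (f : E -> R) : open D ->
  (forall x, D x -> {for x, continuous f}) -> measurable_fun (D : set BE) (f : BE -> R).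
Proof.
move=> oD cf; apply: (measurability _ (RGenOpens.measurableE R)).
move=> _ [_ [a [b ->] <-]]; apply: open_measurableRV.
rewrite openE => x [Dx fx]; rewrite /interior.
apply: filterI; first exact: open_nbhs_nbhs.
by apply: (cf x Dx); apply: open_nbhs_nbhs; split => //; exact: interval_open.
Qed.

Lemma continuous_measurableRV (f : E -> R) :
  continuous f -> measurable_fun setT (f : BE -> R).
Proof. move=> cf; have oT : open [set: E] by exact: openT.
by apply: (open_continuous_measurableRV oT) => x _; exact: cf.
Qed.

Lemma coord_measurable i : measurable_fun setT (fun x : BE => (x : E) 0 i).
Proof. by apply: continuous_measurableRV; exact: coord_continuous. Qed.

Lemma rV_ballP (x y : E) (e : R) : 0 < e ->
  (forall i, `|x 0 i - y 0 i| < e) -> ball x e y.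
Proof. by move=> e0 h; split=> // i j; rewrite ord1; exact: h. Qed.

(* Second countability: an open set is a countable union of rational cubes. *)
Lemma measurable_fun_rV d (T : measurableType d) (f : T -> E) :
  (forall i, measurable_fun setT (fun x => f x 0 i)) ->
  measurable_fun setT (f : T -> BE).
Proof.
move=> mf; apply: (measurability _ (erefl : @measurable _ BE = <<s @open E>>)).
move=> _ [U oU <-]; rewrite setTI.
pose box (c : {ffun 'I_N -> rat} * nat) : set E :=
  [set x | forall i, `|ratr (c.1 i) - x 0 i| < c.2.+1%:R^-1].
pose good (c : {ffun 'I_N -> rat} * nat) : set E :=
  [set x | box c x /\ box c `<=` U].
have -> : f @^-1` U = \bigcup_c (f @^-1` good c).
  apply/seteqP; split=> [t /= Uft|t [c _ [bc +]]]; last exact.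
  have /nbhs_ballP[e /= e0 eU] : nbhs (f t) U by exact: open_nbhs_nbhs.
  (* The cube is centred at a rational approximation of [f t], not at [f t] itself, so two of its
     radii must fit below [e]. *)
  have [n ne] : exists n : nat, 2 * n.+1%:R^-1 < e.
    have := near_infty_natSinv_lt (PosNum (divr_gt0 e0 (@ltr0Sn R 1))).
    by move=> [n _ /(_ n (leqnn n)) /= h]; exists n; rewrite mulrC -ltr_pdivlMr.
  have n0 : 0 < n.+1%:R^-1 :> R by rewrite invr_gt0.
  have rq i : exists q : rat, `|ratr q - f t 0 i| < n.+1%:R^-1.
    have hlt : f t 0 i - n.+1%:R^-1 < f t 0 i + n.+1%:R^-1.
      by move: (n.+1%:R^-1) n0 => e1 e10; lra.
    have [q] := rat_in_itvoo hlt.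
    by rewrite in_itv /= => /andP[h1 h2]; exists q;
      rewrite ltr_norml ltrBrDr addrC h1 ltrBlDr addrC h2.
  exists ([ffun i => projT1 (cid (rq i))], n) => //=; split.
    by move=> i /=; rewrite ffunE; exact: (projT2 (cid (rq i))).
  move=> y hy; apply: eU; apply: rV_ballP => // i.
  have := hy i; rewrite /= ffunE; have := projT2 (cid (rq i)).
  set q := ratr _; move=> h1 h2.
  rewrite (_ : _ - _ = (f t 0 i - q) + (q - y 0 i)); last by ring.
  rewrite (le_lt_trans (ler_normD _ _))// (distrC _ q) (lt_trans _ ne)//.
  by rewrite mulr_natl mulr2n ltrD.
apply: countable_bigcupT_measurable => // c.
have [cU|cU] := pselect (box c `<=` U); last first.
  rewrite (_ : _ @^-1` _ = set0) ?measurable0//.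
  by apply/seteqP; split=> // t [].
rewrite (_ : _ @^-1` _ =
  \big[setI/setT]_(i < N) [set t | `|ratr (c.1 i) - f t 0 i| < c.2.+1%:R^-1]).
  apply: bigsetI_measurable => i _.
  rewrite (_ : [set _ | _] = (fun t => f t 0 i) @^-1` ball (ratr (c.1 i) : R) c.2.+1%:R^-1)//.
  by rewrite -[X in measurable X]setTI; apply: mf => //; apply: open_measurable; exact: ball_open.
rewrite -bigcap_seq_cond; apply/seteqP; split=> t.
  by move=> [bc _] i _; exact: bc.
by move=> h; split=> // i; apply: h; rewrite /= mem_index_enum.
Qed.

Definition updr (x : E) (n : nat) (t : R) : E :=
  \row_i (if (i : nat) == n then t else x 0 i).

Lemma updr_measurable n : measurable_fun setT
  ((fun p => updr p.1 n p.2) : BE * R -> BE).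
Proof.
apply: measurable_fun_rV => i.
rewrite (_ : (fun _ => _) = fun p : BE * R => if (i : nat) == n then p.2 else (p.1 : E) 0 i); last first.
  by apply/funext => p; rewrite mxE.
case: ((i : nat) == n); first exact: measurable_snd.
exact: measurableT_comp (coord_measurable i) measurable_fst.
Qed.

Lemma updr_comm (x : E) i n t u : i != n ->
  updr (updr x i t) n u = updr (updr x n u) i t.
Proof.
move=> ni; apply/rowP => j; rewrite !mxE.
by case: (eqVneq (j : nat) n) => [->|//]; rewrite eq_sym (negbTE ni).
Qed.

(** Only the coordinates below [n] are constrained: such a set has finite mass once the remaining
    coordinates are frozen. *)
Definition box (n : nat) (c : E) (M : R) : set E :=
  [set x | forall j : 'I_N, (j < n)%N -> `|x 0 j - c 0 j| <= M].

Lemma box_measurable n c M : measurable (box n c M : set BE).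
Proof.
rewrite (_ : box n c M = \big[setI/setT]_(i < N | (i < n)%N)
   ((fun x : BE => (x : E) 0 i) @^-1` closed_ball_ Num.norm (c 0 i) M)).
  apply: bigsetI_measurable => i _; rewrite -[X in measurable X]setTI.
  apply: coord_measurable => //; exact: closed_measurable (@closed_closed_ball_ _ _ _ _).
rewrite -bigcap_seq_cond; apply/seteqP; split=> t.
  by move=> b i /= /andP[_ ?]; rewrite /closed_ball_/= distrC; exact: b.
move=> h i ni; have := h i; rewrite /= mem_index_enum ni => /(_ isT).
by rewrite /closed_ball_/= distrC.
Qed.

End BorelRV.

Lemma integral_deriv_compact_support (R : realType) (F f : R -> R) (M : R) :
  (forall t : R, is_derive t 1 F (f t)) -> continuous f ->
  (forall t, M < `|t| -> F t = 0) -> (forall t, M < `|t| -> f t = 0) ->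
  (\int[@lebesgue_measure R]_t (f t)%:E = 0)%E.
Proof.
(* [M] may be negative, and [F] is known to vanish only strictly beyond it; this [K] is positive and
   [F] is zero at both endpoints. *)
move=> dF cf F0 f0; pose K : R := `|M| + 1.
have MK : M < K by rewrite /K; have := ler_norm M; lra.
have K0 : 0 < K by rewrite /K; have := normr_ge0 M; lra.
have cF : continuous F.
  by move=> t; apply: differentiable_continuous; apply/derivable1_diffP; have [] := dF t.
transitivity (\int[@lebesgue_measure R]_(t in `[(- K)%R, K]) (f t)%:E)%E.
  rewrite [RHS]integral_mkcond; apply: eq_integral => t _.
  rewrite patchE; case: ifPn => // /negP tK; rewrite f0//.
  rewrite ltNge; apply/negP => tM; apply: tK; rewrite inE /= in_itv /= -ler_norml.
  by rewrite ltW// (le_lt_trans tM).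
rewrite (@continuous_FTC2 _ f F).
- by rewrite !F0 ?subee// ?normrN gtr0_norm.
- by rewrite gtrN.
- by apply: continuous_subspaceT.
- split.
  + by move=> t _; have [] := dF t.
  + exact/cvg_at_right_filter/cF.
  + exact/cvg_at_left_filter/cF.
- by move=> t _; rewrite derive1E; have [_ ->] := dF t.
Qed.

Section LebesgueRV.
Variables (R : realType) (N : nat).
Local Notation E := 'rV[R]_N.
Local Notation BE := (borelRV R N).

(** Makes the mass of a box multiplicative in the inductive construction of the measure: each new
    coordinate contributes a factor [2 * M]. *)
Lemma box_step n (hn : (n < N)%N) (c : E) (M : R) :
  (fun p : BE * R => updr p.1 n p.2) @^-1` box n.+1 c M =
  box n c M `*` `[c 0 (Ordinal hn) - M, c 0 (Ordinal hn) + M]%classic.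
Proof.
apply/seteqP; split=> -[x t] /=.
  move=> h; split=> /= [j jn|].
    by have := h j (ltnW jn); rewrite mxE /= (ltn_eqF jn).
  have := h (Ordinal hn) (ltnSn _); rewrite mxE /= eqxx in_itv /=.
  by rewrite ler_distl.
move=> [h1]; rewrite in_itv /= -ler_distl => h2 j.
rewrite ltnS leq_eqVlt => /orP[/eqP jn|jn]; rewrite mxE /=.
  by rewrite jn eqxx (_ : j = Ordinal hn)//; exact: val_inj.
by rewrite (ltn_eqF jn); exact: h1.
Qed.

Lemma box_cover n (x : E) : exists k : nat, box n 0 k%:R x.
Proof.
exists (Num.truncn (\sum_(i < N) `|x 0 i|)).+1 => j _.
rewrite mxE subr0; apply: (@le_trans _ _ (\sum_(i < N) `|x 0 i|)).
  by rewrite (bigD1 j)//= lerDl sumr_ge0.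
by rewrite ltW// truncnS_gt.
Qed.

(* [mu] is Lebesgue measure on the first [n] coordinates, the others being
   frozen at [0] ([mu] is a Dirac mass in them). *)
Definition is_lebesgue_upto n (mu : {sigma_finite_measure set BE -> \bar R}) :=
  [/\ (forall f : E -> \bar R, measurable_fun setT (f : BE -> \bar R) ->
         (forall x, 0 <= f x)%E ->
         iter_int n (fun g => f (\row_i g i)) = (\int[mu]_x f x)%E),
      (forall c M, 0 <= M -> mu (box n c M) = ((2 * M) ^+ n)%:E) &
      (forall (i : 'I_N) (F DF : E -> R) (M C : R), (i < n)%N ->
         measurable_fun setT (DF : BE -> R) -> (forall x, `|DF x| <= C) ->
         (forall (x : E) (j : 'I_N), (j < n)%N -> M < `|x 0 j| -> DF x = 0) ->
         (forall x : E, M < `|x 0 i| -> F x = 0) ->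
         (forall x (t : R), is_derive t 1 (fun t => F (updr x i t)) (DF (updr x i t))) ->
         (forall x, continuous (fun t => DF (updr x i t))) ->
         (\int[mu]_x (DF x)%:E = 0)%E)].

Lemma sigma_finite_box n (mu : {measure set BE -> \bar R}) :
  (forall c M, 0 <= M -> mu (box n c M) = ((2 * M) ^+ n)%:E) ->
  sigma_finite setT mu.
Proof.
move=> mub; exists (fun k : nat => box n 0 k%:R).
  apply/esym/seteqP; split=> // x _.
  by have [k xk] := box_cover n x; exists k.
by move=> k; split; [exact: box_measurable|rewrite mub ?ltry].
Qed.

(** With no coordinate integrated, [iter_int] evaluates at the zero sequence, which is a Dirac mass;
    the integration by parts clause is vacuous. *)
Lemma is_lebesgue_upto0 : exists mu, is_lebesgue_upto 0 mu.
Proof.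
exists (dirac (0 : BE)); split=> //.
  move=> f mf f0; rewrite integral_dirac// diracE in_setT mul1e /=; congr f.
  by apply/rowP => i; rewrite !mxE.
move=> c M M0; rewrite (_ : box 0 c M = setT); first by rewrite /= diracE in_setT expr0.
by apply/seteqP; split.
Qed.

(** The new measure is the image of the product of [mu] with Lebesgue measure on the line under
    overwriting coordinate [n]. Tonelli gives the iterated integral. For integration by parts,
    Fubini is taken in the order that puts coordinate [i] inside: the fundamental theorem of
    calculus settles [i = n], the induction hypothesis settles [i < n]. *)
Lemma is_lebesgue_uptoS n : (n < N)%N ->
  (exists mu, is_lebesgue_upto n mu) -> exists mu, is_lebesgue_upto n.+1 mu.
Proof.
move=> hn [mu [mui mub mud]].
pose leb : {sigma_finite_measure set (measurableTypeR R) -> \bar R} := @lebesgue_measure R.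
pose U := (fun p => updr p.1 n p.2) : BE * measurableTypeR R -> BE.
have mU : measurable_fun setT U by exact: updr_measurable.
pose nu0 : {measure set BE -> \bar R} :=
  measure_function_pushforward__canonical__measure_function_Measure (mu \x leb)%E mU.
have nub c M : 0 <= M -> nu0 (box n.+1 c M) = ((2 * M) ^+ n.+1)%:E.
  move=> M0; rewrite /nu0 /= /pushforward /U (box_step hn) product_measure1E//; last exact: box_measurable.
  have lebE a b : a <= b -> leb `[a, b]%classic = (b - a)%:E.
    move=> ab; have -> : leb `[a, b]%classic = @lebesgue_measure R `[a, b]%classic by [].
    rewrite lebesgue_measure_itv /= lte_fin -EFinB.
    by case: ltgtP ab => // -> _; rewrite subrr.
  rewrite [X in (X * _)%E](mub c M M0) [X in (_ * X)%E]lebE; last by lra.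
  by rewrite -EFinM exprS mulrC; congr (_ * _)%:E; ring.
(* The image of a sigma-finite measure need not be sigma-finite; here it is, since the boxes cover
   the space and have finite mass. *)
have sf : sigma_finite setT nu0 by exact: sigma_finite_box nub.
pose H1 := isSFinite.Build _ _ _ _ (sfinite_measure_sigma_finite sf).
pose H2 := isSigmaFinite.Build _ _ _ _ sf.
pose nu := HB.pack_for (SigmaFiniteMeasure.type BE R) (Measure.sort nu0) H1 H2.
exists nu; split.
- move=> f mf f0 /=.
  transitivity (\int[leb]_t \int[mu]_x f (updr x n t))%E.
    apply: eq_integral => t _.
    rewrite -(mui (fun x => f (updr x n t)))//; last first.
      apply: (@measurableT_comp _ _ _ _ _ _ (f \o U) _ (fun x => (x, t))) => //.
      by apply: measurableT_comp.
    congr iter_int; apply/funext => g; congr f; apply/rowP => i.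
    by rewrite !mxE /upd.
  rewrite -(@fubini_tonelli2 _ _ _ _ _ mu leb (f \o U))//; last first.
  - by move=> x; exact: f0.
  - exact: measurableT_comp.
  by rewrite [RHS]ge0_integral_pushforward.
- exact: nub.
move=> i F DF M C; rewrite ltnS => ni mDF DFC DF0 F0 dF cDF.
(* [DF] may change sign, so Fubini requires integrability: [DF] is bounded and vanishes off a box of
   finite mass. *)
have intDF : (mu \x leb)%E.-integrable setT (EFin \o DF \o U).
  apply: (@le_integrable _ _ _ _ _ _ _ (cst C%:E \_ (U @^-1` box n.+1 0 `|M|))) => //.
  - by apply/measurable_EFinP; exact: measurableT_comp.
  - move=> [x t] _ /=; rewrite patchE; case: ifPn => [_|/negP h].
      by rewrite abse_EFin lee_fin (le_trans (DFC _))// ler_norm.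
    suff DF0' : DF (U (x, t)) = 0 by rewrite DF0' ?normr0 ?abse0.
    have /existsNP[j /not_implyP[jn jM]] : ~ box n.+1 0 `|M| (U (x, t)).
      by move=> b; apply: h; rewrite inE.
    apply: (DF0 _ j) => //; rewrite (le_lt_trans (ler_norm M))// ltNge.
    by apply/negP => hM; apply: jM; rewrite [X in _ - X]mxE subr0.
  - apply/integrable_restrict => //; rewrite ?setTI; first by rewrite -[X in measurable X]setTI; apply: (mU) => //; exact: box_measurable.
    apply/integrableP; split; first exact: measurable_cst.
    rewrite integral_cst /=; last by rewrite -[X in measurable X]setTI; apply: (mU) => //; exact: box_measurable.
    by rewrite [X in (_ * X)%E](nub 0 `|M|)// -EFinM ltry.
rewrite [LHS](_ : _ = \int[pushforward (mu \x leb) U]_x (DF x)%:E)%E//.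
rewrite integral_pushforward//; last exact/measurable_EFinP.
rewrite preimage_setT; move: ni; rewrite leq_eqVlt => /orP[/eqP ni|ni].
- rewrite -[LHS]fubini1 //= integral0_eq// => x _.
  rewrite /fubini_F /=; apply: (@integral_deriv_compact_support _ (fun t => F (updr x i t)) (fun t => DF (updr x n t)) M); rewrite -?ni //.
  + by move=> t tM; apply: F0; rewrite mxE eqxx.
  + by move=> t tM; apply: (DF0 _ i); rewrite ?mxE ?eqxx// ni.
- rewrite -[LHS]fubini2 //= integral0_eq// => t _.
  rewrite /fubini_G /=; apply: (mud i (fun x => F (updr x n t)) (fun x => DF (updr x n t)) M C) => //.
  + apply: (@measurableT_comp _ _ _ _ _ _ (DF \o U) _ (fun x => (x, t))) => //.
    exact: measurableT_comp.
  + move=> x j jn jM; apply: (DF0 _ j); first exact: ltnW.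
    by rewrite mxE (ltn_eqF jn).
  + by move=> x h; apply: F0; rewrite mxE (ltn_eqF ni).
  + move=> x u; rewrite updr_comm ?(ltn_eqF ni)//.
    rewrite (_ : (fun t0 => _) = (fun t0 => F (updr (updr x n t) i t0))) ?dF//.
    by apply/funext => v; rewrite updr_comm ?(ltn_eqF ni).
  + move=> x; rewrite (_ : (fun t0 => _) = (fun t0 => DF (updr (updr x n t) i t0))) ?cDF//.
    by apply/funext => v; rewrite updr_comm ?(ltn_eqF ni).
Qed.

Lemma is_lebesgue_upto_exists n : (n <= N)%N -> exists mu, is_lebesgue_upto n mu.
Proof.
elim: n => [|n IH] hn; first exact: is_lebesgue_upto0.
by apply: is_lebesgue_uptoS => //; apply: IH; exact: ltnW.
Qed.

End LebesgueRV.

(** * Smooth functions on open sets *)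

(** The first-order expansion of [f] at [x] is also one of [g], and uniqueness of the differential
    identifies the two differentials. *)
Lemma near_eq_differentiable (R : realType) (V W : normedModType R) (f g : V -> W) x :
  (\near x, f x = g x) -> differentiable f x -> differentiable g x.
Proof.
move=> fg df; have fgx : f x = g x by exact: nbhs_singleton fg.
have H : g \o shift x = cst (g x) + 'd f x +o_ 0 id.
  apply/eqaddoP => e e0; have /eqaddoP/(_ e e0) := diff_locally df.
  have : \forall y \near (0 : V), f (y + x) = g (y + x).
    by move: fg; rewrite (near_shift 0) /= subr0.
  by apply: filterS2 => y fgy; rewrite !fctE /= -fgy -fgx.
have dc : continuous ('d f x) by exact: diff_continuous.
have dE := diff_unique dc H.
by apply/diff_locallyP; rewrite dE.
Qed.

Section Cn.
Variables (R : realType) (N : nat).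
Local Notation E := 'rV[R]_N.
Implicit Types (U : set E) (u v : E -> R).

Lemma partial_eq_on U u v i : open U -> (forall x, U x -> u x = v x) ->
  forall x, U x -> partial i u x = partial i v x.
Proof.
move=> oU uv x Ux; apply: near_eq_derive.
by apply: filterS (open_nbhs_nbhs (conj oU Ux)).
Qed.

Lemma differentiable_eq_on U u v : open U -> (forall x, U x -> u x = v x) ->
  forall x, U x -> differentiable u x -> differentiable v x.
Proof.
move=> oU uv x Ux; apply: near_eq_differentiable.
by apply: filterS (open_nbhs_nbhs (conj oU Ux)).
Qed.

(** A version of [smooth] localised to [U], since [r] is smooth only inside the ball and off the
    pole; it is graded by the order so that products and compositions can be treated by
    induction. *)
Fixpoint Cn U n u : Prop := (forall x, U x -> differentiable u x) /\
  (if n is m.+1 then forall i, Cn U m (partial i u) else True).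

Definition smooth_on U u := forall n, Cn U n u.

Lemma Cn_eq U n u v : open U -> (forall x, U x -> u x = v x) -> Cn U n u -> Cn U n v.
Proof.
move=> oU; elim: n u v => [|n IH] u v uv [du Du].
  by split=> // x Ux; exact: (differentiable_eq_on oU uv Ux (du x Ux)).
split=> [x Ux|i]; first exact: (differentiable_eq_on oU uv Ux (du x Ux)).
by apply: IH (Du i); exact: partial_eq_on.
Qed.

Lemma Cn_diff U n u : Cn U n u -> forall x, U x -> differentiable u x.
Proof. by case: n => [|n] []. Qed.

Lemma CnW U n u : Cn U n.+1 u -> Cn U n u.
Proof.
elim: n u => [|n IH] u [du Du]; first by split.
by split=> // i; exact: IH.
Qed.

Lemma Cn_sub U U' n u : U' `<=` U -> Cn U n u -> Cn U' n u.
Proof.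
move=> sU; elim: n u => [|n IH] u [du Du].
  by split=> // x /sU; exact: du.
by split=> [x /sU|i]; [exact: du|exact: IH (Du i)].
Qed.

Lemma CnU U U' n u : Cn U n u -> Cn U' n u -> Cn (U `|` U') n u.
Proof.
elim: n u => [|n IH] u [du Du] [du' Du'].
  by split=> // x [] ?; [exact: du|exact: du'].
by split=> [x [] ?|i]; [exact: du|exact: du'|exact: IH (Du i) (Du' i)].
Qed.

Lemma partial_cst i (c : R) : partial i (fun _ : E => c) = fun=> 0.
Proof. by apply/funext => x; rewrite /partial; exact: derive_cst. Qed.

Lemma Cn_cst U n (c : R) : Cn U n (fun _ : E => c).
Proof.
elim: n c => [|n IH] c; first by split.
by split=> // i; rewrite partial_cst.
Qed.

Lemma partialD i u v x : differentiable u x -> differentiable v x ->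
  partial i (fun y => u y + v y) x = partial i u x + partial i v x.
Proof. by move=> du dv; rewrite /partial deriveD//; exact: diff_derivable. Qed.

Lemma partialM i u v x : differentiable u x -> differentiable v x ->
  partial i (fun y => u y * v y) x = partial i u x * v x + u x * partial i v x.
Proof.
move=> du dv; rewrite /partial deriveM; [|exact: diff_derivable..].
by rewrite addrC /GRing.scale /= mulrC.
Qed.

Lemma is_derive1_diff (f : R -> R) (x l : R) : is_derive x 1 f l -> differentiable f x.
Proof. by move=> [df _]; apply/derivable1_diffP. Qed.

Lemma partial_comp i (f : R -> R) (l : R) u x : is_derive (u x) 1 f l ->
  differentiable u x -> partial i (f \o u) x = l * partial i u x.
Proof.
move=> df du; have dfd := is_derive1_diff df.
rewrite /partial deriveE; last exact: differentiable_comp.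
case: df => df <-; rewrite diff_comp//= (deriv1E df) /= derive1E -deriveE//.
by rewrite /GRing.scale /= mulrC.
Qed.

Lemma CnD U n u v : open U -> Cn U n u -> Cn U n v -> Cn U n (fun x => u x + v x).
Proof.
move=> oU; elim: n u v => [|n IH] u v [du Du] [dv Dv].
  by split=> // x Ux; apply: differentiableD; [exact: du|exact: dv].
split=> [x Ux|i]; first by apply: differentiableD; [exact: du|exact: dv].
apply: (@Cn_eq _ _ (fun x => partial i u x + partial i v x)) => //.
  by move=> x Ux; rewrite partialD//; [exact: du|exact: dv].
exact: IH (Du i) (Dv i).
Qed.

Lemma CnM U n u v : open U -> Cn U n u -> Cn U n v -> Cn U n (fun x => u x * v x).
Proof.
move=> oU; elim: n u v => [|n IH] u v Cu Cv.
  split=> // x Ux; apply: differentiableM; [exact: (Cn_diff Cu)|exact: (Cn_diff Cv)].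
have [[du Du] [dv Dv]] := (Cu, Cv).
split=> [x Ux|i]; first by apply: differentiableM; [exact: du|exact: dv].
apply: (@Cn_eq _ _ (fun x => partial i u x * v x + u x * partial i v x)) => //.
  by move=> x Ux; rewrite partialM//; [exact: du|exact: dv].
by apply: CnD => //; [exact: IH (Du i) (CnW Cv)|exact: IH (CnW Cu) (Dv i)].
Qed.

(** The outer derivative is required only along [u] and at one order less. Functions whose
    derivative is expressed through themselves, such as the exponential, the inverse and [flat], are
    then smooth by induction on the order. *)
Lemma Cn_comp U n (f f' : R -> R) u : open U ->
  (forall x, U x -> is_derive (u x) 1 f (f' (u x))) ->
  (if n is m.+1 then Cn U m (f' \o u) else True) ->
  Cn U n u -> Cn U n (f \o u).
Proof.
move=> oU df Cf Cu.
have dfu x : U x -> differentiable (f \o u) x.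
  move=> Ux; apply: differentiable_comp; first exact: (Cn_diff Cu).
  exact: is_derive1_diff (df x Ux).
case: n Cf Cu => [|n] Cf Cu; first by split.
split=> // i; apply: (@Cn_eq _ _ (fun x => (f' \o u) x * partial i u x)) => //.
  by move=> x Ux; rewrite (partial_comp i (df x Ux))//; exact: (Cn_diff Cu).
by apply: CnM => //; exact: (Cu.2 i).
Qed.

Lemma partial_coord i j (x : E) : partial i (fun y : E => y 0 j) x = (i == j)%:R.
Proof.
rewrite /partial deriveE; last exact: differentiable_coord.
have cE : linear (fun y : E => y 0 j) by move=> k y z; rewrite !mxE.
pose g : {linear E -> R} := HB.pack (fun y : E => y 0 j) (GRing.isLinear.Build _ _ _ _ _ cE).
have dg : 'd (g : E -> R) x = g :> (E -> R) by apply: diff_lin; exact: coord_continuous.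
transitivity ('d (g : E -> R) x (ebasis R i)) => //.
by rewrite dg /= /ebasis mxE eqxx eq_sym.
Qed.

Lemma Cn_coord U n j : open U -> Cn U n (fun y : E => y 0 j).
Proof.
move=> oU; case: n => [|n]; split=> //; try by move=> *; exact: differentiable_coord.
move=> i; apply: (@Cn_eq _ _ (fun=> (i == j)%:R)) => //; last exact: Cn_cst.
by move=> x _; rewrite partial_coord.
Qed.

(** Turns a partial derivative into the one-variable derivative along [updr], the form in which
    [is_lebesgue_upto] integrates by parts. *)
Lemma partial_line (i : 'I_N) u (x : E) t : differentiable u (updr x i t) ->
  is_derive t 1 (fun t => u (updr x i t)) (partial i u (updr x i t)).
Proof.
move=> /diff_derivable du.
have E1 : (fun h : R => h^-1 *: (((fun s => u (updr x i s)) \o shift t) (h *: (1 : R)) - u (updr x i t))) =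
          (fun h : R => h^-1 *: ((u \o shift (updr x i t)) (h *: ebasis R i) - u (updr x i t))).
  apply/funext => h; congr (_ *: (u _ - _)); apply/rowP => j; rewrite !mxE /=.
  have -> : ((j : nat) == i) = (j == i) by [].
  by case: (eqVneq j i) => _; rewrite ?eqxx /= ?mulr0n ?mulr0 ?add0r.
by apply: DeriveDef; [rewrite /derivable E1; exact: du|rewrite /derive E1].
Qed.

End Cn.

Section SmoothOn.
Variables (R : realType) (N : nat).
Local Notation E := 'rV[R]_N.
Implicit Types (U : set E) (u v : E -> R).

Lemma smooth_on_eq U u v : open U -> (forall x, U x -> u x = v x) ->
  smooth_on U u -> smooth_on U v.
Proof. by move=> oU uv Su n; exact: Cn_eq (Su n). Qed.

Lemma smooth_on_sub U U' u : U' `<=` U -> smooth_on U u -> smooth_on U' u.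
Proof. by move=> sU Su n; exact: Cn_sub (Su n). Qed.

Lemma smooth_on_partial U u i : smooth_on U u -> smooth_on U (partial i u).
Proof. by move=> Su n; have [_] := Su n.+1; apply. Qed.

Lemma smooth_on_diff U u x : smooth_on U u -> U x -> differentiable u x.
Proof. by move=> Su; exact: (Cn_diff (Su 0)). Qed.

Lemma smooth_on_continuous U u x : smooth_on U u -> U x -> {for x, continuous u}.
Proof. by move=> Su Ux; apply: differentiable_continuous; exact: smooth_on_diff Su Ux. Qed.

Lemma smooth_on_cst U (c : R) : smooth_on U (fun _ : E => c).
Proof. by move=> n; exact: Cn_cst. Qed.

Lemma smooth_on_coord U j : open U -> smooth_on U (fun y : E => y 0 j).
Proof. by move=> oU n; exact: Cn_coord. Qed.

Lemma smooth_onD U u v : open U -> smooth_on U u -> smooth_on U v ->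
  smooth_on U (fun x => u x + v x).
Proof. by move=> oU Su Sv n; apply: CnD. Qed.

Lemma smooth_onM U u v : open U -> smooth_on U u -> smooth_on U v ->
  smooth_on U (fun x => u x * v x).
Proof. by move=> oU Su Sv n; apply: CnM. Qed.

Lemma smooth_onN U u : open U -> smooth_on U u -> smooth_on U (fun x => - u x).
Proof.
move=> oU Su; apply: (@smooth_on_eq _ (fun x => -1 * u x)) => //.
  by move=> x _; rewrite mulN1r.
by apply: smooth_onM => //; exact: smooth_on_cst.
Qed.

Lemma smooth_onB U u v : open U -> smooth_on U u -> smooth_on U v ->
  smooth_on U (fun x => u x - v x).
Proof. by move=> oU Su Sv; apply: smooth_onD => //; exact: smooth_onN. Qed.

Lemma smooth_onX U u n : open U -> smooth_on U u -> smooth_on U (fun x => u x ^+ n).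
Proof.
move=> oU Su; elim: n => [|n IH].
  by apply: (@smooth_on_eq _ (fun=> 1)) => //; exact: smooth_on_cst.
apply: (@smooth_on_eq _ (fun x => u x * u x ^+ n)) => [//|x _|].
  by rewrite exprS.
exact: smooth_onM.
Qed.

Lemma smooth_on_sum U (I : Type) (r : seq I) (P : pred I) (F : I -> E -> R) : open U ->
  (forall i, smooth_on U (F i)) -> smooth_on U (fun x => \sum_(i <- r | P i) F i x).
Proof.
move=> oU SF; elim: r => [|a r IH].
  apply: (@smooth_on_eq _ (fun=> 0)) => //; last exact: smooth_on_cst.
  by move=> x _; rewrite big_nil.
apply: (@smooth_on_eq _ (fun x => (if P a then F a x else 0) + \sum_(i <- r | P i) F i x)) => //.
  by move=> x _; rewrite big_cons; case: ifP => //; rewrite add0r.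
by apply: smooth_onD => //; case: (P a) => //; exact: smooth_on_cst.
Qed.

Lemma smooth_on_exp U u : open U -> smooth_on U u -> smooth_on U (fun x => expR (u x)).
Proof.
move=> oU Su; elim=> [|n IH]; by apply: (@Cn_comp _ _ _ _ expR expR).
Qed.

Lemma is_derive1_inv (t : R) : t != 0 -> is_derive t 1 (@GRing.inv R) (- (t^-1 * t^-1)).
Proof.
move=> t0; apply: is_derive_eq.
  by apply: (@is_deriveV _ id t 1 1).
by rewrite /GRing.scale /= mulr1 expr2 invfM.
Qed.

Lemma smooth_on_inv U u : open U -> (forall x, U x -> u x != 0) ->
  smooth_on U u -> smooth_on U (fun x => (u x)^-1).
Proof.
move=> oU u0 Su; have dI x : U x -> is_derive (u x) 1 (@GRing.inv R) (- ((u x)^-1 * (u x)^-1)).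
  by move=> Ux; apply: is_derive1_inv; exact: u0.
elim=> [|n IH]; apply: (@Cn_comp _ _ _ _ (@GRing.inv R) (fun t => - (t^-1 * t^-1))) => //.
apply: (@Cn_eq _ _ _ _ (fun x => -1 * ((u x)^-1 * (u x)^-1))) => //.
  by move=> x _; rewrite /= mulN1r.
by apply: CnM => //; [exact: Cn_cst|exact: CnM].
Qed.

Lemma smooth_on_ln U u : open U -> (forall x, U x -> 0 < u x) ->
  smooth_on U u -> smooth_on U (fun x => ln (u x)).
Proof.
move=> oU u0 Su n; apply: (@Cn_comp _ _ _ _ (@ln R) (@GRing.inv R)) => //.
  by move=> x Ux; apply: is_derive1_ln; exact: u0.
case: n => // n; apply: smooth_on_inv => // x Ux; rewrite gt_eqF//; exact: u0.
Qed.

Lemma smoothP u : smooth u <-> smooth_on setT u.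
Proof.
split=> [Su n|Su s x].
  have : forall s, Cn setT n (iter_partial s u).
    elim: n => [|n IH] s; first by split=> // x _; exact: Su.
    by split=> [x _|i]; [exact: Su|exact: (IH (i :: s))].
  by move/(_ [::]).
suff : smooth_on setT (iter_partial s u) by move/smooth_on_diff; exact.
by elim: s => //= i s IH; exact: smooth_on_partial.
Qed.

(** The open sets [U] and the complement of [K] cover the space, and [u] is zero on the second. This
    is how a function understood only in the ball, or in the punctured ball, becomes a smooth
    function of the whole space. *)
Lemma smooth_on_glue U (K : set E) u : open U -> closed K -> K `<=` U ->
  smooth_on U u -> (forall x, ~ K x -> u x = 0) -> smooth_on setT u.
Proof.
move=> oU cK KU Su u0.
have SK : smooth_on (~` K) u.
  apply: (@smooth_on_eq _ (fun=> 0)); last exact: smooth_on_cst.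
  - by rewrite openC.
  - by move=> x /u0.
move=> n; have := CnU (Su n) (SK n); apply: Cn_sub => x _.
by have [/KU|] := pselect (K x); [left|right].
Qed.

Lemma enorm2_ge0 (x : E) : 0 <= enorm2 x.
Proof. by apply: sumr_ge0 => i _; exact: sqr_ge0. Qed.

Lemma coord_le_enorm2 (x : E) i : (x 0 i) ^+ 2 <= enorm2 x.
Proof. by rewrite /enorm2 (bigD1 i)//= lerDl sumr_ge0// => j _; exact: sqr_ge0. Qed.

Lemma smooth_on_enorm2 U (c : E) : open U -> smooth_on U (fun x => enorm2 (x - c)).
Proof.
move=> oU; apply: smooth_on_sum => // i; apply: smooth_onX => //.
apply: (@smooth_on_eq _ (fun x => x 0 i - c 0 i)) => //.
  by move=> x _; rewrite !mxE.
by apply: smooth_onB => //; [exact: smooth_on_coord|exact: smooth_on_cst].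
Qed.

Lemma smooth_on_enorm20 U : open U -> smooth_on U (fun x : E => enorm2 x).
Proof.
move=> oU; apply: smooth_on_eq (smooth_on_enorm2 0 oU) => //.
by move=> x _; rewrite subr0.
Qed.

Lemma continuous_enorm20 : continuous (fun x : E => enorm2 x).
Proof. by move=> x; exact: (smooth_on_continuous (smooth_on_enorm20 openT)). Qed.

Lemma compact_ball1 : compact [set x : E | enorm2 x <= 1].
Proof.
apply: bounded_closed_compact.
  exists 1; split; first exact: num_real.
  move=> M M1 x x1; rewrite /= -[leLHS]/(mx_norm x) mx_normrE; apply/bigmax_leP; split; first by apply: ltW; apply: lt_trans M1.
  move=> [i j] _ /=; rewrite ord1 (le_trans _ (ltW M1))//.
  by rewrite -(@expr_le1 _ 2)// -normrX ger0_norm ?sqr_ge0// (le_trans (coord_le_enorm2 _ _)).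
apply: (closed_comp _ (@closed_le R 1)) => x _; exact: continuous_enorm20.
Qed.

Lemma bounded_compact_support u : continuous u -> (forall x, 1 <= enorm2 x -> u x = 0) ->
  exists C, forall x, `|u x| <= C.
Proof.
move=> cu u0; have := compact_bounded (continuous_compact (continuous_subspaceT cu) compact_ball1).
move=> [M [_ /(_ (`|M| + 1))]] H.
have {}H : forall x, enorm2 x <= 1 -> `|u x| <= `|M| + 1.
  move=> x x1; apply: H; first by rewrite (le_lt_trans (ler_norm M))// ltrDl.
  by exists x.
exists (`|M| + 1) => x; have [/H//|/ltW/u0->] := leP (enorm2 x) 1.
by rewrite normr0 addr_ge0.
Qed.

End SmoothOn.

(** * Integration against the Lebesgue measure in all coordinates *)

Section LebesgueMeasure.
Variables (R : realType) (N : nat).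
Local Notation E := 'rV[R]_N.
Local Notation BE := (borelRV R N).
Variable mu : {sigma_finite_measure set BE -> \bar R}.
Hypothesis muP : is_lebesgue_upto N mu.

Lemma lebesgue_intE (f : E -> \bar R) : measurable_fun setT (f : BE -> \bar R) ->
  (forall x, 0 <= f x)%E -> lebesgue_int f = (\int[mu]_x f x)%E.
Proof. by case: muP => H _ _; exact: H. Qed.

Lemma in_box1 (x : E) : enorm2 x <= 1 -> box N 0 1 x.
Proof.
move=> x1 j _; rewrite mxE subr0 -(@expr_le1 _ 2)// -normrX ger0_norm ?sqr_ge0//.
exact: le_trans (coord_le_enorm2 _ _) x1.
Qed.

Lemma integrable_bounded_support (u : E -> R) C : measurable_fun setT (u : BE -> R) ->
  (forall x, `|u x| <= C) -> (forall x, 1 <= enorm2 x -> u x = 0) ->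
  mu.-integrable setT (EFin \o u : BE -> \bar R).
Proof.
move=> mU uC u0; have mB : measurable (box N 0 1 : set BE) by exact: box_measurable.
apply: (@le_integrable _ BE R mu setT _ (EFin \o u) (cst C%:E \_ (box N 0 1 : set BE))) => //.
- by apply/measurable_EFinP.
- move=> x _ /=; rewrite patchE; case: ifPn => [_|/negP h].
    by rewrite abse_EFin lee_fin (le_trans (uC _))// ler_norm.
  rewrite u0 ?abse_EFin ?normr0// ltW// ltNge; apply/negP => x1; apply: h.
  by rewrite inE; exact: in_box1.
- apply/integrable_restrict => //; rewrite ?setTI//.
  apply/integrableP; split; first exact: measurable_cst.
  rewrite integral_cst //=; case: muP => _ -> // _.
  by rewrite -EFinM ltry.
Qed.

Lemma integrable_continuous_support (u : E -> R) : continuous u ->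
  (forall x, 1 <= enorm2 x -> u x = 0) ->
  mu.-integrable setT (EFin \o u : BE -> \bar R).
Proof.
move=> cu u0; have [C uC] := bounded_compact_support cu u0.
by apply: integrable_bounded_support uC u0; exact: continuous_measurableRV.
Qed.

Lemma integral_partial i (u : E -> R) : smooth_on setT u ->
  (forall x, 1 <= enorm2 x -> u x = 0) -> (\int[mu]_x (partial i u x)%:E = 0)%E.
Proof.
move=> Su u0; have Sp := smooth_on_partial i Su.
have cp : continuous (partial i u) by move=> x; exact: smooth_on_continuous Sp _.
have p0 x : 1 < enorm2 x -> partial i u x = 0.
  move=> x1; rewrite (@partial_eq_on _ _ [set x | 1 < enorm2 x] u (fun=> 0))//.
  - by rewrite partial_cst.
  - apply: (open_comp _ (@open_gt R 1)) => y _; exact: continuous_enorm20.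
  - by move=> y /ltW/u0.
have [C pC] : exists C, forall x, `|partial i u x| <= C.
  have := compact_bounded (continuous_compact (continuous_subspaceT cp) (@compact_ball1 R N)).
  move=> [M [_ /(_ (`|M| + 1))]] H.
  exists (`|M| + 1) => x; have [x1|/p0->] := leP (enorm2 x) 1; last by rewrite normr0 addr_ge0.
  apply: H; first by rewrite (le_lt_trans (ler_norm M))// ltrDl.
  by exists x.
(* A single coordinate beyond 1 already leaves the unit ball, so [M = 1] serves as the support bound
   in every coordinate. *)
have big1 (x : E) j : 1 < `|x 0 j| -> 1 < enorm2 x.
  move=> x1; apply: lt_le_trans (coord_le_enorm2 _ j).
  by rewrite -[X in _ < X]ger0_norm ?sqr_ge0// normrX expr_gt1.
case: muP => _ _ H; apply: (H i u _ 1 C) => //.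
- exact: continuous_measurableRV.
- by move=> x j _ /big1/p0.
- by move=> x /big1/ltW/u0.
- by move=> x t; apply: partial_line; exact: smooth_on_diff Su _.
- move=> x t; apply: differentiable_continuous; apply/derivable1_diffP.
  by have [] := partial_line (smooth_on_diff Sp (I : setT (updr x i t))).
Qed.

End LebesgueMeasure.

(** * Geometry of the ball model *)

Section Derive1.
Variable R : realType.
Implicit Types (f g : R -> R) (t a b : R).

Lemma is_derive1D f g t a b : is_derive t 1 f a -> is_derive t 1 g b ->
  is_derive t 1 (fun s => f s + g s) (a + b).
Proof. by move=> df dg; exact: is_deriveD. Qed.

Lemma is_derive1M f g t a b : is_derive t 1 f a -> is_derive t 1 g b ->
  is_derive t 1 (fun s => f s * g s) (a * g t + f t * b).
Proof.
move=> df dg; have H := is_deriveM df dg.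
by rewrite addrC (mulrC a); exact: H.
Qed.

Lemma is_derive1_exp t n : is_derive t 1 (fun t : R => t ^+ n) (n%:R * t ^+ n.-1).
Proof.
elim: n => [|n IH].
  rewrite mul0r (_ : (fun _ => _) = cst 1); first exact: is_derive_cst.
  by apply/funext => s; rewrite expr0.
rewrite (_ : (fun _ => _) = (fun s => s * s ^+ n)); last by apply/funext => s; rewrite exprS.
have -> : n.+1%:R * t ^+ n.+1.-1 = 1 * t ^+ n + t * (n%:R * t ^+ n.-1).
  case: (n) => [|m] /=; first by rewrite mul0r mulr0 addr0.
  by rewrite mulrCA -exprS -natr1; ring.
exact: is_derive1M.
Qed.

End Derive1.

Section Geometry.
Variables (R : realType) (N : nat).
Local Notation E := 'rV[R]_N.
Local Notation BE := (borelRV R N).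
Variable o : E.
Hypothesis o1 : enorm2 o < 1.
Implicit Types (U : set E) (u v w : E -> R).

Definition hball : set E := [set x | enorm2 x < 1].
(** The hyperbolic cosine of the distance to [o]. Unlike the distance, it is rational with positive
    denominator on the ball, hence smooth at [o] as well. *)
Definition coshd (x : E) : R := 1 + 2 * enorm2 (x - o) / ((1 - enorm2 x) * (1 - enorm2 o)).
(** The Riemannian inner product of the two gradients, that is, the polarisation of [hgrad2]. *)
Definition hdot u v (x : E) : R :=
  ((1 - enorm2 x) / 2) ^+ 2 * \sum_(i < N) partial i u x * partial i v x.
Definition hdens (x : E) : R := if in_ball x then (2 / (1 - enorm2 x)) ^+ N else 0.

Lemma hdistE x : hdist x o = acosh (coshd x). Proof. by []. Qed.

Lemma hgrad2E u x : hgrad2 u x = hdot u u x.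
Proof. by []. Qed.

Lemma open_hball : open hball.
Proof. by apply: (open_comp _ (@open_lt R 1)) => y _; exact: continuous_enorm20. Qed.

Let b0 : 0 < 1 - enorm2 o. Proof. by rewrite subr_gt0. Qed.
Let a0 x : hball x -> 0 < 1 - enorm2 x. Proof. by rewrite subr_gt0. Qed.
Let oB : open hball := open_hball.

Lemma smooth_on_a U : open U -> smooth_on U (fun x : E => 1 - enorm2 x).
Proof.
by move=> oU; apply: smooth_onB => //; [exact: smooth_on_cst|exact: smooth_on_enorm20].
Qed.

Lemma smooth_on_ainv : smooth_on hball (fun x : E => (1 - enorm2 x)^-1).
Proof.
apply: smooth_on_inv => //; last exact: smooth_on_a.
by move=> x /a0 h; rewrite gt_eqF.
Qed.

Lemma coshd_prod x : coshd x = 1 + (2 / (1 - enorm2 o)) * (enorm2 (x - o) * (1 - enorm2 x)^-1).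
Proof. by rewrite /coshd invfM; ring. Qed.

Lemma smooth_on_coshd : smooth_on hball coshd.
Proof.
apply: smooth_on_eq (fun x _ => esym (coshd_prod x)) _ => //.
apply: smooth_onD => //; first exact: smooth_on_cst.
apply: smooth_onM => //; first exact: smooth_on_cst.
by apply: smooth_onM => //; [exact: smooth_on_enorm2|exact: smooth_on_ainv].
Qed.

Lemma partial_sum i (F : 'I_N -> E -> R) x (r : seq 'I_N) :
  (forall j, differentiable (F j) x) ->
  differentiable (fun y => \sum_(j <- r) F j y) x /\
  partial i (fun y => \sum_(j <- r) F j y) x = \sum_(j <- r) partial i (F j) x.
Proof.
move=> dF; elim: r => [|j r [IH1 IH2]].
  rewrite big_nil (_ : (fun y => _) = fun=> 0); last by apply/funext => y; rewrite big_nil.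
  by rewrite partial_cst; split.
rewrite big_cons (_ : (fun y => _) = fun y => F j y + \sum_(k <- r) F k y); last first.
  by apply/funext => y; rewrite big_cons.
by rewrite partialD// IH2; split => //; exact: differentiableD.
Qed.

Lemma partial_enorm2 i (c x : E) : partial i (fun y => enorm2 (y - c)) x = 2 * (x 0 i - c 0 i).
Proof.
have E1 : (fun y => enorm2 (y - c)) =
    (fun y : E => \sum_(j < N) (y 0 j - c 0 j) * (y 0 j - c 0 j)).
  by apply/funext => y; apply: eq_bigr => j _; rewrite !mxE expr2.
have oT : open [set: E] by exact: openT.
have dF j : differentiable (fun y : E => y 0 j - c 0 j) x.
  apply: (@smooth_on_diff _ _ setT) => //.
  by apply: smooth_onB => //; [exact: smooth_on_coord|exact: smooth_on_cst].
have pF j : partial i (fun y : E => y 0 j - c 0 j) x = (i == j)%:R.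
  rewrite (partialD i (v := fun=> - c 0 j)); [|exact: differentiable_coord|exact: differentiable_cst].
  by rewrite partial_cst partial_coord addr0.
rewrite E1; have [|_ ->] := @partial_sum i (fun j (y : E) => (y 0 j - c 0 j) * (y 0 j - c 0 j)) x (index_enum _).
  by move=> j; apply: differentiableM.
rewrite (bigD1 i)//= big1 ?addr0 => [|j ji].
  by rewrite partialM// pF eqxx mulr1 mul1r; ring.
by rewrite partialM// pF eq_sym (negbTE ji) mul0r mulr0 addr0.
Qed.

Lemma partial_a i (x : E) : partial i (fun y => 1 - enorm2 y) x = - 2 * x 0 i.
Proof.
have E1 : (fun y : E => 1 - enorm2 y) = (fun y : E => 1 + -1 * enorm2 (y - 0)).
  by apply/funext => y; rewrite subr0 mulN1r.
have oT : open [set: E] by exact: openT.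
have d1 : differentiable (fun y : E => enorm2 (y - 0)) x.
  by apply: (@smooth_on_diff _ _ setT) => //; exact: smooth_on_enorm2.
rewrite E1 partialD; [|exact: differentiable_cst|by apply: differentiableM => //; exact: differentiable_cst].
rewrite partial_cst add0r partialM//.
by rewrite partial_cst partial_enorm2 mxE; ring.
Qed.

Lemma partial_ainv i x : hball x -> partial i (fun y => (1 - enorm2 y)^-1) x =
  2 * x 0 i * (1 - enorm2 x)^-1 ^+ 2.
Proof.
move=> hx; have h := a0 hx.
have dI : is_derive (1 - enorm2 x) 1 GRing.inv (- ((1 - enorm2 x)^-1 * (1 - enorm2 x)^-1)).
  by apply: is_derive1_inv; rewrite gt_eqF.
have da : differentiable (fun y : E => 1 - enorm2 y) x.
  by apply: (@smooth_on_diff _ _ hball) => //; exact: smooth_on_a.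
by rewrite (@partial_comp _ _ i GRing.inv _ (fun y : E => 1 - enorm2 y) x dI da) partial_a; ring.
Qed.

Let q x := enorm2 (x - o).
(** The Euclidean gradient of [coshd] stripped of its scalar factor; polynomial in [x]. *)
Let c (i : 'I_N) (x : E) := (1 - enorm2 x) * (x 0 i - o 0 i) + q x * x 0 i.

Lemma partial_coshd i x : hball x -> partial i coshd x =
  4 / (1 - enorm2 o) * (1 - enorm2 x)^-1 ^+ 2 * c i x.
Proof.
move=> hx; have h := a0 hx.
have d1 : differentiable (fun y : E => enorm2 (y - o)) x.
  by apply: (@smooth_on_diff _ _ hball) => //; exact: smooth_on_enorm2.
have d2 : differentiable (fun y : E => (1 - enorm2 y)^-1) x.
  by apply: (@smooth_on_diff _ _ hball) => //; exact: smooth_on_ainv.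
have d3 := differentiableM d1 d2.
have -> : coshd = fun x => 1 + (2 / (1 - enorm2 o)) * (enorm2 (x - o) * (1 - enorm2 x)^-1).
  by apply/funext => y; exact: coshd_prod.
rewrite partialD; [|exact: differentiable_cst|by apply: differentiableM => //; exact: differentiable_cst].
rewrite partial_cst add0r partialM//.
rewrite partial_cst mul0r add0r partialM// partial_enorm2 partial_ainv// /c /q.
by field; rewrite !gt_eqF.
Qed.

Let P (x : E) := \sum_(i < N) x 0 i * (x 0 i - o 0 i).

(** Eliminates the inner product [P]. The geometric identities below thereby become rational
    identities in [1 - |x|^2], [1 - |o|^2] and [q]. *)
Lemma enorm2_oE x : enorm2 o = enorm2 x - 2 * P x + q x.
Proof.
rewrite /P /q /enorm2 mulr_sumr -sumrB -big_split /=.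
by apply: eq_bigr => i _; rewrite !mxE; ring.
Qed.

Lemma sum_sqr_c x : \sum_(i < N) c i x ^+ 2 =
  (1 - enorm2 x) ^+ 2 * q x + 2 * (1 - enorm2 x) * q x * P x + q x ^+ 2 * enorm2 x.
Proof.
have H A Q : \sum_(i < N) (A * (x 0 i - o 0 i) + Q * x 0 i) ^+ 2 =
    A ^+ 2 * enorm2 (x - o) + 2 * A * Q * P x + Q ^+ 2 * enorm2 x.
  rewrite /P /enorm2 !mulr_sumr -!big_split /=.
  by apply: eq_bigr => i _; rewrite !mxE; ring.
by rewrite H.
Qed.

(** The eikonal equation [|grad r| = 1] read in the variable [cosh r], where the right-hand side is
    [sinh^2 r]. *)
Lemma hdot_coshd x : hball x -> hdot coshd coshd x = coshd x ^+ 2 - 1.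
Proof.
move=> hx; have h := a0 hx; rewrite /hdot.
rewrite (eq_bigr (fun i => (4 / (1 - enorm2 o) * (1 - enorm2 x)^-1 ^+ 2) ^+ 2 * c i x ^+ 2)); last first.
  by move=> i _; rewrite partial_coshd//; ring.
rewrite -mulr_sumr sum_sqr_c /coshd -/(q x).
have Pe : P x = (1 - enorm2 o - (1 - enorm2 x) + q x) / 2 by rewrite (enorm2_oE x); field.
move: h b0; rewrite Pe.
have -> : enorm2 x = 1 - (1 - enorm2 x) by ring.
move: (1 - enorm2 x) (1 - enorm2 o) => a b a00 b00.
by field; rewrite !gt_eqF.
Qed.

Let e (i : 'I_N) (x : E) := (1 - enorm2 x)^-1 ^+ N * c i x.

Let smooth_c i : smooth_on hball (c i).
Proof.
have ex : smooth_on hball (fun x : E => x 0 i) by exact: smooth_on_coord.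
apply: smooth_onD => //; apply: smooth_onM => //.
- exact: smooth_on_a.
- by apply: smooth_onB => //; exact: smooth_on_cst.
- exact: smooth_on_enorm2.
Qed.

Let smooth_e i : smooth_on hball (e i).
Proof.
apply: smooth_onM => //.
by apply: smooth_onX => //; exact: smooth_on_ainv.
Qed.

Lemma partial_c i x : hball x -> partial i (c i) x = 1 - enorm2 x + q x.
Proof.
move=> hx.
have dc : differentiable (fun y : E => y 0 i) x by exact: differentiable_coord.
have d0 : differentiable (fun y : E => y 0 i - o 0 i) x.
  by apply: differentiableB => //; exact: differentiable_cst.
have d1 : differentiable (fun y : E => enorm2 (y - o)) x.
  by apply: (@smooth_on_diff _ _ hball) => //; exact: smooth_on_enorm2.
have d2 : differentiable (fun y : E => 1 - enorm2 y) x.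
  by apply: (@smooth_on_diff _ _ hball) => //; exact: smooth_on_a.
have p0 : partial i (fun y : E => y 0 i - o 0 i) x = 1.
  rewrite (partialD i (v := fun=> - o 0 i))//.
  by rewrite partial_cst partial_coord addr0 eqxx.
rewrite /c /q partialD; [|exact: differentiableM|exact: differentiableM].
have pc : partial i (fun y : E => y 0 i) x = 1 by rewrite partial_coord eqxx.
by rewrite !partialM// p0 partial_a partial_enorm2 pc /q; ring.
Qed.

Lemma partial_e i x : hball x -> partial i (e i) x =
  (1 - enorm2 x)^-1 ^+ N.+1 * (N%:R * (2 * x 0 i) * c i x + (1 - enorm2 x) * (1 - enorm2 x + q x)).
Proof.
move=> hx; have h := a0 hx.
have d2 : differentiable (fun y : E => (1 - enorm2 y)^-1) x.
  by apply: (@smooth_on_diff _ _ hball) => //; exact: smooth_on_ainv.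
have d3 : differentiable (fun y : E => (1 - enorm2 y)^-1 ^+ N) x.
  by apply: (@smooth_on_diff _ _ hball) => //; apply: smooth_onX => //; exact: smooth_on_ainv.
rewrite /e partialM//; last exact: (smooth_on_diff (smooth_c i)).
rewrite partial_c// (@partial_comp _ _ i (fun t => t ^+ N) _ (fun y : E => (1 - enorm2 y)^-1) x (is_derive1_exp _ _) d2).
rewrite partial_ainv//.
(* Absorbs the predecessor in the exponent; for [n = 0] both sides vanish through the factor [n]. *)
have aux n (A T : R) : n%:R * T ^+ n.-1 * (A * T ^+ 2) = T ^+ n.+1 * (n%:R * A).
  by case: n => [|n] /=; rewrite ?mul0r ?mulr0//= !exprS; ring.
rewrite aux !exprS; move: (_ ^+ N) => A.
by field; rewrite gt_eqF.
Qed.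

(** The eigenvalue identity [Delta (cosh r) = N cosh r] in coordinates: the factor in front is the
    volume density up to the constant [2 ^ N / (1 - |o|^2)] that relates [e] to the weighted
    gradient. *)
Lemma div_e x : hball x -> \sum_(i < N) partial i (e i) x =
  (1 - enorm2 x)^-1 ^+ N * (1 - enorm2 o) * (N%:R * coshd x).
Proof.
move=> hx; have h := a0 hx.
rewrite (eq_bigr (fun i => (1 - enorm2 x)^-1 ^+ N.+1 * (N%:R * (2 * (1 - enorm2 x))) * (x 0 i * (x 0 i - o 0 i)) +
  ((1 - enorm2 x)^-1 ^+ N.+1 * (N%:R * 2 * q x) * x 0 i ^+ 2 + (1 - enorm2 x)^-1 ^+ N.+1 * ((1 - enorm2 x) * (1 - enorm2 x + q x))))); last first.
  by move=> i _; rewrite partial_e// /c; ring.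
rewrite !big_split /= -!mulr_sumr -/(P x) -/(enorm2 x) sumr_const card_ord -[_ *+ N]mulr_natl.
rewrite /coshd -/(q x).
have Pe : P x = (1 - enorm2 o - (1 - enorm2 x) + q x) / 2 by rewrite (enorm2_oE x); field.
move: h b0; rewrite Pe exprS.
have -> : enorm2 x = 1 - (1 - enorm2 x) by ring.
rewrite (_ : 1 - (1 - (1 - enorm2 x)) = 1 - enorm2 x); last by ring.
move: (_^-1 ^+ N) => A; move: (1 - enorm2 x) (1 - enorm2 o) => a b a00 b00.
by field; rewrite !gt_eqF.
Qed.

Lemma closed_enorm2_le (rho : R) : closed [set x : E | enorm2 x <= rho].
Proof. by apply: (closed_comp _ (@closed_le R rho)) => x _; exact: continuous_enorm20. Qed.

(* The vector field [w * e] is, up to the constant [2 ^ N / (1 - |o|^2)], the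
   hyperbolic field [w * grad (cosh r)] weighted by the volume density. *)
Lemma integral_div_coshd (mu : {sigma_finite_measure set BE -> \bar R}) w rho :
  is_lebesgue_upto N mu -> smooth_on hball w -> rho < 1 ->
  (forall x, hball x -> rho <= enorm2 x -> w x = 0) ->
  (\int[mu]_x (hdens x * (hdot w coshd x + N%:R * coshd x * w x))%:E = 0)%E.
Proof.
move=> muP Sw rho1 w0.
(* Nothing is known about [w] outside the ball. Truncation costs no smoothness because [w] already
   vanishes on the collar between [rho] and the unit sphere. *)
pose Z i x := if in_ball x then w x * e i x else 0.
pose K := [set x : E | enorm2 x <= rho].
have KB : K `<=` hball by move=> x /= /le_lt_trans; exact.
have SZB i : smooth_on hball (Z i).
  apply: (@smooth_on_eq _ _ _ (fun x => w x * e i x)) => //; last exact: smooth_onM.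
  by move=> x hx; rewrite /Z /in_ball hx.
have Z0 i x : ~ K x -> Z i x = 0.
  move=> /negP; rewrite -ltNge => hx; rewrite /Z /in_ball; case: ifP => // hB.
  by rewrite w0 ?mul0r// ltW.
have SZ i : smooth_on setT (Z i).
  by apply: (smooth_on_glue oB (@closed_enorm2_le rho) KB) => // x; exact: Z0.
have Z1 i x : 1 <= enorm2 x -> Z i x = 0.
  by move=> hx; apply: Z0 => /= h; move: (lt_le_trans (le_lt_trans h rho1) hx); rewrite ltxx.
have pZ0 i x : 1 <= enorm2 x -> partial i (Z i) x = 0.
  move=> hx; rewrite (@partial_eq_on _ _ [set x | rho < enorm2 x] (Z i) (fun=> 0)).
  - by rewrite partial_cst.
  - by apply: (open_comp _ (@open_gt R rho)) => y _; exact: continuous_enorm20.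
  - by move=> y /= hy; apply: Z0 => /=; apply/negP; rewrite -ltNge.
  - by rewrite /= (lt_le_trans rho1).
transitivity (\int[mu]_x \sum_(i < N) (2 ^+ N / (1 - enorm2 o) * partial i (Z i) x)%:E)%E.
  apply: eq_integral => x _; rewrite sumEFin; congr EFin.
  rewrite /hdens; case: ifPn => hB; last first.
    rewrite mul0r big1// => i _; rewrite pZ0 ?mulr0//.
    by rewrite leNgt.
  have h := a0 hB; rewrite -mulr_sumr.
  rewrite (eq_bigr (fun i => partial i w x * e i x + w x * partial i (e i) x)); last first.
    move=> i _; rewrite (@partial_eq_on _ _ hball (Z i) (fun x => w x * e i x))//.
      by rewrite partialM//; [exact: smooth_on_diff Sw _|exact: smooth_on_diff (smooth_e i) _].
    by move=> y hy; rewrite /Z /in_ball hy.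
  rewrite big_split /= -mulr_sumr div_e//.
  have -> : \sum_(i < N) partial i w x * e i x =
    (1 - enorm2 x)^-1 ^+ N * (1 - enorm2 o) * hdot w coshd x.
    rewrite /hdot !mulr_sumr; apply: eq_bigr => i _; rewrite partial_coshd// /e.
    by field; rewrite !gt_eqF.
  rewrite exprMn; move: b0; move: (_^-1 ^+ N) (1 - enorm2 o) => A b b00.
  by field; rewrite gt_eqF.
have iZ i : mu.-integrable setT (fun x : BE => (2 ^+ N / (1 - enorm2 o) * partial i (Z i) x)%:E).
  apply: (integrable_continuous_support muP (u := fun x => 2 ^+ N / (1 - enorm2 o) * partial i (Z i) x)).
    move=> x; apply: (@smooth_on_continuous _ _ setT) => //.
    by apply: smooth_onM; [exact: openT|exact: smooth_on_cst|exact: smooth_on_partial].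
  by move=> x hx; rewrite pZ0 ?mulr0.
rewrite integral_sum//; apply: big1 => i _.
under eq_integral do rewrite EFinM.
rewrite integralZl//; last first.
  apply: (integrable_continuous_support muP (u := partial i (Z i))); last exact: pZ0.
  by move=> x; apply: (@smooth_on_continuous _ _ setT) => //; exact: smooth_on_partial.
by rewrite (integral_partial muP i (SZ i) (Z1 i)) mule0.
Qed.

End Geometry.

Arguments hball {R N} _.

(** * The radial ground state *)

(** The rules produce derivatives in unsimplified shape. This is why the derivatives below keep
    terms such as [0 * x] and are brought to a readable form by [field] or [ring] beforehand. *)
Ltac derive1 := repeat first
  [ assumption | exact: is_derive_cst | exact: is_derive_id | exact: is_derive1_exp
  | apply: is_derive1D | apply: is_deriveN | apply: is_derive1M ].

Section HyperbolicFunctions.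
Variable R : realType.
Implicit Types s t r y : R.

Lemma le_of_derive_ge0 (F dF : R -> R) y : (forall z : R, 0 < z -> is_derive z 1 F (dF z)) ->
  (forall z : R, 0 < z -> 0 <= dF z) -> 1 <= y -> F 1 <= F y.
Proof.
move=> DF dF0; rewrite le_eqVlt => /orP[/eqP <-//|y1].
have zp z : z \in `[1, y] -> 0 < z by rewrite in_itv /= => /andP[/(lt_le_trans ltr01)].
have [|z zy|z zI E] := @MVT R F dF 1 y y1.
- by move=> z zI; apply: DF; apply: zp; exact: subset_itv_oo_cc zI.
- apply: continuous_in_subspaceT => t; rewrite inE => /zp t0.
  by apply: differentiable_continuous; apply/derivable1_diffP; have [] := DF t t0.
- have zp' : 0 < z by apply: zp; exact: subset_itv_oo_cc zI.
  by rewrite -subr_ge0 E mulr_ge0 ?dF0// subr_ge0 ltW.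
Qed.

(** With [y = exp r] this is [r <= sinh r]. The derivative of the difference is the square
    [(1 - 1/z)^2 / 2]. *)
Lemma ln_le_sinh y : 1 <= y -> ln y <= (y - y^-1) / 2.
Proof.
move=> y1; have := @le_of_derive_ge0 (fun z : R => (z + - z^-1) / 2 + - ln z)
  (fun z : R => (1 + - - (z^-1 * z^-1)) / 2 + (z + - z^-1) * 0 + - z^-1) y.
rewrite ln1 invr1 subrr mul0r oppr0 addr0 => /(_ _ _ y1) H.
rewrite -subr_ge0; apply: H => z z0.
  have dln := is_derive1_ln z0.
  have dinv : is_derive z 1 (@GRing.inv R) (- (z^-1 * z^-1)) by apply: is_derive1_inv; rewrite gt_eqF.
  derive1.
have -> : (1 + - - (z^-1 * z^-1)) / 2 + (z + - z^-1) * 0 + - z^-1 = (1 - z^-1) ^+ 2 / 2 by field; rewrite gt_eqF.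
by rewrite divr_ge0 ?sqr_ge0.
Qed.

(** With [y = exp r] this is [tanh r <= r]. Written as [1 - 2 / (y^2 + 1)], the left side leaves a
    difference whose derivative is [(z^2 - 1)^2 / (z (z^2 + 1)^2)]. *)
Lemma tanh_le_ln y : 1 <= y -> (y - y^-1) / (y + y^-1) <= ln y.
Proof.
move=> y1; have y0 : 0 < y by exact: lt_le_trans y1.
have p2 (z : R) : 0 < z -> 0 < z ^+ 2 + 1 by move=> z0; rewrite addr_gt0 ?exprn_gt0.
have -> : (y - y^-1) / (y + y^-1) = 1 - 2 / (y ^+ 2 + 1).
  by have h := p2 _ y0; field; rewrite !gt_eqF.
have := @le_of_derive_ge0 (fun z : R => ln z + (-1 + 2 * (z ^+ 2 + 1)^-1))
  (fun z : R => z^-1 + (0 + (0 * (z ^+ 2 + 1)^-1 + 2 * (- ((z ^+ 2 + 1)^-1 * (z ^+ 2 + 1)^-1) * (2%:R * z ^+ 1 + 0))))) y.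
rewrite ln1 expr1n add0r => H.
have {}H : -1 + 2 * (1 + 1)^-1 <= ln y + (-1 + 2 * (y ^+ 2 + 1)^-1).
  apply: H => // z z0; have h := p2 _ z0.
    have dln := is_derive1_ln z0.
    have dinv : is_derive z 1 (fun z : R => (z ^+ 2 + 1)^-1) (- ((z ^+ 2 + 1)^-1 * (z ^+ 2 + 1)^-1) * (2%:R * z ^+ 1 + 0)).
      apply: (is_derive1_comp (f := @GRing.inv R) (g := fun z : R => z ^+ 2 + 1)); last by derive1.
      by apply: is_derive1_inv; rewrite gt_eqF.
    derive1.
  have -> : z^-1 + (0 + (0 * (z ^+ 2 + 1)^-1 + 2 * (- ((z ^+ 2 + 1)^-1 * (z ^+ 2 + 1)^-1) * (2%:R * z ^+ 1 + 0))))
    = (z ^+ 2 - 1) ^+ 2 / (z * (z ^+ 2 + 1) ^+ 2).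
    by field; rewrite -?expr2 !gt_eqF.
  by rewrite divr_ge0 ?sqr_ge0// mulr_ge0 ?ltW// exprn_gt0.
have E0 : -1 + 2 * (1 + 1)^-1 = 0 :> R by field.
by rewrite E0 in H; lra.
Qed.

Definition sh s : R := Num.sqrt (s ^+ 2 - 1).

Lemma sqrB1_gt0 s : 1 < s -> 0 < s ^+ 2 - 1.
Proof. by move=> s1; rewrite subr_gt0 expr_gt1// ltW// (lt_trans ltr01). Qed.

Lemma sqr_sh s : 1 <= s -> sh s ^+ 2 = s ^+ 2 - 1.
Proof. by move=> s1; rewrite sqr_sqrtr// subr_ge0 expr_ge1// (le_trans ler01). Qed.

Lemma sh_gt0 s : 1 < s -> 0 < sh s.
Proof. by move=> s1; rewrite sqrtr_gt0 sqrB1_gt0. Qed.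

Lemma acoshE s : acosh s = ln (s + sh s). Proof. by []. Qed.

Lemma inv_acosh_arg s : 1 <= s -> (s + sh s)^-1 = s - sh s.
Proof.
move=> s1; have s0 : 0 < s + sh s by rewrite ltr_wpDr ?sqrtr_ge0// (lt_le_trans ltr01).
apply: (mulfI (lt0r_neq0 s0)); rewrite mulfV ?gt_eqF//.
have -> : (s + sh s) * (s - sh s) = s ^+ 2 - sh s ^+ 2 by ring.
by rewrite sqr_sh//; ring.
Qed.

Lemma acosh_arg_ge1 s : 1 <= s -> 1 <= s + sh s.
Proof. by move=> s1; rewrite (le_trans s1)// lerDl sqrtr_ge0. Qed.

Lemma sinh_acosh s : 1 <= s -> sinh (acosh s) = sh s.
Proof.
move=> s1; have s0 : 0 < s + sh s by rewrite (lt_le_trans ltr01)// acosh_arg_ge1.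
by rewrite /sinh expRN acoshE lnK ?posrE// inv_acosh_arg//; field.
Qed.

Lemma acosh1 : acosh 1 = 0 :> R.
Proof. by rewrite acoshE /sh expr1n subrr sqrtr0 addr0 ln1. Qed.

Lemma acosh_gt0 s : 1 < s -> 0 < acosh s.
Proof. by move=> s1; rewrite acoshE ln_gt0// (lt_le_trans s1)// lerDl sqrtr_ge0. Qed.

Lemma acosh_le_sh s : 1 <= s -> acosh s <= sh s.
Proof.
move=> s1; have := ln_le_sinh (acosh_arg_ge1 s1); rewrite inv_acosh_arg// acoshE.
by have -> : (s + sh s - (s - sh s)) / 2 = sh s by field.
Qed.

Lemma sh_le_acosh s : 1 <= s -> sh s <= s * acosh s.
Proof.
move=> s1; have := tanh_le_ln (acosh_arg_ge1 s1); rewrite inv_acosh_arg// acoshE.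
have s0 : 0 < s by exact: lt_le_trans s1.
have -> : (s + sh s - (s - sh s)) / (s + sh s + (s - sh s)) = sh s / s.
  by field; rewrite gt_eqF//= (_ : s + _ + _ = 2 * s) ?gt_eqF ?mulr_gt0//; ring.
by rewrite ler_pdivrMr// mulrC.
Qed.

Lemma is_derive_sh s : 1 < s -> is_derive s 1 sh (s / sh s).
Proof.
move=> s1; have -> : s / sh s = (2 * sh s)^-1 * (2%:R * s ^+ 1 + 0).
  by rewrite expr1 addr0; field; rewrite gt_eqF// sh_gt0.
apply: (is_derive1_comp (f := @Num.sqrt R) (g := fun s : R => s ^+ 2 + - 1)).
  by apply: is_derive1_sqrt; exact: sqrB1_gt0.
by derive1.
Qed.

Lemma is_derive_acosh s : 1 < s -> is_derive s 1 (@acosh R) (sh s)^-1.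
Proof.
move=> s1; have sp := sh_gt0 s1.
have s0 : 0 < s + sh s by rewrite addr_gt0// (lt_trans ltr01).
have -> : (sh s)^-1 = (s + sh s)^-1 * (1 + s / sh s) by field; rewrite !gt_eqF.
apply: (is_derive1_comp (f := @ln R) (g := fun s : R => s + sh s)); first exact: is_derive1_ln.
by have := is_derive_sh s1; derive1.
Qed.

Definition tlog s : R := ln (acosh s).

Lemma is_derive_tlog s : 1 < s -> is_derive s 1 tlog (acosh s * sh s)^-1.
Proof.
move=> s1; rewrite invfM.
apply: (is_derive1_comp (f := @ln R) (g := @acosh R)); last exact: is_derive_acosh.
by apply: is_derive1_ln; exact: acosh_gt0.
Qed.

Section GroundState.
Variable c : R.

(* [gphi] is the radial ground state in the variable [s = cosh r], with
   [c = (N - 1) / 2]; [gslope] is minus its logarithmic derivative. *)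
Definition gphi s : R := expR (tlog s / 2 - c / 2 * ln (s ^+ 2 - 1)).
Definition gslope s : R := c * s / (s ^+ 2 - 1) - (2 * acosh s * sh s)^-1.
Definition gslope' s : R := - c * (s ^+ 2 + 1) / (s ^+ 2 - 1) ^+ 2 +
  (1 + acosh s * s / sh s) / (2 * acosh s ^+ 2 * (s ^+ 2 - 1)).
(** The whole zero-order term of the operator, spectral bottom included: for [c = (N - 1) / 2] one
    has [c^2 = (N - 1)^2 / 4] and [c^2 - c = (N - 1)(N - 3) / 4]. *)
Definition gpot s : R := c ^+ 2 + 1 / (4 * acosh s ^+ 2) + (c ^+ 2 - c) / (s ^+ 2 - 1).

Lemma is_derive_gphi s : 1 < s -> is_derive s 1 gphi (- gslope s * gphi s).
Proof.
move=> s1; have [[rp sp] zp] := (acosh_gt0 s1, sh_gt0 s1, sqrB1_gt0 s1).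
have -> : - gslope s * gphi s = gphi s * (((acosh s * sh s)^-1 * 2^-1 + tlog s * 0) +
    (0 * - ln (s ^+ 2 - 1) + c / 2 * - ((s ^+ 2 - 1)^-1 * (2%:R * s ^+ 1 + 0)))).
  by rewrite /gslope; field; rewrite !gt_eqF.
rewrite (_ : gphi = (@expR R) \o (fun s : R => tlog s * 2^-1 + c / 2 * - ln (s ^+ 2 - 1))); last first.
  by apply/funext => z; rewrite /gphi /= mulrN.
apply: is_derive1_comp => /=; have dt := is_derive_tlog s1.
have dln : is_derive s 1 (fun s : R => ln (s ^+ 2 - 1)) ((s ^+ 2 - 1)^-1 * (2%:R * s ^+ 1 + 0)).
  apply: (is_derive1_comp (f := @ln R) (g := fun s : R => s ^+ 2 + - 1)); last by derive1.
  exact: is_derive1_ln.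
derive1.
Qed.

Lemma is_derive_gslope s : 1 < s -> is_derive s 1 gslope (gslope' s).
Proof.
move=> s1; have [[rp sp] zp] := (acosh_gt0 s1, sh_gt0 s1, sqrB1_gt0 s1).
have e2 := sqr_sh (ltW s1).
have -> : gslope' s = ((0 * s + c * 1) * (s ^+ 2 - 1)^-1 + c * s * (- ((s ^+ 2 - 1)^-1 * (s ^+ 2 - 1)^-1) * (2%:R * s ^+ 1 + 0))) +
   - (- ((2 * acosh s * sh s)^-1 * (2 * acosh s * sh s)^-1) * ((0 * acosh s + 2 * (sh s)^-1) * sh s + 2 * acosh s * (s / sh s))).
  congr (_ + _); first by field; rewrite gt_eqF.
  by rewrite -e2; field; rewrite !gt_eqF.
have dinv : is_derive s 1 (fun s : R => (s ^+ 2 - 1)^-1) (- ((s ^+ 2 - 1)^-1 * (s ^+ 2 - 1)^-1) * (2%:R * s ^+ 1 + 0)).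
  apply: (is_derive1_comp (f := @GRing.inv R) (g := fun s : R => s ^+ 2 + - 1)); last by derive1.
  by apply: is_derive1_inv; rewrite gt_eqF.
have [da ds] := (is_derive_acosh s1, is_derive_sh s1).
have dinv2 : is_derive s 1 (fun s : R => (2 * acosh s * sh s)^-1) (- ((2 * acosh s * sh s)^-1 * (2 * acosh s * sh s)^-1) * ((0 * acosh s + 2 * (sh s)^-1) * sh s + 2 * acosh s * (s / sh s))).
  apply: (is_derive1_comp (f := @GRing.inv R) (g := fun s : R => 2 * acosh s * sh s)); last by derive1.
  by apply: is_derive1_inv; rewrite gt_eqF// !mulr_gt0.
derive1.
Qed.

(** This is [- Delta phi = gpot phi] after [phi' = - gslope phi]: on functions of [s] the Laplacian
    is [(s^2 - 1) d^2/ds^2 + N s d/ds], and [N = 2 c + 1]. *)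
Lemma riccati s : 1 < s ->
  (2 * c + 1) * s * gslope s + (gslope' s - gslope s ^+ 2) * (s ^+ 2 - 1) = gpot s.
Proof.
move=> s1; have [[rp sp] zp] := (acosh_gt0 s1, sh_gt0 s1, sqrB1_gt0 s1).
have e2 := sqr_sh (ltW s1).
rewrite /gslope /gslope' /gpot -e2; move: e2 => /eqP; rewrite eq_sym subr_eq => /eqP e2.
have e3 : s ^+ 2 * s = (sh s ^+ 2 + 1) * s by rewrite e2.
(* The products are expanded to expose [s ^+ 2] to [e2]; [field] by itself does not know the
   relation between [s] and [sh s]. *)
have -> : (2 * c + 1) * s * (c * s / sh s ^+ 2 - (2 * acosh s * sh s)^-1) =
   (2 * c + 1) * (c * s ^+ 2 / sh s ^+ 2 - s * (2 * acosh s * sh s)^-1) by ring.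
have -> : (c * s / sh s ^+ 2 - (2 * acosh s * sh s)^-1) ^+ 2 = c ^+ 2 * s ^+ 2 / sh s ^+ 4 -
   c * s / (sh s ^+ 3 * acosh s) + (2 * acosh s * sh s)^-1 ^+ 2.
  by field; rewrite !gt_eqF.
by rewrite e2; field; rewrite !gt_eqF.
Qed.

Hypothesis c1 : 1 <= c.

(** The last term of [gpot] is nonnegative, [r <= sinh r], and [c^2 >= 1 >= 1/4], so [gpot] is at
    least [1/4 + 1 / (4 sinh^2 r) = s^2 / (4 sinh^2 r)]. One factor [s] is given up to match the
    leading term of [gslope]. *)
Lemma gpot_ge s : 1 < s -> s / (4 * (s ^+ 2 - 1)) <= gpot s.
Proof.
move=> s1; have [[rp sp] zp] := (acosh_gt0 s1, sh_gt0 s1, sqrB1_gt0 s1).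
have h1 : (s ^+ 2 - 1)^-1 <= (acosh s ^+ 2)^-1.
  rewrite lef_pV2 ?posrE ?exprn_gt0// -(sqr_sh (ltW s1)).
  by apply: lerXn2r; rewrite ?nnegrE; [exact: ltW|exact: ltW|exact/acosh_le_sh/ltW].
have h2 : 0 <= (c ^+ 2 - c) / (s ^+ 2 - 1).
  by rewrite divr_ge0 ?(ltW zp)// subr_ge0 expr2 ler_peMl// (le_trans ler01).
have h3 : 1 <= c ^+ 2 by rewrite expr_ge1 ?(le_trans ler01).
have h4 : s / (4 * (s ^+ 2 - 1)) <= (1 + (s ^+ 2 - 1)^-1) / 4.
  have -> : (1 + (s ^+ 2 - 1)^-1) / 4 = s ^+ 2 / (4 * (s ^+ 2 - 1)) by field; rewrite gt_eqF.
  rewrite ler_pM2r ?invr_gt0 ?mulr_gt0// expr2 ler_pMr ?ltW// (lt_trans ltr01)//.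
rewrite /gpot.
have -> : 1 / (4 * acosh s ^+ 2) = (acosh s ^+ 2)^-1 / 4 by field; rewrite gt_eqF.
move: h1 h2 h3 h4; set A := (c ^+ 2 - c) / _; set D := s / _; set B := (acosh s ^+ 2)^-1.
set C := (s ^+ 2 - 1)^-1; clearbody A B C D; lra.
Qed.

Lemma gpot_gt0 s : 1 < s -> 0 < gpot s.
Proof.
move=> s1; apply: lt_le_trans (gpot_ge s1).
apply: divr_gt0; first exact: lt_trans s1.
by apply: mulr_gt0 => //; exact: sqrB1_gt0.
Qed.

(** The leading term of [gslope] is exactly [4 c] times the lower bound in [gpot_ge]. It lets the
    error caused by shifting [s] be absorbed into the potential. *)
Lemma gslope_le_gpot s : 1 < s -> gslope s <= 4 * c * gpot s.
Proof.
move=> s1; have [[rp sp] zp] := (acosh_gt0 s1, sh_gt0 s1, sqrB1_gt0 s1).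
apply: (@le_trans _ _ (4 * c * (s / (4 * (s ^+ 2 - 1))))).
  have -> : 4 * c * (s / (4 * (s ^+ 2 - 1))) = c * s / (s ^+ 2 - 1) by field; rewrite gt_eqF.
  by rewrite /gslope lerBlDr lerDl invr_ge0 !mulr_ge0// ltW.
by rewrite ler_pM2l ?gpot_ge// mulr_gt0// (lt_le_trans ltr01).
Qed.

(** Over a common denominator the numerator is [sinh^2 r + r s sinh r - 2 c r^2 (s^2 + 1)]. By
    [tanh r <= r] the first two terms are at most [s^2 r^2] each, and [c >= 1] does the rest. *)
Lemma gslope'_le0 s : 1 < s -> gslope' s <= 0.
Proof.
move=> s1; have [[rp sp] zp] := (acosh_gt0 s1, sh_gt0 s1, sqrB1_gt0 s1).
have e2 := sqr_sh (ltW s1).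
have s0 : 0 < s by rewrite (lt_trans ltr01).
have h := sh_le_acosh (ltW s1).
have -> : gslope' s = (sh s ^+ 2 + acosh s * s * sh s - 2 * c * acosh s ^+ 2 * (s ^+ 2 + 1)) /
    (2 * acosh s ^+ 2 * sh s ^+ 4).
  rewrite /gslope' -e2; field; rewrite !gt_eqF//.
apply: mulr_le0_ge0; last by rewrite invr_ge0 !mulr_ge0 ?exprn_ge0// ltW.
have h1 : sh s ^+ 2 <= (s * acosh s) ^+ 2 by rewrite lerXn2r ?nnegrE ?mulr_ge0// ltW.
have h2 : acosh s * s * sh s <= (s * acosh s) ^+ 2.
  by rewrite expr2 (mulrC (acosh s)) ler_wpM2l// mulr_ge0// ltW.
have h3 : acosh s ^+ 2 * (s ^+ 2 + 1) <= c * (acosh s ^+ 2 * (s ^+ 2 + 1)).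
  by rewrite ler_peMl// mulr_ge0 ?addr_ge0 ?sqr_ge0.
have h4 : 0 <= acosh s ^+ 2 by exact: sqr_ge0.
rewrite exprMn in h1 h2; nra.
Qed.

End GroundState.
End HyperbolicFunctions.

(** * A smooth step *)

Section SmoothStep.
Variable R : realType.
Implicit Types (t : R) (k : nat).

(** The classical flat function with the powers [t^-k] that differentiation creates. The derivative
    of a member is a combination of members, so smoothness is proved for all [k] at once. *)
Definition flat k t : R := if 0 < t then t^-1 ^+ k * expR (- t^-1) else 0.

Lemma flat_gt0 k t : 0 < t -> 0 < flat k t.
Proof. by move=> t0; rewrite /flat t0 mulr_gt0 ?expR_gt0 ?exprn_gt0 ?invr_gt0. Qed.

Lemma flat_ge0 k t : 0 <= flat k t.
Proof. by rewrite /flat; case: ifP => // t0; rewrite mulr_ge0 ?expR_ge0 ?exprn_ge0 ?invr_ge0 ?ltW. Qed.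

Lemma flat_le0 k t : t <= 0 -> flat k t = 0.
Proof. by rewrite /flat leNgt => /negbTE ->. Qed.

(** From [exp y >= y^(k+2) / (k+2)!] at [y = 1/t]. Two spare powers of [t] give continuity at 0, and
    a uniform bound for [t <= 1]. *)
Lemma flat_le k t : flat k t <= (k.+2)`!%:R * t ^+ 2.
Proof.
have [t0|t0] := ltP 0 t; last by rewrite flat_le0// mulr_ge0 ?sqr_ge0.
have y0 : 0 < t^-1 by rewrite invr_gt0.
have F0 : 0 < (k.+2)`!%:R :> R by rewrite ltr0n fact_gt0.
have := expR_ge1Dxn k.+1 (ltW y0); move=> H.
have {}H : t^-1 ^+ k.+2 / (k.+2)`!%:R <= expR t^-1 by apply: le_trans H; rewrite lerDr.
rewrite /flat t0 expRN ler_pdivrMr ?expR_gt0//.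
apply: le_trans (ler_wpM2l _ H); last by rewrite mulr_ge0 ?ltW// exprn_gt0.
rewrite le_eqVlt; apply/orP; left; apply/eqP.
rewrite !exprS !exprVn; have tk : t ^+ k != 0 by rewrite expf_neq0// gt_eqF.
by field; rewrite tk !gt_eqF.
Qed.

Lemma flat_le1 k t : t <= 1 -> flat k t <= (k.+2)`!%:R.
Proof.
have [t0 t1|t0 _] := ltP 0 t; last by rewrite flat_le0.
apply: le_trans (flat_le k t) _; rewrite ler_piMr// expr_le1// ltW//.
Qed.

Lemma is_derive_flat k t : is_derive t 1 (flat k) (flat k.+2 t - k%:R * flat k.+1 t).
Proof.
have [t0|t0|<-] := ltgtP 0 t.
- have : \forall z \near t, (fun z : R => z^-1 ^+ k * expR (- z^-1)) z = flat k z.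
    have : \forall z \near t, 0 < z by apply: open_nbhs_nbhs; split => //; exact: open_gt.
    by apply: filterS => z z0; rewrite /flat z0.
  move=> /near_eq_is_derive; apply.
  have dinv : is_derive t 1 (@GRing.inv R) (- (t^-1 * t^-1)) by apply: is_derive1_inv; rewrite gt_eqF.
  have dpow : is_derive t 1 (fun z : R => z^-1 ^+ k) (k%:R * t^-1 ^+ k.-1 * - (t^-1 * t^-1)).
    by apply: (is_derive1_comp (f := fun z : R => z ^+ k) (g := @GRing.inv R)); exact: is_derive1_exp.
  have dexp : is_derive t 1 (fun z : R => expR (- z^-1)) (expR (- t^-1) * - - (t^-1 * t^-1)).
    by apply: (is_derive1_comp (f := @expR R) (g := fun z : R => - z^-1)).
  have -> : flat k.+2 t - k%:R * flat k.+1 t =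
     k%:R * t^-1 ^+ k.-1 * - (t^-1 * t^-1) * expR (- t^-1) + t^-1 ^+ k * (expR (- t^-1) * - - (t^-1 * t^-1)).
    rewrite /flat t0; case: (k) => [|n] /=; rewrite !exprS; ring.
  exact: is_derive1M.
- rewrite !flat_le0 ?(ltW t0)// mulr0 subr0.
  have : \forall z \near t, (fun _ : R => 0 : R) z = flat k z.
    have : \forall z \near t, z < 0 by apply: open_nbhs_nbhs; split => //; exact: open_lt.
    by apply: filterS => z z0; rewrite flat_le0// ltW.
  by move=> /near_eq_is_derive; apply; exact: is_derive_cst.
rewrite !flat_le0 // mulr0 subr0.
(* At 0 the difference quotient is [flat k.+1] itself, because [flat k z = z * flat k.+1 z]; its
   continuity at 0 comes from [flat_le]. *)
apply/is_derive1_caratheodory; exists (flat k.+1); split.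
- move=> z; rewrite (flat_le0 k (lexx 0)) !subr0 /flat; case: ifP => [z0|_]; last by rewrite mul0r.
  by rewrite exprS; field; rewrite gt_eqF.
- have f0 : flat k.+1 0 = 0 by exact: flat_le0.
  have small (d : R) : 0 < d -> \forall z \near (0 : R), `|z| <= d.
    move=> d0; apply/nbhs_ballP; exists d => //= z.
    by rewrite /ball /= sub0r normrN => /ltW.
  apply/cvgrPdist_le => e e0.
  have F0 : 0 < (k.+3)`!%:R :> R by rewrite ltr0n fact_gt0.
  near=> z; rewrite f0 sub0r normrN ger0_norm ?flat_ge0//.
  apply: le_trans (flat_le _ _) _; rewrite -ler_pdivlMl//.
  have z1 : `|z| <= 1 by near: z; exact: small.
  have ze : `|z| <= (k.+3)`!%:R^-1 * e by near: z; apply: small; rewrite mulr_gt0// invr_gt0.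
  apply: le_trans ze; have -> : z ^+ 2 = `|z| * `|z| by rewrite -normrM -expr2 ger0_norm ?sqr_ge0.
  by rewrite ler_piMl.
- exact: flat_le0.
Unshelve. all: by end_near. Qed.

Definition stepden t : R := flat 0 t + flat 0 (1 - t).
Definition step t : R := flat 0 t / stepden t.
Definition step' t : R :=
  (flat 2 t * flat 0 (1 - t) + flat 0 t * flat 2 (1 - t)) / stepden t ^+ 2.

Lemma stepden_gt0 t : 0 < stepden t.
Proof.
rewrite /stepden; have [t0|t0] := ltP 0 t.
  by rewrite ltr_pwDl ?flat_gt0// flat_ge0.
by rewrite ltr_wpDl ?flat_ge0// flat_gt0//; lra.
Qed.

Lemma is_derive_step t : is_derive t 1 step (step' t).
Proof.
have d0 := stepden_gt0 t.
have df1 : is_derive t 1 (flat 0) (flat 2 t - 0%:R * flat 1 t) by exact: is_derive_flat.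
have df2 : is_derive t 1 (fun t : R => flat 0 (1 - t)) ((flat 2 (1 - t) - 0%:R * flat 1 (1 - t)) * (0 + - 1)).
  apply: (is_derive1_comp (f := flat 0) (g := fun t : R => 1 + - t)); first exact: is_derive_flat.
  derive1.
have ds : is_derive t 1 stepden (flat 2 t - 0%:R * flat 1 t + (flat 2 (1 - t) - 0%:R * flat 1 (1 - t)) * (0 + - 1)).
  exact: (is_derive1D df1 df2).
have di : is_derive (stepden t) 1 (@GRing.inv R) (- ((stepden t)^-1 * (stepden t)^-1)).
  by apply: is_derive1_inv; rewrite gt_eqF.
have dinv := is_derive1_comp di ds.
have -> : step' t = (flat 2 t - 0%:R * flat 1 t) * (stepden t)^-1 + flat 0 t * (- ((stepden t)^-1 * (stepden t)^-1) *
    (flat 2 t - 0%:R * flat 1 t + (flat 2 (1 - t) - 0%:R * flat 1 (1 - t)) * (0 + - 1))).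
  rewrite /step'; have -> : flat 0 (1 - t) = stepden t - flat 0 t by rewrite /stepden; ring.
  by field; rewrite gt_eqF.
exact: is_derive1M.
Qed.

Lemma step'_ge0 t : 0 <= step' t.
Proof. by rewrite divr_ge0 ?sqr_ge0// addr_ge0// mulr_ge0 ?flat_ge0. Qed.

Lemma step_le0 t : t <= 0 -> step t = 0.
Proof. by move=> t0; rewrite /step flat_le0// mul0r. Qed.

Lemma step_ge1 t : 1 <= t -> step t = 1.
Proof.
move=> t1; have := stepden_gt0 t.
by rewrite /step /stepden (flat_le0 0 (t := 1 - t)) ?subr_le0// addr0 => h; rewrite divff// gt_eqF.
Qed.

Lemma step_ge0 t : 0 <= step t.
Proof. by rewrite divr_ge0 ?flat_ge0// ltW// stepden_gt0. Qed.

Lemma step_le1 t : step t <= 1.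
Proof. by rewrite ler_pdivrMr ?stepden_gt0// mul1r lerDl flat_ge0. Qed.

Lemma step'_eq0 t : t <= 0 \/ 1 <= t -> step' t = 0.
Proof.
case=> h; rewrite /step'.
  by rewrite !(flat_le0 _ h) !mul0r addr0 mul0r.
by rewrite !(flat_le0 _ (t := 1 - t)) ?subr_le0// !mulr0 addr0 mul0r.
Qed.

Lemma step'_half_gt0 : 0 < step' 2^-1.
Proof.
have h : 0 < 2^-1 :> R by rewrite invr_gt0.
have e1 : 1 - 2^-1 = 2^-1 :> R by field.
rewrite /step' e1 divr_gt0 ?exprn_gt0 ?stepden_gt0//.
by rewrite addr_gt0// mulr_gt0// flat_gt0.
Qed.

Lemma step'_bounded : exists2 M, 0 < M & forall t, step' t <= M.
Proof.
pose d : R := expR (- 2).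
have d0 : 0 < d by exact: expR_gt0.
(* The numerator is at most [4! 2! + 2! 4! = 96] on the unit interval. The denominator is at least
   [d ^+ 2], as one of [t] and [1 - t] is at least one half. *)
exists (96 / d ^+ 2); first by rewrite divr_gt0 ?exprn_gt0.
move=> t; have [t0|t0] := leP t 0.
  by rewrite step'_eq0; [rewrite divr_ge0 ?sqr_ge0|left].
have [t1|t1] := leP 1 t.
  by rewrite step'_eq0; [rewrite divr_ge0 ?sqr_ge0|right].
have big z : 2^-1 <= z -> d <= flat 0 z.
  move=> z2; have z0 : 0 < z by apply: lt_le_trans z2; rewrite invr_gt0.
  by rewrite /flat z0 expr0 mul1r ler_expR lerN2 invf_ple ?posrE.
have dd : d <= stepden t.
  rewrite /stepden; have [h|h] := leP 2^-1 t.
    by rewrite (le_trans (big _ h))// lerDl flat_ge0.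
  have h2 : 2^-1 <= 1 - t by lra.
  by rewrite (le_trans (big _ h2))// lerDr flat_ge0.
apply: ler_pM.
- by rewrite addr_ge0// mulr_ge0 ?flat_ge0.
- by rewrite invr_ge0 sqr_ge0.
- have b k z : z <= 1 -> flat k z <= (k.+2)`!%:R by exact: flat_le1.
  have [u1 u2] : t <= 1 /\ 1 - t <= 1 by lra.
  apply: (@le_trans _ _ (4`!%:R * 2`!%:R + 2`!%:R * 4`!%:R)).
    by apply: lerD; apply: ler_pM; rewrite ?flat_ge0// b.
  by rewrite -!natrM -natrD.
- rewrite lef_pV2 ?posrE ?exprn_gt0 ?stepden_gt0//.
  by apply: lerXn2r; rewrite ?nnegrE; [exact: ltW|exact: ltW (stepden_gt0 _)|exact: dd].
Qed.

Section SmoothOn.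
Variable N : nat.
Implicit Types (U : set 'rV[R]_N) (u : 'rV[R]_N -> R).

Lemma smooth_on_flat U u k : open U -> smooth_on U u -> smooth_on U (fun x => flat k (u x)).
Proof.
move=> oU Su n; elim: n k => [|n IH] k;
  apply: (@Cn_comp _ _ _ _ (flat k) (fun t => flat k.+2 t - k%:R * flat k.+1 t)) => //.
  by move=> x _; exact: is_derive_flat.
  by move=> x _; exact: is_derive_flat.
apply: (@Cn_eq _ _ _ _ (fun x => flat k.+2 (u x) + - k%:R * flat k.+1 (u x))) => //.
  by move=> x _; rewrite /= mulNr.
apply: CnD => //.
by apply: CnM => //; exact: Cn_cst.
Qed.

Lemma smooth_on_stepden U u : open U -> smooth_on U u -> smooth_on U (fun x => stepden (u x)).
Proof.
move=> oU Su; apply: smooth_onD => //; apply: smooth_on_flat => //.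
by apply: smooth_onB => //; exact: smooth_on_cst.
Qed.

Lemma smooth_on_step U u : open U -> smooth_on U u -> smooth_on U (fun x => step (u x)).
Proof.
move=> oU Su; apply: smooth_onM => //; first exact: smooth_on_flat.
apply: smooth_on_inv => //; last exact: smooth_on_stepden.
by move=> x _; rewrite gt_eqF// stepden_gt0.
Qed.

Lemma smooth_on_step' U u : open U -> smooth_on U u -> smooth_on U (fun x => step' (u x)).
Proof.
move=> oU Su; have S1 : smooth_on U (fun x => 1 - u x).
  by apply: smooth_onB => //; exact: smooth_on_cst.
apply: smooth_onM => //.
  by apply: smooth_onD => //; apply: smooth_onM => //; exact: smooth_on_flat.
apply: smooth_on_inv => //; last by apply: smooth_onX => //; exact: smooth_on_stepden.
by move=> x _; rewrite expf_neq0// gt_eqF// stepden_gt0.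
Qed.

End SmoothOn.
End SmoothStep.

(** * Radial functions *)

Section SmoothHyperbolic.
Variables (R : realType) (N : nat).
Implicit Types (U : set 'rV[R]_N) (u : 'rV[R]_N -> R).

Lemma smooth_on_sqrB1 U u : open U -> smooth_on U u -> smooth_on U (fun x => u x ^+ 2 - 1).
Proof.
by move=> oU Su; apply: smooth_onB => //; [exact: smooth_onX|exact: smooth_on_cst].
Qed.

Lemma smooth_on_ln_sqrB1 U u : open U -> (forall x, U x -> 1 < u x) -> smooth_on U u ->
  smooth_on U (fun x => ln (u x ^+ 2 - 1)).
Proof.
move=> oU u1 Su; apply: smooth_on_ln => //; last exact: smooth_on_sqrB1.
by move=> x Ux; apply: sqrB1_gt0; exact: u1.
Qed.

Lemma smooth_on_sh U u : open U -> (forall x, U x -> 1 < u x) -> smooth_on U u ->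
  smooth_on U (fun x => sh (u x)).
Proof.
(* The square root of a positive quantity is rewritten as the exponential of half its logarithm. *)
move=> oU u1 Su; apply: (@smooth_on_eq _ _ _ (fun x => expR (ln (u x ^+ 2 - 1) * 2^-1))) => //.
  move=> x Ux; have h := sqrB1_gt0 (u1 x Ux).
  rewrite -(@ger0_norm _ (expR _)) ?expR_ge0// -sqrtr_sqr -expRM_natr.
  by rewrite -mulrA mulVf ?mulr1 ?lnK ?posrE// pnatr_eq0.
apply: smooth_on_exp => //; apply: smooth_onM => //; last exact: smooth_on_cst.
exact: smooth_on_ln_sqrB1.
Qed.

Lemma smooth_on_acosh U u : open U -> (forall x, U x -> 1 < u x) -> smooth_on U u ->
  smooth_on U (fun x => acosh (u x)).
Proof.
move=> oU u1 Su; apply: smooth_on_ln => //.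
  move=> x Ux; rewrite ltr_wpDr ?sqrtr_ge0//; exact: lt_trans (u1 x Ux).
by apply: smooth_onD => //; exact: smooth_on_sh.
Qed.

Lemma smooth_on_tlog U u : open U -> (forall x, U x -> 1 < u x) -> smooth_on U u ->
  smooth_on U (fun x => tlog (u x)).
Proof.
move=> oU u1 Su; apply: smooth_on_ln => //; last exact: smooth_on_acosh.
by move=> x Ux; apply: acosh_gt0; exact: u1.
Qed.

Lemma smooth_on_gphi U u c : open U -> (forall x, U x -> 1 < u x) -> smooth_on U u ->
  smooth_on U (fun x => gphi c (u x)).
Proof.
move=> oU u1 Su; apply: smooth_on_exp => //; apply: smooth_onB => //; apply: smooth_onM => //.
- exact: smooth_on_tlog.
- exact: smooth_on_cst.
- exact: smooth_on_cst.
- exact: smooth_on_ln_sqrB1.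
Qed.

Lemma smooth_on_gslope U u c : open U -> (forall x, U x -> 1 < u x) -> smooth_on U u ->
  smooth_on U (fun x => gslope c (u x)).
Proof.
move=> oU u1 Su; apply: smooth_onB => //.
  apply: smooth_onM => //; first by apply: smooth_onM => //; exact: smooth_on_cst.
  apply: smooth_on_inv => //; last exact: smooth_on_sqrB1.
  by move=> x /u1 /sqrB1_gt0 h; rewrite gt_eqF.
apply: smooth_on_inv => //.
  by move=> x /u1 h; rewrite gt_eqF// !mulr_gt0 ?acosh_gt0 ?sh_gt0.
apply: smooth_onM => //; last exact: smooth_on_sh.
by apply: smooth_onM => //; [exact: smooth_on_cst|exact: smooth_on_acosh].
Qed.

Lemma smooth_on_acosh_inv U u : open U -> (forall x, U x -> 1 < u x) -> smooth_on U u ->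
  smooth_on U (fun x => (acosh (u x))^-1).
Proof.
move=> oU u1 Su; apply: smooth_on_inv => //; last exact: smooth_on_acosh.
by move=> x /u1 /acosh_gt0 h; rewrite gt_eqF.
Qed.

Lemma smooth_on_sh_inv U u : open U -> (forall x, U x -> 1 < u x) -> smooth_on U u ->
  smooth_on U (fun x => (sh (u x))^-1).
Proof.
move=> oU u1 Su; apply: smooth_on_inv => //; last exact: smooth_on_sh.
by move=> x /u1 /sh_gt0 h; rewrite gt_eqF.
Qed.

Lemma smooth_on_gpot U u c : open U -> (forall x, U x -> 1 < u x) -> smooth_on U u ->
  smooth_on U (fun x => gpot c (u x)).
Proof.
move=> oU u1 Su; apply: (@smooth_on_eq _ _ _ (fun x => c ^+ 2 + 4^-1 * (acosh (u x))^-1 ^+ 2 +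
   (c ^+ 2 - c) * (sh (u x))^-1 ^+ 2)) => //.
  move=> x /u1 h; by rewrite /gpot -(sqr_sh (ltW h)); field; rewrite !gt_eqF ?acosh_gt0 ?sh_gt0.
apply: smooth_onD => //; first apply: smooth_onD => //; first exact: smooth_on_cst.
  apply: smooth_onM => //; first exact: smooth_on_cst.
  by apply: smooth_onX => //; exact: smooth_on_acosh_inv.
apply: smooth_onM => //; first exact: smooth_on_cst.
by apply: smooth_onX => //; exact: smooth_on_sh_inv.
Qed.

End SmoothHyperbolic.

Section Radial.
Variables (R : realType) (N : nat).
Local Notation E := 'rV[R]_N.
Local Notation BE := (borelRV R N).
Variable o : E.
Hypothesis o1 : enorm2 o < 1.
Implicit Types (F G W : R -> R) (s : R) (x : E).

Local Notation cosh := (coshd o).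

Definition pball : set E := [set x | hball x /\ x != o].

Lemma enorm2_gt0 x : x != o -> 0 < enorm2 (x - o).
Proof.
move=> xo; rewrite lt_neqAle enorm2_ge0 andbT eq_sym; apply: contra xo => /eqP h.
apply/eqP/rowP => i; have := coord_le_enorm2 (x - o) i; rewrite h !mxE => h2.
by apply/eqP; rewrite -subr_eq0 -sqrf_eq0 eq_le h2 sqr_ge0.
Qed.

Let b0 : 0 < 1 - enorm2 o. Proof. by rewrite subr_gt0. Qed.
Let a0 x : hball x -> 0 < 1 - enorm2 x. Proof. by rewrite subr_gt0. Qed.

Lemma coshd_ge1 x : hball x -> 1 <= cosh x.
Proof.
move=> hx; rewrite lerDl divr_ge0 ?mulr_ge0 ?enorm2_ge0 ?ltW//.
exact: a0.
Qed.

Lemma coshd_gt1 x : pball x -> 1 < cosh x.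
Proof.
move=> [hx xo]; rewrite ltrDl divr_gt0// mulr_gt0//; [exact: enorm2_gt0|exact: a0].
Qed.

Lemma enorm2_0 : enorm2 (0 : E) = 0.
Proof. by rewrite /enorm2 big1// => i _; rewrite mxE expr0n. Qed.

Lemma coshd_o : cosh o = 1.
Proof. by rewrite /coshd subrr enorm2_0 mulr0 mul0r addr0. Qed.

Lemma closed_set1RV x : closed [set x].
Proof. exact: (@accessible_closed_set1 _ (hausdorff_accessible (@norm_hausdorff _ _))). Qed.

Lemma open_pball : open pball.
Proof.
have -> : pball = hball `&` ~` [set o].
  apply/seteqP; split=> x [hx xo]; split=> //; first by move=> /= h; rewrite h eqxx in xo.
  by apply/eqP.
by apply: openI; [exact: open_hball|rewrite openC; exact: closed_set1RV].
Qed.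

Lemma pball_hball : pball `<=` hball. Proof. by move=> x []. Qed.

Let oP := open_pball.

Lemma smooth_on_coshdP : smooth_on pball cosh.
Proof.
apply: (smooth_on_sub _ (@smooth_on_coshd _ _ o)); exact: pball_hball.
Qed.

Definition radial F x := if in_ball x && (x != o) then F (cosh x) else 0.

(** The region [s0 <= cosh r <= s1] with denominators cleared. The inequalities are polynomial, so
    the set is closed in the whole space and not merely in the open ball. *)
Definition shell s0 s1 : set E :=
  [set x | enorm2 x <= 1 /\
     (s0 - 1) * ((1 - enorm2 x) * (1 - enorm2 o)) <= 2 * enorm2 (x - o) <=
     (s1 - 1) * ((1 - enorm2 x) * (1 - enorm2 o))].

Lemma closed_shell s0 s1 : closed (shell s0 s1).
Proof.
have oT : open [set: E] by exact: openT.
have cE (u : E -> R) : smooth_on setT u -> closed [set x | 0 <= u x].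
  move=> Su; apply: (closed_comp _ (@closed_ge R 0)) => x _.
  exact: (smooth_on_continuous Su).
have Sq : smooth_on setT (fun x : E => 2 * enorm2 (x - o)).
  by apply: smooth_onM => //; [exact: smooth_on_cst|exact: smooth_on_enorm2].
have Sa k : smooth_on setT (fun x : E => k * ((1 - enorm2 x) * (1 - enorm2 o))).
  apply: smooth_onM => //; first exact: smooth_on_cst.
  by apply: smooth_onM => //; [exact: smooth_on_a|exact: smooth_on_cst].
have -> : shell s0 s1 = [set x : E | 0 <= 1 - enorm2 x] `&`
   ([set x | 0 <= 2 * enorm2 (x - o) - (s0 - 1) * ((1 - enorm2 x) * (1 - enorm2 o))] `&`
    [set x | 0 <= (s1 - 1) * ((1 - enorm2 x) * (1 - enorm2 o)) - 2 * enorm2 (x - o)]).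
  apply/seteqP; split=> x /=; rewrite !subr_ge0.
    by move=> [h /andP[h1 h2]].
  by move=> [h [h1 h2]]; split => //; rewrite h1.
apply: closedI; first by apply: cE; exact: smooth_on_a.
by apply: closedI; apply: cE; apply: smooth_onB.
Qed.

(** At [o] the lower bound fails. On the unit sphere the upper bound would force [|x - o| = 0]. *)
Lemma shell_pball s0 s1 : 1 < s0 -> shell s0 s1 `<=` pball.
Proof.
move=> s01 x [x1 /andP[h1 h2]].
have xo : x != o.
  apply/eqP => xo; move: h1; rewrite xo subrr enorm2_0 mulr0 leNgt.
  by rewrite !mulr_gt0// subr_gt0.
split=> //; rewrite /hball /= lt_neqAle x1 andbT; apply/eqP => x1'.
move: h2; rewrite x1' subrr mul0r mulr0 leNgt mulr_gt0//; exact: enorm2_gt0.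
Qed.

Lemma shellP s0 s1 x : pball x -> s0 <= cosh x <= s1 -> shell s0 s1 x.
Proof.
move=> [hx xo] /andP[h0 h1]; split; first exact: ltW.
have ab : 0 < (1 - enorm2 x) * (1 - enorm2 o) by rewrite mulr_gt0// a0.
by apply/andP; split; [rewrite -ler_pdivlMr// lerBlDl|rewrite -ler_pdivrMr// lerBrDl].
Qed.

(** Nothing is asked for [s <= 1]: off the pole [cosh r > 1], and the profiles involve logarithms
    and inverses without meaning there. *)
Definition supp F s0 s1 := forall s, 1 < s -> s < s0 \/ s1 < s -> F s = 0.

Lemma radial_shell F s0 s1 x : supp F s0 s1 -> ~ shell s0 s1 x -> radial F x = 0.
Proof.
move=> sF nx; rewrite /radial; case: ifP => // /andP[hx xo].
have px : pball x by split.
apply: sF; first exact: coshd_gt1.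
have [h|h] := ltP (cosh x) s0; first by left.
have [h'|h'] := ltP s1 (cosh x); first by right.
by exfalso; apply: nx; apply: shellP => //; rewrite h.
Qed.

Lemma radial_pball F x : pball x -> radial F x = F (cosh x).
Proof. by move=> [hx xo]; rewrite /radial /in_ball hx xo. Qed.

(** With [b = 1 - |o|^2], Young's inequality bounds [|x|^2] by
    [(1 + b/2) |o|^2 + (1 + 2/b) |x - o|^2], and in the shell the last term is at most
    [C (1 - |x|^2)]. Hence [1 - |x|^2 >= (b/2) / (1 + C) = d]; the radius [1 - d/2] makes the
    inequality strict. *)
Lemma shell_enorm2 s0 s1 : exists2 rho, rho < 1 & forall x, shell s0 s1 x -> enorm2 x < rho.
Proof.
pose b := 1 - enorm2 o; pose C := (1 + 2 / b) * (`|s1 - 1| * b / 2).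
have bp : 0 < b by [].
have b2 : 0 <= 1 + 2 / b by rewrite addr_ge0// divr_ge0// ltW.
have C0 : 0 <= C.
  by rewrite /C; apply: mulr_ge0 => //; apply: divr_ge0 => //; apply: mulr_ge0 => //; exact: ltW.
pose d := b / 2 / (1 + C).
have d0 : 0 < d by rewrite /d !divr_gt0// ltr_wpDr.
exists (1 - d / 2); first by rewrite ltrBlDr ltrDl divr_gt0.
move=> x [x1 /andP[_ h]].
have h1 : enorm2 x <= (1 + b / 2) * enorm2 o + (1 + 2 / b) * enorm2 (x - o).
  rewrite /enorm2 !mulr_sumr -big_split /=; apply: ler_sum => i _; rewrite !mxE.
  have := sqr_ge0 (b * o 0 i - 2 * (x 0 i - o 0 i)) => H.
  have bb : 0 < 2 * b by rewrite mulr_gt0.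
  rewrite -subr_ge0 -(pmulr_rge0 _ bb).
  have -> : 2 * b * ((1 + b / 2) * o 0 i ^+ 2 + (1 + 2 / b) * (x 0 i - o 0 i) ^+ 2 - x 0 i ^+ 2) =
     (b * o 0 i - 2 * (x 0 i - o 0 i)) ^+ 2 by field; rewrite gt_eqF.
  exact: H.
have h2 : (1 + 2 / b) * enorm2 (x - o) <= C * (1 - enorm2 x).
  rewrite /C -mulrA ler_wpM2l//.
  have : 2 * enorm2 (x - o) <= `|s1 - 1| * ((1 - enorm2 x) * b).
    apply: le_trans h _; apply: ler_wpM2r; last exact: ler_norm.
    by rewrite mulr_ge0 ?subr_ge0// ltW.
  by lra.
have h3 : b / 2 <= (1 + C) * (1 - enorm2 x).
  have : (1 + b / 2) * enorm2 o <= enorm2 o + b / 2.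
    by rewrite mulrDl mul1r lerD2l; apply: ler_piMr; [rewrite divr_ge0// ltW|exact: ltW].
  have bE : enorm2 o = 1 - b by rewrite /b; ring.
  by move: h1 h2; lra.
have h4 : d <= 1 - enorm2 x by rewrite ler_pdivrMr ?ltr_wpDr// [leRHS]mulrC.
lra.
Qed.

Lemma radial_smooth F s0 s1 : 1 < s0 -> supp F s0 s1 -> smooth_on pball (F \o cosh) ->
  smooth_on setT (radial F).
Proof.
move=> s01 sF SF; apply: (smooth_on_glue oP (@closed_shell s0 s1) (shell_pball s01)).
  by apply: smooth_on_eq SF => // x px; rewrite radial_pball.
by move=> x; exact: radial_shell.
Qed.

Lemma radial_enorm2 F s0 s1 : 1 < s0 -> supp F s0 s1 ->
  exists2 rho, rho < 1 & forall x, rho <= enorm2 x -> radial F x = 0.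
Proof.
move=> s01 sF; have [rho r1 H] := shell_enorm2 s0 s1; exists rho => // x hx.
by apply: (radial_shell sF) => /H; rewrite ltNge hx.
Qed.

Lemma partial_radial F F' s0 s1 i x : 1 < s0 -> supp F s0 s1 ->
  (forall s, 1 < s -> is_derive s 1 F (F' s)) -> hball x ->
  partial i (radial F) x = (if x != o then F' (cosh x) else 0) * partial i cosh x.
Proof.
move=> s01 sF dF hx; case: ifPn => xo.
  have px : pball x by split.
  rewrite (@partial_eq_on _ _ pball (radial F) (F \o cosh))//; last by move=> y; exact: radial_pball.
  apply: partial_comp; first by apply: dF; exact: coshd_gt1.
  exact: smooth_on_diff smooth_on_coshdP px.
(* The complement of the shell is an open neighbourhood of the pole on which the function
   vanishes. *)
have -> : x = o by apply/eqP; rewrite -[_ == _]negbK.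
rewrite mul0r (@partial_eq_on _ _ (~` shell s0 s1) (radial F) (fun=> 0)).
- by rewrite partial_cst.
- by rewrite openC; exact: closed_shell.
- by move=> y; exact: radial_shell.
- by move=> /(shell_pball s01) []; rewrite eqxx.
Qed.

Lemma hdot_radial F F' s0 s1 x : 1 < s0 -> supp F s0 s1 ->
  (forall s, 1 < s -> is_derive s 1 F (F' s)) -> hball x ->
  hdot (radial F) cosh x = radial (fun s => (s ^+ 2 - 1) * F' s) x.
Proof.
move=> s01 sF dF hx; rewrite /hdot.
under eq_bigr do rewrite (partial_radial _ s01 sF dF hx) -mulrA.
rewrite -mulr_sumr mulrCA -/(hdot cosh cosh x) hdot_coshd//.
by rewrite /radial /in_ball hx /=; case: ifP; rewrite ?mul0r// mulrC.
Qed.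

Lemma hgrad2_radial F F' s0 s1 x : 1 < s0 -> supp F s0 s1 ->
  (forall s, 1 < s -> is_derive s 1 F (F' s)) -> hball x ->
  hgrad2 (radial F) x = radial (fun s => F' s ^+ 2 * (s ^+ 2 - 1)) x.
Proof.
move=> s01 sF dF hx; rewrite hgrad2E /hdot.
under eq_bigr do rewrite (partial_radial _ s01 sF dF hx) mulrACA.
rewrite -mulr_sumr mulrCA -/(hdot cosh cosh x) hdot_coshd//.
by rewrite /radial /in_ball hx /=; case: ifP; rewrite ?mul0r// expr2.
Qed.

End Radial.

(** * Integrals of radial profiles *)

Section RadialIntegral.
Variables (R : realType) (N : nat).
Local Notation E := 'rV[R]_N.
Local Notation BE := (borelRV R N).
Variable o : E.
Hypothesis o1 : enorm2 o < 1.
Variable mu : {sigma_finite_measure set BE -> \bar R}.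
Hypothesis muP : is_lebesgue_upto N mu.
Implicit Types (F G W : R -> R) (s : R) (x : E).

Local Notation cosh := (coshd o).
Local Notation pball := (pball o).
Let oP : open pball := @open_pball R N o.
Let oB : open (@hball R N) := @open_hball R N.

Lemma hdens_hball x : hball x -> hdens x = (2 / (1 - enorm2 x)) ^+ N.
Proof. by move=> hx; rewrite /hdens /in_ball hx. Qed.

Lemma hdens_out x : 1 <= enorm2 x -> hdens x = 0.
Proof. by move=> hx; rewrite /hdens /in_ball ltNge hx. Qed.

Lemma hdens_gt0 x : hball x -> 0 < hdens x.
Proof. by move=> hx; rewrite hdens_hball// exprn_gt0// divr_gt0// subr_gt0. Qed.

Lemma hdens_ge0 x : 0 <= hdens x.
Proof.
have [hx|hx] := ltP (enorm2 x) 1; first by rewrite ltW// hdens_gt0.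
by rewrite hdens_out.
Qed.

Lemma smooth_on_hdens : smooth_on hball (@hdens R N).
Proof.
apply: (@smooth_on_eq _ _ _ (fun x => (2 * (1 - enorm2 x)^-1) ^+ N)) => //.
  by move=> x hx; rewrite hdens_hball.
apply: smooth_onX => //; apply: smooth_onM => //; first exact: smooth_on_cst.
exact: smooth_on_ainv.
Qed.

Lemma integrable_hdens (f : E -> R) rho : rho < 1 -> smooth_on hball f ->
  (forall x, hball x -> rho <= enorm2 x -> f x = 0) ->
  mu.-integrable setT (fun x : BE => (hdens x * f x)%:E).
Proof.
move=> r1 Sf f0.
have S : smooth_on setT (fun x => hdens x * f x).
  apply: (smooth_on_glue oB (@closed_enorm2_le R N rho)).
  - by move=> x /= h; apply: le_lt_trans h r1.
  - by apply: smooth_onM => //; exact: smooth_on_hdens.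
  move=> x /= /negP; rewrite -ltNge => hx.
  have [hB|hB] := ltP (enorm2 x) 1; first by rewrite f0 ?mulr0// ltW.
  by rewrite hdens_out ?mul0r.
apply: (integrable_continuous_support muP (u := fun x => hdens x * f x)).
  by move=> x; exact: (smooth_on_continuous S).
by move=> x hx; rewrite hdens_out ?mul0r.
Qed.

(** Continuity is needed only on the punctured ball: the pole is a single closed point, and outside
    the ball the density is zero. This covers potentials that are singular at [o]. *)
Lemma measurable_hdens (f : E -> R) : (forall x, pball x -> {for x, continuous f}) ->
  measurable_fun setT (fun x : BE => hdens x * f x).
Proof.
move=> cf.
have mP : measurable (pball : set BE) by exact: open_measurableRV.
have mo : measurable ([set o] : set BE) by apply: closed_measurableRV; exact: closed_set1RV.
have mB : measurable (~` hball : set BE).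
  by apply: measurableC; exact: open_measurableRV.
have -> : [set: BE] = (pball `|` [set o]) `|` ~` hball.
  apply/esym/seteqP; split=> // x _; have [hx|hx] := pselect (hball x); last by right.
  by left; have [->|xo] := eqVneq x o; [right|left].
apply/measurable_funU => //; first exact: measurableU.
split; last first.
  have m0 : measurable_fun (~` hball : set BE) (cst 0 : BE -> R) by exact: measurable_cst.
  apply: eq_measurable_fun m0.
  by move=> x; rewrite inE /= => /negP; rewrite -leNgt => hx; rewrite hdens_out ?mul0r.
apply/measurable_funU => //; split; last exact: measurable_fun_set1.
apply: (open_continuous_measurableRV oP (f := fun x => hdens x * f x)) => x px.
apply: continuousM; last exact: cf.
exact: (smooth_on_continuous smooth_on_hdens px.1).
Qed.

(** The bridge from the iterated integral of the statement to [mu]. Nonnegativity is what permits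
    it, so signed integrands occur on the [mu] side alone. *)
Lemma hintE (f : E -> R) : measurable_fun setT (fun x : BE => hdens x * f x) ->
  (forall x, hball x -> 0 <= f x) ->
  hint (fun x => (f x)%:E) = (\int[mu]_x (hdens x * f x)%:E)%E.
Proof.
move=> mf f0; rewrite /hint.
have -> : (fun x => if in_ball x then ((f x)%:E * ((2 / (1 - enorm2 x)) ^+ N)%:E)%E else 0%E) =
   (fun x => (hdens x * f x)%:E).
  apply/funext => x; case: ifPn => hx; first by rewrite hdens_hball// -EFinM mulrC.
  by rewrite hdens_out ?mul0r// leNgt.
apply: (lebesgue_intE muP); first exact/measurable_EFinP.
move=> x; rewrite lee_fin; have [hx|hx] := ltP (enorm2 x) 1.
  by rewrite mulr_ge0 ?hdens_ge0 ?f0.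
by rewrite hdens_out ?mul0r.
Qed.

(* Radial profiles, as functions of [s = cosh r], that are smooth and supported
   in a compact subset of [s > 1]. *)
Definition profile F := (exists s0 s1, 1 < s0 /\ supp F s0 s1) /\ smooth_on pball (F \o cosh).

Definition rint F : R := fine (\int[mu]_x (hdens x * radial o F x)%:E)%E.

Lemma profile_integrable F : profile F ->
  mu.-integrable setT (fun x : BE => (hdens x * radial o F x)%:E).
Proof.
move=> [[s0 [s1 [s01 sF]]] SF].
have [rho r1 H] := radial_enorm2 o1 s01 sF.
apply: (integrable_hdens r1); last by move=> x _; exact: H.
exact: smooth_on_sub (subsetT _) (radial_smooth o1 s01 sF SF).
Qed.

Lemma rintE F : profile F -> (\int[mu]_x (hdens x * radial o F x)%:E = (rint F)%:E)%E.
Proof. by move=> pF; rewrite fineK//; apply: integrable_fin_num => //; exact: profile_integrable. Qed.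

Lemma profileD F G : profile F -> profile G -> profile (fun s => F s + G s).
Proof.
move=> [[s0 [s1 [s01 sF]]] SF] [[s0' [s1' [s01' sG]]] SG]; split; last exact: smooth_onD.
exists (Num.min s0 s0'), (Num.max s1 s1'); rewrite lt_min s01 s01'; split => // s hs.
rewrite lt_min gt_max => h; rewrite sF ?sG ?addr0//.
  by case: h => /andP[? ?]; [left|right].
by case: h => /andP[? ?]; [left|right].
Qed.

Lemma profileZ k F : profile F -> profile (fun s => k * F s).
Proof.
move=> [[s0 [s1 [s01 sF]]] SF]; split; last by apply: smooth_onM => //; exact: smooth_on_cst.
by exists s0, s1; split => // s hs h; rewrite sF ?mulr0.
Qed.

Lemma eq_profile F G : (forall s, 1 < s -> F s = G s) -> profile F -> profile G.
Proof.
move=> FG [[s0 [s1 [s01 sF]]] SF]; split.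
  by exists s0, s1; split => // s hs h; rewrite -FG// sF.
by apply: smooth_on_eq SF => // x px; rewrite /= FG//; exact: coshd_gt1.
Qed.

Lemma eq_radial F G x : (forall s, 1 < s -> F s = G s) -> radial o F x = radial o G x.
Proof.
move=> FG; rewrite /radial; case: ifP => // /andP[hx xo]; rewrite FG//.
by apply: coshd_gt1.
Qed.

Lemma eq_rint F G : (forall s, 1 < s -> F s = G s) -> rint F = rint G.
Proof.
by move=> FG; congr fine; apply: eq_integral => x _; rewrite (eq_radial x FG).
Qed.

Lemma rintD F G : profile F -> profile G -> rint (fun s => F s + G s) = rint F + rint G.
Proof.
move=> pF pG; apply: EFin_inj; rewrite EFinD -!rintE//; last exact: profileD.
rewrite -integralD//; try exact: profile_integrable.
apply: eq_integral => x _; rewrite -EFinD -mulrDr; congr ((_ * _)%:E).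
by rewrite /radial; case: ifP => // _; rewrite addr0.
Qed.

Lemma rintZ k F : profile F -> rint (fun s => k * F s) = k * rint F.
Proof.
move=> pF; apply: EFin_inj; rewrite EFinM -!rintE//; last exact: profileZ.
rewrite -integralZl//; last exact: profile_integrable.
apply: eq_integral => x _; rewrite -EFinM mulrCA; congr ((_ * _)%:E).
by rewrite /radial; case: ifP => // _; rewrite mulr0.
Qed.

Lemma rint_le F G : profile F -> profile G -> (forall s, 1 < s -> F s <= G s) -> rint F <= rint G.
Proof.
move=> pF pG FG; rewrite -lee_fin -!rintE//.
apply: le_integral; [by []|exact: profile_integrable|exact: profile_integrable|].
move=> x _; rewrite lee_fin ler_wpM2l ?hdens_ge0// /radial.
by case: ifP => // /andP[hx xo]; apply: FG; exact: coshd_gt1.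
Qed.

(* The weighted radial divergence [W' (s^2 - 1) + N s W] integrates to zero:
   this replaces integration in polar coordinates. *)
Lemma rint_div W W' : profile W -> (forall s, 1 < s -> is_derive s 1 W (W' s)) ->
  rint (fun s => (s ^+ 2 - 1) * W' s + N%:R * s * W s) = 0.
Proof.
move=> [[s0 [s1 [s01 sW]]] SW] dW.
have [rho r1 H] := radial_enorm2 o1 s01 sW.
have SW' : smooth_on hball (radial o W) by exact: smooth_on_sub (subsetT _) (radial_smooth o1 s01 sW SW).
have := integral_div_coshd o1 muP SW' r1 (fun x _ => H x).
rewrite /rint => E0; rewrite (_ : (\int[mu]_x _)%E = 0%E)//; rewrite -[RHS]E0.
apply: eq_integral => x _; congr EFin.
have [hx|hx] := ltP (enorm2 x) 1; last by rewrite hdens_out ?mul0r.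
rewrite (hdot_radial o1 s01 sW dW hx); congr (_ * _).
by rewrite /radial; case: ifP => // _; rewrite mulr0 addr0.
Qed.

End RadialIntegral.

(** * Logarithmic test functions *)

Section TestFunctions.
Variables (R : realType) (N : nat).
Local Notation E := 'rV[R]_N.
Local Notation BE := (borelRV R N).
Variable o : E.
Hypothesis o1 : enorm2 o < 1.
Variable mu : {sigma_finite_measure set BE -> \bar R}.
Hypothesis muP : is_lebesgue_upto N mu.
Implicit Types (F G W H P : R -> R) (s t : R) (x : E).

Local Notation cosh := (coshd o).
Local Notation pball := (pball o).
Local Notation profile := (profile o).
Local Notation rint := (rint o mu).
Local Notation c := ((N%:R - 1) / 2 : R).
Local Notation phi := (gphi c).
Local Notation gst := (gslope c).
Local Notation gst' := (gslope' c).
Local Notation pot := (gpot c).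
Let oP : open pball := @open_pball R N o.
Let oB : open (@hball R N) := @open_hball R N.
Let SC : smooth_on pball cosh := @smooth_on_coshdP R N o.
Let C1 x : pball x -> 1 < cosh x. Proof. exact: coshd_gt1. Qed.

(** Follows from [r <= sinh r]; its companion [tlog_ge] follows from [r >= ln s]. The thresholds are
    crude, but any compact range of [s > 1] suffices. *)
Lemma tlog_le (t0 s : R) : 1 < s -> s < Num.sqrt (1 + expR t0 ^+ 2) -> tlog s <= t0.
Proof.
move=> s1 h; have s0 : 0 < s by exact: lt_trans s1.
have h2 : s ^+ 2 < 1 + expR t0 ^+ 2.
  rewrite -[ltRHS]sqr_sqrtr; last by rewrite addr_ge0 ?sqr_ge0.
  by rewrite ltrXn2r ?nnegrE ?sqrtr_ge0 ?(ltW s0).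
have h3 : sh s <= expR t0.
  rewrite -[leRHS]ger0_norm ?expR_ge0// -sqrtr_sqr ler_sqrt ?sqr_ge0//.
  by rewrite lerBlDl ltW.
rewrite /tlog -[leRHS]expRK ler_ln ?posrE ?expR_gt0 ?acosh_gt0//.
by rewrite (le_trans _ h3)// acosh_le_sh// ltW.
Qed.

Lemma tlog_ge (t1 s : R) : 1 < s -> expR (expR t1) < s -> t1 <= tlog s.
Proof.
move=> s1 h; have s0 : 0 < s by exact: lt_trans s1.
rewrite /tlog -[leLHS]expRK ler_ln ?posrE ?expR_gt0 ?acosh_gt0//.
rewrite acoshE -[leLHS]expRK ler_ln ?posrE ?expR_gt0//.
  by rewrite (le_trans (ltW h))// lerDl sqrtr_ge0.
by rewrite ltr_wpDr ?sqrtr_ge0.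
Qed.

Lemma profile_tlog P H t0 t1 : smooth_on pball (fun x => P (cosh x)) ->
  smooth_on pball (fun x => H (tlog (cosh x))) ->
  (forall t, t <= t0 \/ t1 <= t -> H t = 0) ->
  profile (fun s => P s * H (tlog s)).
Proof.
move=> SP SH H0; split; last exact: smooth_onM.
exists (Num.sqrt (1 + expR t0 ^+ 2)), (expR (expR t1)); split.
  by rewrite -[ltLHS]sqrtr1 ltr_sqrt ?addr_gt0 ?exprn_gt0 ?expR_gt0// ltrDl exprn_gt0 ?expR_gt0.
move=> s s1 hs; rewrite H0 ?mulr0//.
by case: hs => h; [left; exact: tlog_le|right; exact: tlog_ge].
Qed.

Let S_tlog : smooth_on pball (fun x => tlog (cosh x)).
Proof. exact: smooth_on_tlog. Qed.

Let S_aff (c0 k : R) : smooth_on pball (fun x => (tlog (cosh x) - c0) / k).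
Proof.
by apply: smooth_onM => //; [apply: smooth_onB => //|]; exact: smooth_on_cst.
Qed.

(** The density that turns the volume into [d(log r)]: in polar coordinates
    [phi^2 / r^2 = 1 / (r (sinh r)^(N-1))], so [wgt dv] is [dr / r] times the measure of the
    sphere. *)
Definition wgt s : R := phi s ^+ 2 * (acosh s)^-1 ^+ 2.

Lemma S_phi2 : smooth_on pball (fun x => phi (cosh x) ^+ 2).
Proof. by apply: smooth_onX => //; exact: smooth_on_gphi. Qed.

Lemma S_wgt : smooth_on pball (fun x => wgt (cosh x)).
Proof.
apply: smooth_onM => //; first exact: S_phi2.
by apply: smooth_onX => //; exact: smooth_on_acosh_inv.
Qed.

Lemma wgt_gt0 s : 1 < s -> 0 < wgt s.
Proof. by move=> s1; rewrite mulr_gt0// exprn_gt0// ?expR_gt0// invr_gt0 acosh_gt0. Qed.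

Lemma profile_wgt_step' (c0 k : R) : 0 < k ->
  profile (fun s => wgt s * step' ((tlog s - c0) / k)).
Proof.
move=> k0; apply: (@profile_tlog wgt (fun t => step' ((t - c0) / k)) c0 (c0 + k)).
- exact: S_wgt.
- by apply: smooth_on_step' => //; exact: S_aff.
- move=> t h; apply: step'_eq0; case: h => h; [left|right].
    by rewrite pmulr_lle0 ?invr_gt0// subr_le0.
  by rewrite ler_pdivlMr// mul1r lerBrDl.
Qed.

Lemma is_derive_affine_comp F (l c0 k t : R) : is_derive ((t - c0) / k) 1 F l ->
  is_derive t 1 (fun t => F ((t - c0) / k)) (l / k).
Proof.
move=> dF; apply: (is_derive1_comp (f := F) (g := fun t : R => (t + - c0) * k^-1)).
have H : is_derive t 1 (fun t : R => (t + - c0) * k^-1) ((1 + 0) * k^-1 + (t + - c0) * 0) by derive1.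
by move: H; rewrite addr0 mul1r mulr0 addr0.
Qed.

(* The radial flux [W = phi^2 / (r sinh r) * D(log r)] has weighted divergence
   [wgt * D'(log r)]; take for [D] a difference of two steps of equal height. *)
Lemma rint_step' (c0 k : R) : 0 < k ->
  rint (fun s => wgt s * step' ((tlog s - c0) / k)) = k * rint (fun s => wgt s * step' ((tlog s - 0) / 1)).
Proof.
move=> k0.
pose A s : R := (acosh s * sh s)^-1.
pose D t : R := k * step ((t - c0) / k) + - k * step ((t - 0) / 1).
pose D' t : R := (0 * step ((t - c0) / k) + k * (step' ((t - c0) / k) / k)) +
   (0 * step ((t - 0) / 1) + - k * (step' ((t - 0) / 1) / 1)).
have dD t : is_derive t 1 D (D' t).
  have h1 := is_derive_affine_comp (is_derive_step ((t - c0) / k)).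
  have h2 := is_derive_affine_comp (is_derive_step ((t - 0) / 1)).
  derive1.
pose W s := (phi s ^+ 2 * A s) * D (tlog s).
pose W' s := ((- gst s * phi s * phi s + phi s * (- gst s * phi s)) * A s + phi s ^+ 2 *
   (- (A s * A s) * ((sh s)^-1 * sh s + acosh s * (s / sh s)))) * D (tlog s) +
   (phi s ^+ 2 * A s) * (D' (tlog s) * A s).
have pW : profile W.
  apply: (@profile_tlog (fun s => phi s ^+ 2 * A s) D (Num.min c0 0) (Num.max (c0 + k) 1)).
  - apply: smooth_onM => //; first exact: S_phi2.
    apply: (@smooth_on_eq _ _ _ (fun x => (acosh (cosh x))^-1 * (sh (cosh x))^-1)) => //.
      by move=> x _; rewrite /A invfM.
    by apply: smooth_onM => //; [exact: smooth_on_acosh_inv|exact: smooth_on_sh_inv].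
  - apply: smooth_onD => //; apply: smooth_onM => //; try exact: smooth_on_cst.
      by apply: smooth_on_step => //; exact: S_aff.
    by apply: smooth_on_step => //; exact: S_aff.
  - move=> t h; rewrite /D subr0 divr1; case: h; rewrite ?le_min ?ge_max => /andP[h1 h2].
      by rewrite !step_le0 ?pmulr_lle0 ?invr_gt0 ?subr_le0// !mulr0 addr0.
    by rewrite !step_ge1 ?ler_pdivlMr ?mul1r ?lerBrDl// !mulr1 subrr.
have dW s : 1 < s -> is_derive s 1 W (W' s).
  move=> s1; have [[rp sp] zp] := (acosh_gt0 s1, sh_gt0 s1, sqrB1_gt0 s1).
  have dp := is_derive_gphi c s1.
  have [da ds] := (is_derive_acosh s1, is_derive_sh s1).
  have dt := is_derive_tlog s1.
  have dA : is_derive s 1 A (- (A s * A s) * ((sh s)^-1 * sh s + acosh s * (s / sh s))).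
    apply: (is_derive1_comp (f := @GRing.inv R) (g := fun s : R => acosh s * sh s)); last by derive1.
    by apply: is_derive1_inv; rewrite gt_eqF// mulr_gt0.
  have dDt := is_derive1_comp (dD (tlog s)) dt.
  have E1 : W = fun s : R => (phi s * phi s * A s) * D (tlog s) by apply/funext => z; rewrite /W expr2.
  rewrite E1 /W' expr2.
  exact: (is_derive1M (is_derive1M (is_derive1M dp dp) dA) dDt).
have := rint_div o1 muP pW dW.
rewrite (@eq_rint _ _ _ o1 _ _ (fun s => wgt s * step' ((tlog s - c0) / k) + - k * (wgt s * step' ((tlog s - 0) / 1)))); last first.
  move=> s s1; have [[rp sp] zp] := (acosh_gt0 s1, sh_gt0 s1, sqrB1_gt0 s1).
  rewrite -(sqr_sh (ltW s1)) /W' /W /D' /wgt /A /gslope -(sqr_sh (ltW s1)).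
  move: (step' _) (step' _) (D _) (phi s) => u v d p.
  by field; rewrite !gt_eqF.
rewrite rintD//; [|exact: profile_wgt_step'|apply: profileZ; exact: profile_wgt_step'].
rewrite rintZ//; last exact: profile_wgt_step'.
by move=> /eqP; rewrite mulNr subr_eq0 => /eqP.
Qed.

(** A ramp up, a plateau at height 1 and a ramp down, each of length [k], starting at [c0]. *)
Definition psi (c0 k t : R) : R := step ((t - c0) / k) * (1 - step ((t - (c0 + 2 * k)) / k)).
Definition psi' (c0 k t : R) : R := step' ((t - c0) / k) / k * (1 - step ((t - (c0 + 2 * k)) / k)) +
  step ((t - c0) / k) * (0 + - (step' ((t - (c0 + 2 * k)) / k) / k)).
(** The radial test function: the ground state cut off in [log r]. *)
Definition gflux (c0 k s : R) : R := phi s * psi c0 k (tlog s).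
Definition gflux' (c0 k s : R) : R := - gst s * phi s * psi c0 k (tlog s) +
  phi s * (psi' c0 k (tlog s) * (acosh s * sh s)^-1).

Lemma is_derive_psi (c0 k t : R) : is_derive t 1 (psi c0 k) (psi' c0 k t).
Proof.
have h1 := is_derive_affine_comp (is_derive_step ((t - c0) / k)).
have h2 := is_derive_affine_comp (is_derive_step ((t - (c0 + 2 * k)) / k)).
exact: (is_derive1M h1 (is_derive1D (is_derive_cst _ _ _) (is_deriveN h2))).
Qed.

Section Scale.
Variables c0 k : R.
Hypothesis k0 : 0 < k.

Lemma affine_le0 (d t : R) : t <= d -> (t - d) / k <= 0.
Proof. by move=> h; rewrite pmulr_lle0 ?invr_gt0// subr_le0. Qed.

Lemma affine_ge1 (d t : R) : d + k <= t -> 1 <= (t - d) / k.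
Proof. by move=> h; rewrite ler_pdivlMr// mul1r lerBrDl. Qed.

Lemma psi_out (t : R) : t <= c0 \/ c0 + 3 * k <= t -> psi c0 k t = 0.
Proof.
case=> h; rewrite /psi; first by rewrite step_le0 ?mul0r// affine_le0.
by rewrite [X in 1 - X]step_ge1 ?subrr ?mulr0// affine_ge1//; lra.
Qed.

Lemma psi'_out (t : R) : t <= c0 \/ c0 + 3 * k <= t -> psi' c0 k t = 0.
Proof.
have K0 := k0; case=> h; rewrite /psi'.
  have -> : step ((t - c0) / k) = 0 by rewrite step_le0// affine_le0.
  have -> : step' ((t - c0) / k) = 0 by rewrite step'_eq0//; left; exact: affine_le0.
  by rewrite !mul0r addr0.
have h' : c0 + 2 * k + k <= t by lra.
have -> : step ((t - (c0 + 2 * k)) / k) = 1 by rewrite step_ge1// affine_ge1.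
have -> : step' ((t - (c0 + 2 * k)) / k) = 0 by rewrite step'_eq0//; right; exact: affine_ge1.
by rewrite subrr mul0r oppr0 addr0 !mulr0 addr0.
Qed.

Lemma psi_in (t : R) : c0 + k <= t <= c0 + 2 * k -> psi c0 k t = 1.
Proof.
move=> /andP[h1 h2]; rewrite /psi step_ge1 ?affine_ge1// step_le0 ?affine_le0//.
by rewrite subr0 mulr1.
Qed.

(** The two ramps are disjoint, so at each [t] one of the [step'] terms is zero. Bounding one factor
    of the square by [M] leaves an expression linear in [step'], whose weighted integral
    [rint_step'] evaluates. *)
Lemma psi'_sqr_le (M t : R) : (forall z : R, step' z <= M) ->
  psi' c0 k t ^+ 2 <= M / k ^+ 2 * (step' ((t - c0) / k) + step' ((t - (c0 + 2 * k)) / k)).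
Proof.
move=> sM; have K0 := k0.
have key (u v : R) : 0 <= v <= 1 -> 0 <= u -> u <= M -> (u / k * v) ^+ 2 <= M / k ^+ 2 * u.
  move=> /andP[v0 v1] u0 uM.
  have -> : (u / k * v) ^+ 2 = (u * v ^+ 2) * u / k ^+ 2 by field; rewrite gt_eqF.
  have -> : M / k ^+ 2 * u = M * u / k ^+ 2 by field; rewrite gt_eqF.
  rewrite ler_wpM2r ?invr_ge0 ?sqr_ge0// ler_wpM2r//.
  by apply: le_trans uM; rewrite ler_piMr// expr_le1.
have K2 : 0 <= M / k ^+ 2.
  by rewrite divr_ge0 ?sqr_ge0// (le_trans (step'_ge0 0)).
have [h|h] := leP t (c0 + 2 * k).
  rewrite /psi' [X in - (X / k)]step'_eq0; last by left; exact: affine_le0.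
  rewrite mul0r oppr0 addr0 mulr0 addr0.
  apply: le_trans (key _ _ _ (step'_ge0 _) (sM _)) _.
    by rewrite subr_ge0 step_le1 lerBlDr lerDl step_ge0.
  by rewrite ler_wpM2l// lerDl step'_ge0.
rewrite /psi' [step' ((t - c0) / k)]step'_eq0; last by right; rewrite affine_ge1//; lra.
rewrite mul0r mul0r !add0r mulrN sqrrN mulrC.
apply: key; rewrite ?step'_ge0 ?step_ge0 ?step_le1//.
Qed.

(** The bump on the left is supported on the plateau, where [psi] is 1. It converts the known
    integral of a bump into a lower bound for the mass. *)
Lemma step'_le_psi (M t : R) : 0 < M -> (forall z : R, step' z <= M) ->
  step' ((t - (c0 + k)) / k) <= M * psi c0 k t ^+ 2.
Proof.
move=> M0 sM; have K0 := k0; have [h1|h1] := leP (c0 + k) t; last first.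
  rewrite step'_eq0; first by rewrite mulr_ge0 ?sqr_ge0// ltW.
  by left; apply: affine_le0; exact: ltW.
have [h2|h2] := leP t (c0 + 2 * k).
  by rewrite psi_in ?h1// expr1n mulr1.
rewrite step'_eq0; first by rewrite mulr_ge0 ?sqr_ge0// ltW.
by right; apply: affine_ge1; lra.
Qed.

Lemma S_psi : smooth_on pball (fun x => psi c0 k (tlog (cosh x))).
Proof.
apply: smooth_onM => //; first by apply: smooth_on_step => //; exact: S_aff.
apply: smooth_onB => //; first exact: smooth_on_cst.
by apply: smooth_on_step => //; exact: S_aff.
Qed.

Lemma S_psi' : smooth_on pball (fun x => psi' c0 k (tlog (cosh x))).
Proof.
apply: smooth_onD => //; apply: smooth_onM => //.
- apply: smooth_onM => //; last exact: smooth_on_cst.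
  by apply: smooth_on_step' => //; exact: S_aff.
- apply: smooth_onB => //; first exact: smooth_on_cst.
  by apply: smooth_on_step => //; exact: S_aff.
- by apply: smooth_on_step => //; exact: S_aff.
- apply: smooth_onD => //; first exact: smooth_on_cst.
  apply: smooth_onN => //; apply: smooth_onM => //; last exact: smooth_on_cst.
  by apply: smooth_on_step' => //; exact: S_aff.
Qed.

Lemma profile_flux_sqr P : smooth_on pball (fun x => P (cosh x)) ->
  profile (fun s => P s * gflux c0 k s ^+ 2).
Proof.
move=> SP; apply: (@eq_profile _ _ _ o1 (fun s => (P s * phi s ^+ 2) * psi c0 k (tlog s) ^+ 2)).
  by move=> s _; rewrite /gflux; ring.
apply: (@profile_tlog (fun s => P s * phi s ^+ 2) (fun t => psi c0 k t ^+ 2) c0 (c0 + 3 * k)).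
- by apply: smooth_onM => //; exact: S_phi2.
- by apply: smooth_onX => //; exact: S_psi.
- by move=> t /psi_out ->; rewrite expr0n.
Qed.

Lemma profile_flux : profile (gflux c0 k).
Proof.
apply: (@profile_tlog phi (psi c0 k) c0 (c0 + 3 * k)); [|exact: S_psi|exact: psi_out].
exact: smooth_on_gphi.
Qed.

Lemma profile_wgt_psi' : profile (fun s => wgt s * psi' c0 k (tlog s) ^+ 2).
Proof.
apply: (@profile_tlog wgt (fun t => psi' c0 k t ^+ 2) c0 (c0 + 3 * k)); first exact: S_wgt.
- by apply: smooth_onX => //; exact: S_psi'.
- by move=> t /psi'_out ->; rewrite expr0n.
Qed.

Lemma is_derive_flux s : 1 < s -> is_derive s 1 (gflux c0 k) (gflux' c0 k s).
Proof.
move=> s1; have dp := is_derive_gphi c s1.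
have dt := is_derive1_comp (is_derive_psi c0 k (tlog s)) (is_derive_tlog s1).
exact: (is_derive1M dp dt).
Qed.

Lemma profile_flux' : profile (fun s => gflux' c0 k s ^+ 2 * (s ^+ 2 - 1)).
Proof.
have [[s0 [s1 [s01 sF]]] _] := profile_flux.
split; last first.
  apply: smooth_onM => //; last exact: smooth_on_sqrB1.
  apply: smooth_onX => //; apply: smooth_onD => //; apply: smooth_onM => //.
  - apply: smooth_onM => //; last exact: smooth_on_gphi.
    by apply: smooth_onN => //; exact: smooth_on_gslope.
  - exact: S_psi.
  - exact: smooth_on_gphi.
  - apply: smooth_onM => //; first exact: S_psi'.
    apply: (@smooth_on_eq _ _ _ (fun x => (acosh (cosh x))^-1 * (sh (cosh x))^-1)) => //.
      by move=> x _; rewrite invfM.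
    by apply: smooth_onM => //; [exact: smooth_on_acosh_inv|exact: smooth_on_sh_inv].
exists (Num.sqrt (1 + expR c0 ^+ 2)), (expR (expR (c0 + 3 * k))); split.
  by rewrite -[ltLHS]sqrtr1 ltr_sqrt ?addr_gt0 ?exprn_gt0 ?expR_gt0// ltrDl exprn_gt0 ?expR_gt0.
move=> s hs h; suff t0 : tlog s <= c0 \/ c0 + 3 * k <= tlog s.
  by rewrite /gflux' psi_out// psi'_out// mul0r !mulr0 addr0 expr0n mul0r.
by case: h => h; [left; exact: tlog_le|right; exact: tlog_ge].
Qed.

(** The ground state transform. Adding the divergence of [g f^2], for [f = gflux] and [g = gslope],
    to the energy completes the square [(f' + g f)^2], and the Riccati equation turns the remainder
    into the potential. Here [f' + g f = phi psi' / (r sinh r)], whose square times [sinh^2 r] is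
    [wgt psi'^2]. *)
Lemma rint_energy : (2 <= N)%N -> rint (fun s => gflux' c0 k s ^+ 2 * (s ^+ 2 - 1)) =
  rint (fun s => pot s * gflux c0 k s ^+ 2) + rint (fun s => wgt s * psi' c0 k (tlog s) ^+ 2).
Proof.
move=> hN.
have Sg : smooth_on pball (fun x => gst (cosh x)) by exact: smooth_on_gslope.
have pW := profile_flux_sqr Sg.
pose W' s := gst' s * (gflux c0 k s * gflux c0 k s) +
  gst s * (gflux' c0 k s * gflux c0 k s + gflux c0 k s * gflux' c0 k s).
have dW s : 1 < s -> is_derive s 1 (fun s => gst s * gflux c0 k s ^+ 2) (W' s).
  move=> s1; have df := is_derive_flux s1; have dg := is_derive_gslope c s1.
  rewrite (_ : (fun s => _) = fun s => gst s * (gflux c0 k s * gflux c0 k s)); last first.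
    by apply/funext => z; rewrite expr2.
  exact: (is_derive1M dg (is_derive1M df df)).
have E0 := rint_div o1 muP pW dW.
have Sp : smooth_on pball (fun x => pot (cosh x)) by exact: smooth_on_gpot.
have pP := profile_flux_sqr Sp.
have pE := profile_flux'.
have pQ := profile_wgt_psi'.
have E1 : rint (fun s => ((s ^+ 2 - 1) * W' s + N%:R * s * (gst s * gflux c0 k s ^+ 2)) + gflux' c0 k s ^+ 2 * (s ^+ 2 - 1)) =
   rint (fun s => pot s * gflux c0 k s ^+ 2 + wgt s * psi' c0 k (tlog s) ^+ 2).
  apply: (eq_rint o1) => s s1.
  have [[rp sp] zp] := (acosh_gt0 s1, sh_gt0 s1, sqrB1_gt0 s1).
  rewrite -(riccati c s1) /W' /wgt.
  have -> : gflux' c0 k s = - gst s * gflux c0 k s + phi s * (psi' c0 k (tlog s) * (acosh s * sh s)^-1).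
    by rewrite /gflux' /gflux; ring.
  rewrite -(sqr_sh (ltW s1)); move: (gflux _ _ _) (psi' _ _ _) (gst s) (gst' s) (phi s) => f p g g' ph.
  have -> : 2 * c + 1 = N%:R by field.
  by field; rewrite !gt_eqF.
rewrite -rintD// -E1 rintD//; first by rewrite E0 add0r.
(* The divergence integrand is a profile because the same pointwise identity expresses it through
   three known profiles. *)
apply: (@eq_profile _ _ _ o1 (fun s => (pot s * gflux c0 k s ^+ 2 + wgt s * psi' c0 k (tlog s) ^+ 2) + -1 * (gflux' c0 k s ^+ 2 * (s ^+ 2 - 1)))).
  move=> s s1.
  have [[rp sp] zp] := (acosh_gt0 s1, sh_gt0 s1, sqrB1_gt0 s1).
  rewrite -(riccati c s1) /W' /wgt.
  have -> : gflux' c0 k s = - gst s * gflux c0 k s + phi s * (psi' c0 k (tlog s) * (acosh s * sh s)^-1).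
    by rewrite /gflux' /gflux; ring.
  rewrite -(sqr_sh (ltW s1)); move: (gflux _ _ _) (psi' _ _ _) (gst s) (gst' s) (phi s) => f p g g' ph.
  have -> : 2 * c + 1 = N%:R by field.
  by field; rewrite !gt_eqF.
by apply: profileD; [exact: profileD|exact: profileZ].
Qed.

Local Notation J0 := (rint (fun s => wgt s * step' ((tlog s - 0) / 1))).

(** Each of the two ramps contributes [M / k^2] times [k J0]. *)
Lemma rint_wgt_psi'_le (M : R) : 0 < M -> (forall z : R, step' z <= M) ->
  rint (fun s => wgt s * psi' c0 k (tlog s) ^+ 2) <= 2 * M * J0 / k.
Proof.
move=> M0 sM; have h1 := profile_wgt_step' c0 k0; have h2 := profile_wgt_step' (c0 + 2 * k) k0.
have -> : 2 * M * J0 / k = rint (fun s => M / k ^+ 2 * (wgt s * step' ((tlog s - c0) / k) +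
   wgt s * step' ((tlog s - (c0 + 2 * k)) / k))).
  rewrite rintZ//; last exact: profileD.
  rewrite rintD// (rint_step' c0 k0) (rint_step' (c0 + 2 * k) k0); move: (rint _) => J.
  by field; rewrite gt_eqF.
apply: (rint_le o1 muP); [exact: profile_wgt_psi'|by apply: profileZ; exact: profileD|].
move=> s s1; rewrite -mulrDr.
have -> (a p q : R) : a * (p * q) = p * (a * q) by ring.
apply: ler_wpM2l; first exact: ltW (wgt_gt0 s1).
exact: psi'_sqr_le.
Qed.

Lemma rint_wgt_psi_ge (M : R) : 0 < M -> (forall z : R, step' z <= M) ->
  k * J0 <= M * rint (fun s => (acosh s)^-1 ^+ 2 * gflux c0 k s ^+ 2).
Proof.
move=> M0 sM; have h1 := profile_wgt_step' (c0 + k) k0.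
have h2 : profile (fun s => (acosh s)^-1 ^+ 2 * gflux c0 k s ^+ 2).
  by apply: profile_flux_sqr; apply: smooth_onX => //; exact: smooth_on_acosh_inv.
rewrite -(rint_step' (c0 + k) k0) -rintZ//.
apply: (rint_le o1 muP) => //; first exact: profileZ.
move=> s s1; have -> : M * ((acosh s)^-1 ^+ 2 * gflux c0 k s ^+ 2) = wgt s * (M * psi c0 k (tlog s) ^+ 2).
  by rewrite /gflux /wgt; ring.
by rewrite ler_wpM2l ?(ltW (wgt_gt0 s1))// step'_le_psi.
Qed.

End Scale.

End TestFunctions.

(** * The Hardy inequality *)

Section Fatou.
Variables (d : measure_display) (T : measurableType d) (R : realType).
Variable mu : {measure set T -> \bar R}.

Lemma fatou_le (f : nat -> T -> R) (g : T -> R) (b : nat -> R) (l : R) :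
  (forall n, measurable_fun setT (f n)) -> (forall n x, 0 <= f n x) ->
  (forall x, f n x @[n --> \oo] --> g x) ->
  (forall n, (\int[mu]_x (f n x)%:E <= (b n)%:E)%E) -> b n @[n --> \oo] --> l ->
  (\int[mu]_x (g x)%:E <= l%:E)%E.
Proof.
move=> mf f0 fg fb bl.
have -> : (\int[mu]_x (g x)%:E = \int[mu]_x limn_einf (fun n => (f n x)%:E))%E.
  apply: eq_integral => x _; have /cvg_limn_einf_sup[-> _]// : (f n x)%:E @[n --> \oo] --> (g x)%:E.
  by apply: cvg_EFin; [exact: nearW|exact: fg].
have := @fatou _ _ _ mu setT measurableT (fun n x => (f n x)%:E).
move=> /(_ _ _)/le_trans; apply; rewrite ?limn_einf_lim.
- by move=> n; apply/measurable_EFinP.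
- by move=> n x _; rewrite lee_fin.
have bE : (b n)%:E @[n --> \oo] --> l%:E by apply: cvg_EFin; [exact: nearW|exact: bl].
rewrite -(cvg_lim _ bE)//; apply: lee_lim.
- exact: is_cvg_einfs.
- by apply/cvg_ex; exists l%:E.
- apply: nearW => n; apply: le_trans (fb n).
  by apply: ereal_inf_lbound; exists n => //=.
Qed.

End Fatou.

Section Hardy.
Variables (R : realType) (N : nat).
Local Notation E := 'rV[R]_N.
Local Notation BE := (borelRV R N).
Variable o : E.
Hypothesis o1 : enorm2 o < 1.
Hypothesis hN : (3 <= N)%N.
Variable mu : {sigma_finite_measure set BE -> \bar R}.
Hypothesis muP : is_lebesgue_upto N mu.
Implicit Types (s t : R) (x : E) (u : E -> R).

Local Notation cosh := (coshd o).
Local Notation pball := (pball o).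
Local Notation c := ((N%:R - 1) / 2 : R).
Local Notation gst := (gslope c).
Local Notation gst' := (gslope' c).
Local Notation pot := (gpot c).
Let oP : open pball := @open_pball R N o.
Let oB : open (@hball R N) := @open_hball R N.

Lemma half_dim_ge1 : 1 <= c.
Proof.
rewrite ler_pdivlMr// mul1r lerBrDl.
have -> : 1 + 2 = 3%:R :> R by ring.
by rewrite ler_nat.
Qed.
Let c1 := half_dim_ge1.

Lemma test_smooth u : test_H u -> smooth_on setT u /\
  exists2 rho, rho < 1 & forall x, rho <= enorm2 x -> u x = 0.
Proof. by move=> [/smoothP Su [rho [r1 H]]]; split => //; exists rho. Qed.

Lemma smooth_on_hgrad2 u : smooth_on setT u -> smooth_on setT (hgrad2 u).
Proof.
have oT : open [set: E] by exact: openT.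
move=> Su; apply: smooth_onM => //.
  apply: smooth_onX => //; apply: smooth_onM => //; last exact: smooth_on_cst.
  exact: smooth_on_a.
by apply: smooth_on_sum => // i; apply: smooth_onX => //; exact: smooth_on_partial.
Qed.

Lemma hgrad2_ge0 u x : 0 <= hgrad2 u x.
Proof. by rewrite mulr_ge0 ?sqr_ge0// sumr_ge0// => i _; exact: sqr_ge0. Qed.

Lemma hgrad2_out u rho x : rho < 1 -> (forall x, rho <= enorm2 x -> u x = 0) ->
  rho < enorm2 x -> hgrad2 u x = 0.
Proof.
move=> r1 u0 hx; rewrite /hgrad2 big1 ?mulr0// => i _.
rewrite (@partial_eq_on _ _ [set x | rho < enorm2 x] u (fun=> 0))//.
- by rewrite partial_cst expr0n.
- by apply: (open_comp _ (@open_gt R rho)) => y _; exact: continuous_enorm20.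
- by move=> y /ltW; exact: u0.
Qed.

Lemma integrable_hgrad2 u : test_H u -> mu.-integrable setT (fun x : BE => (hdens x * hgrad2 u x)%:E).
Proof.
move=> /test_smooth[Su [rho r1 u0]].
(* The derivatives are seen to vanish only strictly beyond [rho], where [u] is zero on a
   neighbourhood; a slightly larger radius restores a non-strict condition. *)
have [rho' rr r1'] : exists2 r', rho < r' & r' < 1.
  by exists ((rho + 1) / 2); lra.
have SB : smooth_on hball (hgrad2 u) by exact: smooth_on_sub (subsetT _) (smooth_on_hgrad2 Su).
apply: (integrable_hdens muP r1' SB) => x _ hx.
by apply: (hgrad2_out r1 u0); exact: lt_le_trans hx.
Qed.

(** The field [u^2 gslope (cosh r + e)] is smooth at the pole. After the square is completed, the
    Riccati equation holds at [s + e] while the geometry supplies [s]. The defect [N e gslope] is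
    bounded by [gslope_le_gpot], which produces the factor on the left; the defect in [s^2 - 1] has
    a favourable sign by [gslope'_le0]. *)
Lemma hardy_shifted u (e : R) : test_H u -> 0 < e ->
  ((1 - 4 * c * N%:R * e)%:E * \int[mu]_x (hdens x * (pot (cosh x + e) * u x ^+ 2))%:E <=
   \int[mu]_x (hdens x * hgrad2 u x)%:E)%E.
Proof.
move=> tu e0; have [Su [rho r1 u0]] := test_smooth tu.
have SuB : smooth_on hball u by exact: smooth_on_sub (subsetT _) Su.
pose sg x := cosh x + e.
have Ssg : smooth_on hball sg.
  by apply: smooth_onD => //; [exact: smooth_on_coshd|exact: smooth_on_cst].
have sg1 x : hball x -> 1 < sg x.
  by move=> hx; rewrite /sg -[ltLHS]addr0 ler_ltD// coshd_ge1.
pose w x := u x ^+ 2 * gst (sg x).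
have Sg : smooth_on hball (fun x => gst (sg x)) by exact: smooth_on_gslope.
have Sw : smooth_on hball w by apply: smooth_onM => //; exact: smooth_onX.
have w0 x : hball x -> rho <= enorm2 x -> w x = 0.
  by move=> _ hx; rewrite /w u0// expr0n mul0r.
have I0 := integral_div_coshd o1 muP Sw r1 w0.
have Sp : smooth_on hball (fun x => pot (sg x) * u x ^+ 2).
  by apply: smooth_onM => //; [exact: smooth_on_gpot|exact: smooth_onX].
have ip : mu.-integrable setT (fun x : BE => (hdens x * (pot (sg x) * u x ^+ 2))%:E).
  apply: (integrable_hdens muP r1 Sp) => x _ hx.
  by rewrite u0// expr0n mulr0.
have SI : smooth_on hball (fun x => hdot w cosh x + N%:R * cosh x * w x).
  apply: smooth_onD => //.
    apply: smooth_onM => //.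
      apply: smooth_onX => //; apply: smooth_onM => //; last exact: smooth_on_cst.
      exact: smooth_on_a.
    apply: smooth_on_sum => // i; apply: smooth_onM => //; apply: smooth_on_partial => //.
    exact: smooth_on_coshd.
  apply: smooth_onM => //; apply: smooth_onM => //; first exact: smooth_on_cst.
  exact: smooth_on_coshd.
have [rho' rr r1'] : exists2 r', rho < r' & r' < 1.
  by exists ((rho + 1) / 2); lra.
have pw0 i x : hball x -> rho' <= enorm2 x -> partial i w x = 0.
  move=> hx xr; rewrite (@partial_eq_on _ _ (hball `&` [set x | rho < enorm2 x]) w (fun=> 0)).
  - by rewrite partial_cst.
  - apply: openI => //; apply: (open_comp _ (@open_gt R rho)) => y _; exact: continuous_enorm20.
  - by move=> y [hy /ltW]; exact: w0.
  - by split => //=; exact: lt_le_trans xr.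
have iI : mu.-integrable setT (fun x : BE => (hdens x * (hdot w cosh x + N%:R * cosh x * w x))%:E).
  apply: (integrable_hdens muP r1' SI) => x hx xr.
  rewrite /hdot big1 ?mulr0 ?add0r; first by rewrite w0 ?mulr0// ltW// (lt_le_trans rr).
  by move=> i _; rewrite pw0// mul0r.
rewrite -integralZl// -[leRHS]adde0 -I0 -integralD//; last exact: integrable_hgrad2.
apply: le_integral => //.
- by apply: integrableZl.
- by apply: integrableD => //; exact: integrable_hgrad2.
move=> x _; rewrite -EFinD -EFinM lee_fin mulrCA -mulrDr.
have [hx|hx] := ltP (enorm2 x) 1; last by rewrite hdens_out// !mul0r.
apply: ler_wpM2l; first exact: hdens_ge0.
have s1 := coshd_ge1 o1 hx; have sg1x := sg1 _ hx.
have du : differentiable u x := smooth_on_diff SuB hx.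
have dsg : differentiable sg x := smooth_on_diff Ssg hx.
have dg : differentiable (fun x => gst (sg x)) x := smooth_on_diff Sg hx.
have dc : differentiable cosh x := smooth_on_diff (@smooth_on_coshd _ _ o) hx.
have pw i : partial i w x = 2 * u x * gst (sg x) * partial i u x + u x ^+ 2 * gst' (sg x) * partial i cosh x.
  have -> : w = (fun x => (u x * u x) * gst (sg x)) by apply/funext => y; rewrite /w expr2.
  have dgg := is_derive_gslope c sg1x.
  have pg : partial i (fun x => gst (sg x)) x = gst' (sg x) * partial i sg x by exact: partial_comp.
  have ps : partial i sg x = partial i cosh x.
    by rewrite /sg partialD// partial_cst addr0.
  by rewrite partialM//; [rewrite partialM// pg ps; ring|exact: differentiableM].
pose a := ((1 - enorm2 x) / 2) ^+ 2.
pose B := a * \sum_(i < N) partial i u x * partial i cosh x.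
have hw : hdot w cosh x = 2 * u x * gst (sg x) * B + u x ^+ 2 * gst' (sg x) * (cosh x ^+ 2 - 1).
  rewrite -(hdot_coshd o1 hx) /hdot /B -/a !(mulrCA _ a) -mulrDr; congr (_ * _).
  rewrite !mulr_sumr -big_split /=; apply: eq_bigr => i _; rewrite pw; ring.
(* This is the squared norm of [grad u + u g grad s]. *)
have sq : 0 <= hgrad2 u x + 2 * u x * gst (sg x) * B + u x ^+ 2 * gst (sg x) ^+ 2 * (cosh x ^+ 2 - 1).
  have -> : hgrad2 u x + 2 * u x * gst (sg x) * B + u x ^+ 2 * gst (sg x) ^+ 2 * (cosh x ^+ 2 - 1) =
     a * \sum_(i < N) (partial i u x + u x * gst (sg x) * partial i cosh x) ^+ 2.
    rewrite -(hdot_coshd o1 hx) /hdot /B /hgrad2 -/a !(mulrCA _ a) -!mulrDr; congr (_ * _).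
    rewrite !mulr_sumr -!big_split /=; apply: eq_bigr => i _; ring.
  by rewrite mulr_ge0 ?sqr_ge0// sumr_ge0// => i _; exact: sqr_ge0.
have Rc := riccati c sg1x.
have gp := gslope_le_gpot c1 sg1x.
have g'0 := gslope'_le0 c1 sg1x.
have e2 : 2 * c + 1 = N%:R by field.
rewrite e2 in Rc.
rewrite hw /w; clear hw; clearbody B; move: sq Rc gp g'0; rewrite /sg.
move: (cosh x) (gst _) (gst' _) (pot _) (hgrad2 u x) B (u x) s1 => s G G' V A B U s1 sq Rc gp g'0.
have cN : 0 <= N%:R * e :> R by rewrite mulr_ge0 ?ler0n// ltW.
have U2 : 0 <= U ^+ 2 by exact: sqr_ge0.
have h1 : N%:R * e * G <= N%:R * e * (4 * c * V) by rewrite ler_wpM2l.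
(* Gain from replacing [(s + e)^2 - 1] by [s^2 - 1]; it uses [G' <= 0]. *)
have h2 : 0 <= (G ^+ 2 - G') * ((s + e) ^+ 2 - s ^+ 2).
  rewrite mulr_ge0//; first by have := sqr_ge0 G; lra.
  by rewrite subr_ge0 lerXn2r ?nnegrE//; lra.
have h3 : (1 - 4 * c * N%:R * e) * V <= G' * (s ^+ 2 - 1) - G ^+ 2 * (s ^+ 2 - 1) + N%:R * s * G.
  rewrite -subr_ge0; have -> : G' * (s ^+ 2 - 1) - G ^+ 2 * (s ^+ 2 - 1) + N%:R * s * G - (1 - 4 * c * N%:R * e) * V =
     (N%:R * e * (4 * c * V) - N%:R * e * G) + (G ^+ 2 - G') * ((s + e) ^+ 2 - s ^+ 2) +
     ((N%:R * (s + e) * G + (G' - G ^+ 2) * ((s + e) ^+ 2 - 1)) - V) by ring.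
  by rewrite Rc subrr addr0 addr_ge0// subr_ge0.
have h4 := ler_wpM2l U2 h3.
rewrite -subr_ge0 in h4; rewrite -subr_ge0.
apply: le_trans (addr_ge0 sq h4) _.
by rewrite le_eqVlt; apply/orP; left; apply/eqP; ring.
Qed.

(** Valid at the pole as well, where both sides read the inverse of zero as zero. *)
Lemma gpot_coshd x : hball x -> (N%:R - 1) ^+ 2 / 4 + 1 / (4 * hdist x o ^+ 2)
                     + (N%:R - 1) * (N%:R - 3) / 4 / sinh (hdist x o) ^+ 2 = pot (cosh x).
Proof.
move=> hx; rewrite hdistE sinh_acosh ?coshd_ge1// sqr_sh ?coshd_ge1// /gpot.
by congr (_ + _ + _ / _); field.
Qed.

Lemma gpot_ge0 s : 1 <= s -> 0 <= pot s.
Proof.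
rewrite le_eqVlt => /orP[/eqP <-|/(gpot_gt0 c1)/ltW//].
by rewrite /gpot acosh1 expr1n subrr expr0n mulr0 !invr0 !mulr0 !addr0 sqr_ge0.
Qed.

Lemma continuous_gpot s : 1 < s -> {for s, continuous pot}.
Proof.
move=> s1; have [rp zp] := (acosh_gt0 s1, sqrB1_gt0 s1).
have da : differentiable (@acosh R) s by exact: is_derive1_diff (is_derive_acosh s1).
have -> : pot = fun s => c ^+ 2 + (4 * (acosh s * acosh s))^-1 + (c ^+ 2 - c) * (s * s - 1)^-1.
  by apply/funext => z; rewrite /gpot !expr2 mul1r.
apply: differentiable_continuous; apply: differentiableD.
  apply: differentiableD; first exact: differentiable_cst.
  apply: differentiableV; last by rewrite gt_eqF// mulr_gt0// mulr_gt0.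
  by apply: differentiableM; [exact: differentiable_cst|exact: differentiableM].
apply: differentiableM; first exact: differentiable_cst.
apply: differentiableV; last by rewrite -expr2 gt_eqF.
by apply: differentiableB; [exact: differentiableM|exact: differentiable_cst].
Qed.

(** At [s = 1] the singular terms read as zero, so [gpot] takes there the value [c^2], a lower bound
    of its other values. The Fatou argument can thus use this value at the pole. *)
Lemma gpot1_le s : 1 < s -> pot 1 <= pot s.
Proof.
move=> s1; rewrite /gpot acosh1 expr1n subrr expr0n mulr0 !invr0 !mulr0 !addr0 -addrA lerDl.
apply: addr_ge0; first by rewrite divr_ge0// mulr_ge0// sqr_ge0.
apply: divr_ge0; last by rewrite ltW// sqrB1_gt0.
by rewrite subr_ge0 expr2 ler_peMl// (le_trans _ c1).
Qed.

Lemma hardy u : test_H u ->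
  (\int[mu]_x (hdens x * (pot (cosh x) * u x ^+ 2))%:E <=
   \int[mu]_x (hdens x * hgrad2 u x)%:E)%E.
Proof.
move=> tu; have [Su [rho r1 u0]] := test_smooth tu.
pose A := fine (\int[mu]_x (hdens x * hgrad2 u x)%:E)%E.
have AE : (\int[mu]_x (hdens x * hgrad2 u x)%:E)%E = A%:E.
  by rewrite fineK//; apply: integrable_fin_num => //; exact: integrable_hgrad2.
rewrite AE; pose C : R := 4 * c * N%:R.
have C0 : 0 <= C.
  have cp : 0 <= c by exact: le_trans c1.
  by rewrite /C; apply: mulr_ge0 => //; apply: mulr_ge0.
(* Scaled so that [1 - C * e n] is nonnegative for every [n], as Fatou's lemma requires. *)
pose e (n : nat) : R := (1 + C)^-1 * n.+1%:R^-1.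
have e0 n : 0 < e n by rewrite mulr_gt0 ?invr_gt0 ?ltr_wpDr.
have Ce n : 0 <= 1 - C * e n.
  rewrite subr_ge0 /e mulrA ler_pdivrMr ?ltr0n// mul1r ler_pdivrMr ?ltr_wpDr//.
  rewrite (@le_trans _ _ (1 + C))//; first by rewrite lerDr.
  by rewrite ler_peMl ?addr_ge0// ler1n.
(* At [o] the shifted potential blows up as [e n] tends to 0, while the limit integrand takes the
   value [pot 1] there. Imposing [pot 1] at [o] secures convergence everywhere and, by [gpot1_le],
   only lowers the integrand. *)
pose f (n : nat) x := hdens x * ((1 - C * e n) * (pot (if x == o then 1 else cosh x + e n) * u x ^+ 2)).
have eto0 : e n @[n --> \oo] --> (0 : R).
  rewrite -[X in _ --> X](mulr0 (1 + C)^-1); apply: cvgMr; exact: cvg_harmonic.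
have S n : smooth_on pball (fun x => (1 - C * e n) * (pot (cosh x + e n) * u x ^+ 2)).
  apply: smooth_onM => //; first exact: smooth_on_cst.
  apply: smooth_onM => //; last first.
    by apply: smooth_onX => //; exact: smooth_on_sub (subsetT _) Su.
  apply: smooth_on_gpot => //.
    by move=> y [hy _]; rewrite -[ltLHS]addr0 ler_ltD// coshd_ge1.
  by apply: smooth_onD => //; [exact: smooth_on_coshdP|exact: smooth_on_cst].
have mf n : measurable_fun setT (f n : BE -> R).
  apply: (@measurable_hdens _ _ o) => // x px.
  have S' : smooth_on pball (fun x => (1 - C * e n) * (pot (if x == o then 1 else cosh x + e n) * u x ^+ 2)).
    by apply: smooth_on_eq (S n) => // y [_ /negbTE ->].
  exact: (smooth_on_continuous S' px).
have f0 n x : 0 <= f n x.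
  have [hx|hx] := ltP (enorm2 x) 1; last by rewrite /f hdens_out ?mul0r.
  rewrite /f; apply: mulr_ge0; first exact: hdens_ge0.
  apply: mulr_ge0 => //; apply: mulr_ge0; last exact: sqr_ge0.
  apply: gpot_ge0; case: ifP => // _; rewrite (le_trans (coshd_ge1 o1 hx))// lerDl ltW//.
apply: (@fatou_le _ _ _ mu f _ (fun=> A)) => //.
- move=> x; have [hx|hx] := ltP (enorm2 x) 1; last first.
    by rewrite /f hdens_out// mul0r; under eq_fun do rewrite mul0r; exact: cvg_cst.
  rewrite /f; apply: cvgMr; rewrite -[X in _ --> X]mul1r.
  have h1 : (1 - C * e n) @[n --> \oo] --> (1 : R).
    rewrite -[X in _ --> X]subr0 -(mulr0 C); apply: cvgB; first exact: cvg_cst.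
    exact: cvgMr.
  apply: cvgM => //; apply: cvgMl.
  have [->|xo] := eqVneq x o; first by rewrite coshd_o; exact: cvg_cst.
  have xs : (cosh x + e n) @[n --> \oo] --> cosh x.
    by rewrite -[X in _ --> X]addr0; apply: cvgD => //; exact: cvg_cst.
  have ps : pball x by split.
  rewrite /=.
  have Hc := continuous_gpot (coshd_gt1 o1 ps).
  exact: (@continuous_cvg _ _ _ _ eventually_filter _ pot _ Hc xs).
- move=> n; apply: (@le_trans _ _ ((1 - C * e n)%:E * \int[mu]_x (hdens x * (pot (cosh x + e n) * u x ^+ 2))%:E)%E); last first.
    by rewrite -AE; exact: hardy_shifted.
  have p0 x : hball x -> 1 < cosh x + e n.
    by move=> hx; rewrite -[ltLHS]addr0 ler_ltD// coshd_ge1.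
  have g0 x : 0 <= hdens x * (pot (cosh x + e n) * u x ^+ 2).
    have [hx|hx] := ltP (enorm2 x) 1; last by rewrite hdens_out ?mul0r.
    apply: mulr_ge0; first exact: hdens_ge0.
    by apply: mulr_ge0; [exact/ltW/(gpot_gt0 c1)/p0|exact: sqr_ge0].
  have SB : smooth_on hball (fun x => pot (cosh x + e n) * u x ^+ 2).
    apply: smooth_onM => //; last by apply: smooth_onX => //; exact: smooth_on_sub (subsetT _) Su.
    apply: smooth_on_gpot => //.
    by apply: smooth_onD => //; [exact: smooth_on_coshd|exact: smooth_on_cst].
  have mg : measurable_fun setT (fun x : BE => hdens x * (pot (cosh x + e n) * u x ^+ 2)).
    by apply: (@measurable_hdens _ _ o) => x px; exact: (smooth_on_continuous SB px.1).
  rewrite -ge0_integralZl_EFin//; last 2 first.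
  + by move=> x _; rewrite lee_fin.
  + exact/measurable_EFinP.
  apply: ge0_le_integral => //.
  + by move=> x _; rewrite lee_fin.
  + exact/measurable_EFinP.
  + by apply/measurable_EFinP; apply: measurable_funM => //; exact: measurable_cst.
  move=> x _; rewrite -EFinM lee_fin mulrCA.
  have [hx|hx] := ltP (enorm2 x) 1; last by rewrite /f hdens_out ?mul0r ?mulr0.
  apply: ler_wpM2l; first exact: hdens_ge0.
  apply: ler_wpM2l => //; apply: ler_wpM2r; first exact: sqr_ge0.
  by case: ifP => // _; apply: gpot1_le; exact: p0.
- exact: cvg_cst.
Qed.

End Hardy.

(** * Criticality and sharp constants *)

Section Sharpness.
Variables (R : realType) (N : nat).
Local Notation E := 'rV[R]_N.
Local Notation BE := (borelRV R N).
Variable o : E.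
Hypothesis o1 : enorm2 o < 1.
Hypothesis hN : (3 <= N)%N.
Variable mu : {sigma_finite_measure set BE -> \bar R}.
Hypothesis muP : is_lebesgue_upto N mu.
Implicit Types (s t : R) (x : E) (u : E -> R) (F : R -> R).

Local Notation cosh := (coshd o).
Local Notation pball := (pball o).
Local Notation profile := (profile o).
Local Notation rint := (rint o mu).
Local Notation c := ((N%:R - 1) / 2 : R).
Local Notation Q := (c ^+ 2 - c : R).
Local Notation pot := (gpot c).
Local Notation flux := (@gflux R N).
Local Notation wgt := (@wgt R N).
Local Notation J0 := (rint (fun s => wgt s * step' ((tlog s - 0) / 1))).
Let oP : open pball := @open_pball R N o.
Let oB : open (@hball R N) := @open_hball R N.
Let SC : smooth_on pball cosh := @smooth_on_coshdP R N o.
Let C1 x : pball x -> 1 < cosh x. Proof. exact: coshd_gt1. Qed.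
Let c1 : 1 <= c := half_dim_ge1 R hN.

Lemma integral_gt0 (g : E -> R) x1 : measurable_fun setT (g : BE -> R) ->
  (forall x, 0 <= g x) -> {for x1, continuous g} -> 0 < g x1 ->
  (0 < \int[mu]_x (g x)%:E)%E.
Proof.
move=> mg g0 cg gx; have gx2 : 0 < g x1 / 2 by rewrite divr_gt0.
have /nbhs_ballP[e /= e0 eU] : \forall x \near x1, g x1 / 2 < g x.
  have := cvgr_gt (g x1) cg (g x1 / 2); apply.
  by rewrite ltr_pdivrMr// ltr_pMr// ltr1n.
have e20 : 0 < e / 2 by rewrite divr_gt0.
have mB : measurable (box N x1 (e / 2) : set BE) by exact: box_measurable.
have sub x : box N x1 (e / 2) x -> g x1 / 2 <= g x.
  move=> hx; apply: ltW; apply: eU; apply: rV_ballP => // i.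
  rewrite distrC; apply: le_lt_trans (hx i (ltn_ord i)) _.
  by rewrite ltr_pdivrMr// ltr_pMr// ltr1n.
apply: (@lt_le_trans _ _ (\int[mu]_(x in box N x1 (e / 2)) (g x1 / 2)%:E)%E).
  have -> : (\int[mu]_(x in box N x1 (e / 2)) (g x1 / 2)%:E = (g x1 / 2)%:E * mu (box N x1 (e / 2)))%E by rewrite integral_cst.
  case: muP => _ -> //; last by move=> *; exact: ltW.
  by move=> _; rewrite -EFinM lte_fin mulr_gt0// exprn_gt0// mulr_gt0.
apply: (@le_trans _ _ (\int[mu]_(x in box N x1 (e / 2)) (g x)%:E)%E).
  apply: ge0_le_integral => //.
  - by move=> x _; rewrite lee_fin ltW.
  - by apply/measurable_EFinP; exact: measurable_funTS.
apply: ge0_subset_integral => //; first exact/measurable_EFinP.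
by move=> x _; rewrite lee_fin.
Qed.

Lemma pball_nonempty : exists x, pball x.
Proof.
have N0 : (0 < N)%N by exact: leq_trans hN.
have [oz|oz] := eqVneq o 0; last first.
  by exists 0; split; [rewrite /hball /= enorm2_0|rewrite eq_sym].
pose i0 : 'I_N := Ordinal N0.
exists (2^-1 *: ebasis R i0); split.
  rewrite /hball /= /enorm2 (bigD1 i0)//= big1 => [|j ji].
    rewrite !mxE !eqxx mulr1 addr0 expr_lt1// ?invr_ge0// invf_lt1// ltr1n//.
  by rewrite !mxE (negbTE ji) andbF mulr0 expr0n.
apply/eqP => /rowP/(_ i0); rewrite oz !mxE !eqxx mulr1 => /eqP.
by rewrite invr_eq0 pnatr_eq0.
Qed.

(** By [rint_step'] with [k = 1] the bump may be translated until its midpoint, where [step'] is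
    positive, is the value of [log r] at a chosen point. *)
Lemma J0_gt0 : 0 < J0.
Proof.
have [x1 p1] := pball_nonempty.
pose c0 := tlog (cosh x1) - 2^-1.
have := rint_step' o1 muP c0 ltr01; rewrite mul1r => <-.
have pF := profile_wgt_step' o1 c0 ltr01.
pose F s := wgt s * step' ((tlog s - c0) / 1).
rewrite -lte_fin -(rintE o1 muP pF).
have S : smooth_on pball (fun x => hdens x * radial o F x).
  apply: smooth_onM => //; first exact: smooth_on_sub (@pball_hball _ _ _) (@smooth_on_hdens R N).
  by apply: smooth_on_eq (pF.2) => // x px; rewrite radial_pball.
apply: (@integral_gt0 (fun x => hdens x * radial o F x) x1).
- by apply/measurable_EFinP; have /integrableP[] := profile_integrable o1 muP pF.
- move=> x; apply: mulr_ge0; first exact: hdens_ge0.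
  rewrite /radial; case: ifP => // /andP[hx xo]; apply: mulr_ge0; last exact: step'_ge0.
  by apply: ltW; apply: wgt_gt0; apply: C1; split.
- exact: (smooth_on_continuous S p1).
apply: mulr_gt0; first exact: hdens_gt0 p1.1.
rewrite radial_pball// /F mulr_gt0// ?wgt_gt0 ?C1//.
by rewrite /c0 divr1 opprB addrCA subrr addr0 step'_half_gt0.
Qed.

Lemma hint_radial (f : E -> R) F : (forall x, hball x -> f x = radial o F x) ->
  profile F -> (forall s, 1 < s -> 0 <= F s) -> hint (fun x => (f x)%:E) = (rint F)%:E.
Proof.
move=> fF pF F0.
have E1 : (fun x => hdens x * f x) = (fun x => hdens x * radial o F x).
  apply/funext => x; have [hx|hx] := ltP (enorm2 x) 1; first by rewrite fF.
  by rewrite hdens_out ?mul0r.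
have mF : measurable_fun setT (fun x : BE => hdens x * radial o F x).
  by apply/measurable_EFinP; have /integrableP[] := profile_integrable o1 muP pF.
rewrite (hintE muP); first by rewrite -(rintE o1 muP pF); apply: eq_integral => x _; have := congr1 (@^~ x) E1 => /= ->.
- by rewrite E1.
move=> x hx; rewrite fF// /radial; case: ifP => // /andP[_ xo].
by apply: F0; apply: C1; split.
Qed.

(** The statement keeps three separate integrals; nonnegative coefficients allow them to be merged
    without knowing that they are finite. *)
Lemma hint_lin3 u (al be ga : R) : smooth_on setT u -> 0 <= al -> 0 <= be -> 0 <= ga ->
  (al%:E * hint (fun x => (u x ^+ 2)%:E) + be%:E * hint (fun x => (u x ^+ 2 / hdist x o ^+ 2)%:E)
   + ga%:E * hint (fun x => (u x ^+ 2 / sinh (hdist x o) ^+ 2)%:E) =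
  \int[mu]_x (hdens x * (al * u x ^+ 2 + be * (u x ^+ 2 / hdist x o ^+ 2) +
     ga * (u x ^+ 2 / sinh (hdist x o) ^+ 2)))%:E)%E.
Proof.
move=> Su al0 be0 ga0.
have SP : smooth_on pball (fun x => u x ^+ 2).
  by apply: smooth_onX => //; exact: smooth_on_sub (subsetT _) Su.
have S1 : smooth_on pball (fun x => u x ^+ 2 / hdist x o ^+ 2).
  apply: (@smooth_on_eq _ _ _ (fun x => u x ^+ 2 * (acosh (cosh x))^-1 ^+ 2)) => //.
    by move=> x px; rewrite exprVn.
  by apply: smooth_onM => //; apply: smooth_onX => //; exact: smooth_on_acosh_inv.
have S2 : smooth_on pball (fun x => u x ^+ 2 / sinh (hdist x o) ^+ 2).
  apply: (@smooth_on_eq _ _ _ (fun x => u x ^+ 2 * (sh (cosh x))^-1 ^+ 2)) => //.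
    by move=> x px; rewrite exprVn hdistE sinh_acosh//; exact/ltW/C1.
  by apply: smooth_onM => //; apply: smooth_onX => //; exact: smooth_on_sh_inv.
have m (f : E -> R) : smooth_on pball f -> measurable_fun setT (fun x : BE => hdens x * f x).
  by move=> Sf; apply: (@measurable_hdens _ _ o) => x px; exact: (smooth_on_continuous Sf px).
have p (f : E -> R) : (forall x, 0 <= f x) -> forall x, (0 <= (hdens x * f x)%:E)%E.
  by move=> f0 x; rewrite lee_fin mulr_ge0 ?hdens_ge0.
have q0 x : 0 <= u x ^+ 2 by exact: sqr_ge0.
have q1 x : 0 <= u x ^+ 2 / hdist x o ^+ 2 by rewrite divr_ge0 ?sqr_ge0.
have q2 x : 0 <= u x ^+ 2 / sinh (hdist x o) ^+ 2 by rewrite divr_ge0 ?sqr_ge0.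
have [m0 m1 m2] := And3 (m _ SP) (m _ S1) (m _ S2).
have [p0 p1 p2] := And3 (p _ q0) (p _ q1) (p _ q2).
rewrite !(hintE muP)//.
rewrite -!ge0_integralZl_EFin//; try by apply/measurable_EFinP.
rewrite -ge0_integralD//; last 4 first.
- by move=> x _; rewrite -EFinM lee_fin mulr_ge0// mulr_ge0 ?hdens_ge0.
- by apply/measurable_EFinP; apply: measurable_funM => //; exact: measurable_cst.
- by move=> x _; rewrite -EFinM lee_fin mulr_ge0// mulr_ge0 ?hdens_ge0.
- by apply/measurable_EFinP; apply: measurable_funM => //; exact: measurable_cst.
rewrite -ge0_integralD//; last 4 first.
- by move=> x _; rewrite -!EFinM -EFinD lee_fin addr_ge0// mulr_ge0// mulr_ge0 ?hdens_ge0.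
- by apply: emeasurable_funD; apply/measurable_EFinP; apply: measurable_funM => //; exact: measurable_cst.
- by move=> x _; rewrite -EFinM lee_fin mulr_ge0// mulr_ge0 ?hdens_ge0.
- by apply/measurable_EFinP; apply: measurable_funM => //; exact: measurable_cst.
apply: eq_integral => x _; rewrite -!EFinM -!EFinD; congr EFin; ring.
Qed.

Lemma gpot_terms x (v : R) : hball x ->
  pot (cosh x) * v = (N%:R - 1) ^+ 2 / 4 * v + 1 / 4 * (v / hdist x o ^+ 2) +
     (N%:R - 1) * (N%:R - 3) / 4 * (v / sinh (hdist x o) ^+ 2).
Proof.
move=> hx; by rewrite -(gpot_coshd o1 hx) (invfM 4); ring.
Qed.

Lemma hardy_hint u : test_H u ->
  (((N%:R - 1) ^+ 2 / 4)%:E * hint (fun x => (u x ^+ 2)%:E)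
    + (1 / 4)%:E * hint (fun x => (u x ^+ 2 / hdist x o ^+ 2)%:E)
    + ((N%:R - 1) * (N%:R - 3) / 4)%:E * hint (fun x => (u x ^+ 2 / sinh (hdist x o) ^+ 2)%:E)
    <= hint (fun x => (hgrad2 u x)%:E))%E.
Proof.
move=> tu; have [Su _] := test_smooth tu.
have N3 : 3%:R <= N%:R :> R by rewrite ler_nat.
rewrite hint_lin3//; last 2 first.
- by rewrite divr_ge0 ?sqr_ge0.
- by rewrite divr_ge0// mulr_ge0//; lra.
rewrite (hintE muP); last 2 first.
- by apply/measurable_EFinP; have /integrableP[] := integrable_hgrad2 muP tu.
- by move=> x _; exact: hgrad2_ge0.
apply: le_trans (hardy o1 hN muP tu); rewrite le_eqVlt; apply/orP; left; apply/eqP.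
apply: eq_integral => x _; congr EFin; have [hx|hx] := ltP (enorm2 x) 1; last first.
  by rewrite hdens_out// !mul0r.
by rewrite -gpot_terms.
Qed.

Lemma test_punct_H u : test_punct o u -> test_H u. Proof. by case. Qed.

Lemma hint_potential u : smooth_on setT u ->
  hint (fun x => (((N%:R - 1) ^+ 2 / 4 + 1 / (4 * hdist x o ^+ 2)
     + (N%:R - 1) * (N%:R - 3) / 4 / sinh (hdist x o) ^+ 2) * u x ^+ 2)%:E) =
  (\int[mu]_x (hdens x * (pot (cosh x) * u x ^+ 2))%:E)%E.
Proof.
move=> Su.
have S : smooth_on pball (fun x => pot (cosh x) * u x ^+ 2).
  apply: smooth_onM => //; first exact: smooth_on_gpot.
  by apply: smooth_onX => //; exact: smooth_on_sub (subsetT _) Su.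
have m : measurable_fun setT (fun x : BE => hdens x * (pot (cosh x) * u x ^+ 2)).
  by apply: (@measurable_hdens _ _ o) => x px; exact: (smooth_on_continuous S px).
have Ex : (fun x => hdens x * (((N%:R - 1) ^+ 2 / 4 + 1 / (4 * hdist x o ^+ 2)
     + (N%:R - 1) * (N%:R - 3) / 4 / sinh (hdist x o) ^+ 2) * u x ^+ 2)) =
     (fun x => hdens x * (pot (cosh x) * u x ^+ 2)).
  apply/funext => x; have [hx|hx] := ltP (enorm2 x) 1; first by rewrite gpot_coshd.
  by rewrite hdens_out ?mul0r.
rewrite (hintE muP); last 2 first.
- by rewrite Ex.
- move=> x hx; rewrite gpot_coshd//; apply: mulr_ge0; last exact: sqr_ge0.
  by apply: (gpot_ge0 hN); apply: coshd_ge1.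
by apply: eq_integral => x _; have := congr1 (@^~ x) Ex => /= ->.
Qed.

(** * Integrals of the cut-off ground state *)

Section Flux.
Variables c0 k : R.
Hypothesis k0 : 0 < k.
Local Notation u := (radial o (flux c0 k)).

Let pf : profile (flux c0 k) := profile_flux o1 c0 k0.

Lemma flux_supp x : u x != 0 -> pball x /\ c0 < tlog (cosh x) < c0 + 3 * k.
Proof.
rewrite /radial; case: ifP => [/andP[hx xo] h|_]; last by rewrite eqxx.
split; first by split.
rewrite !ltNge -negb_or; apply/negP => H.
have := @psi_out _ c0 k k0 (tlog (cosh x)) => H0; move: h; rewrite /gflux H0 ?mulr0 ?eqxx//.
by apply/orP.
Qed.

Lemma flux_smooth : smooth_on setT u.
Proof. by have [[s0 [s1 [s01 sF]]] SF] := pf; exact: (radial_smooth o1 s01 sF SF). Qed.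

Lemma flux_test_H : test_H u.
Proof.
split; first by apply/smoothP; exact: flux_smooth.
have [[s0 [s1 [s01 sF]]] SF] := pf.
by have [rho r1 H] := radial_enorm2 o1 s01 sF; exists rho.
Qed.

Lemma flux_test_punct : test_punct o u.
Proof.
split; first exact: flux_test_H.
exists (expR c0); split; first exact: expR_gt0.
move=> x; rewrite hdistE => hx; apply/eqP; apply: contraLR hx => /flux_supp[px /andP[h _]].
rewrite -leNgt -[leRHS]lnK ?posrE ?acosh_gt0 ?C1// ler_expR ltW//.
Qed.

Lemma flux_test_ball eps : expR (c0 + 3 * k) < eps -> test_ball o eps u.
Proof.
move=> he; split; first by apply/smoothP; exact: flux_smooth.
exists (expR (c0 + 3 * k)); split => // x hx; apply/eqP; apply/negPn/negP => /flux_supp[px /andP[_ h]].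
apply: hx; split; first exact: px.1.
by rewrite hdistE -[leLHS]lnK ?posrE ?acosh_gt0 ?C1// ler_expR ltW.
Qed.

Lemma hint_flux (P : R -> R) (f : E -> R) : smooth_on pball (fun x => P (cosh x)) ->
  (forall s, 1 < s -> 0 <= P s) ->
  (forall x, pball x -> f x = P (cosh x)) ->
  hint (fun x => (f x * u x ^+ 2)%:E) = (rint (fun s => P s * flux c0 k s ^+ 2))%:E.
Proof.
move=> SP P0 fP; apply: hint_radial.
- move=> x hx; rewrite /radial; case: ifP => [/andP[_ xo]|_]; last by rewrite expr0n mulr0.
  by rewrite fP//; split.
- exact: profile_flux_sqr.
- by move=> s s1; rewrite mulr_ge0 ?sqr_ge0// P0.
Qed.

Lemma hint_hgrad2_flux : hint (fun x => (hgrad2 u x)%:E) =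
  (rint (fun s => pot s * flux c0 k s ^+ 2) + rint (fun s => wgt s * psi' c0 k (tlog s) ^+ 2))%:E.
Proof.
have N2 : (2 <= N)%N by exact: leq_trans hN.
rewrite -(rint_energy o1 muP c0 k0 N2); apply: hint_radial.
- have [[s0 [s1 [s01 sF]]] SF] := pf.
  by move=> x hx; apply: (hgrad2_radial o1 s01 sF) => // s h; exact: is_derive_flux.
- exact: profile_flux'.
- by move=> s s1; rewrite mulr_ge0 ?sqr_ge0// ltW// sqrB1_gt0.
Qed.

Lemma rint_gpot : rint (fun s => pot s * flux c0 k s ^+ 2) =
  c ^+ 2 * rint (fun s => 1 * flux c0 k s ^+ 2) +
  1 / 4 * rint (fun s => (acosh s)^-1 ^+ 2 * flux c0 k s ^+ 2) +
  Q * rint (fun s => (sh s)^-1 ^+ 2 * flux c0 k s ^+ 2).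
Proof.
have h0 : profile (fun s => 1 * flux c0 k s ^+ 2).
  by apply: (profile_flux_sqr o1 c0 k0 (P := fun=> 1)); exact: smooth_on_cst.
have h1 : profile (fun s => (acosh s)^-1 ^+ 2 * flux c0 k s ^+ 2).
  apply: (profile_flux_sqr o1 c0 k0 (P := fun s => (acosh s)^-1 ^+ 2)).
  by apply: smooth_onX => //; exact: smooth_on_acosh_inv.
have h2 : profile (fun s => (sh s)^-1 ^+ 2 * flux c0 k s ^+ 2).
  apply: (profile_flux_sqr o1 c0 k0 (P := fun s => (sh s)^-1 ^+ 2)).
  by apply: smooth_onX => //; exact: smooth_on_sh_inv.
have [z0 z1 z2] := And3 (profileZ (c ^+ 2) h0) (profileZ (1 / 4) h1) (profileZ Q h2).
have z01 := profileD z0 z1.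
rewrite -!rintZ// -(rintD o1 muP z0 z1) -(rintD o1 muP z01 z2).
apply: (eq_rint o1) => s s1.
rewrite /gpot -(sqr_sh (ltW s1)).
have [rp sp] := (acosh_gt0 s1, sh_gt0 s1).
by move: (gflux _ _ _ _) => f; field; rewrite !gt_eqF.
Qed.

End Flux.
End Sharpness.

(** * Absence of an extra weight, and optimality of the two constants *)

Section Criticality.
Variables (R : realType) (N : nat).
Local Notation E := 'rV[R]_N.
Local Notation BE := (borelRV R N).
Variable o : E.
Hypothesis o1 : enorm2 o < 1.
Hypothesis hN : (3 <= N)%N.
Variable mu : {sigma_finite_measure set BE -> \bar R}.
Hypothesis muP : is_lebesgue_upto N mu.
Implicit Types (s t : R) (x : E) (u : E -> R) (F : R -> R).

Local Notation cosh := (coshd o).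
Local Notation pball := (pball o).
Local Notation profile := (profile o).
Local Notation rint := (rint o mu).
Local Notation c := ((N%:R - 1) / 2 : R).
Local Notation Q := (c ^+ 2 - c : R).
Local Notation pot := (gpot c).
Local Notation flux := (@gflux R N).
Local Notation wgt := (@wgt R N).
Local Notation J0 := (rint (fun s => wgt s * step' ((tlog s - 0) / 1))).
Local Notation energy c0 k := (rint (fun s => wgt s * psi' c0 k (tlog s) ^+ 2)).
Local Notation mass c0 k := (rint (fun s => (acosh s)^-1 ^+ 2 * flux c0 k s ^+ 2)).
Let oP : open pball := @open_pball R N o.
Let SC : smooth_on pball cosh := @smooth_on_coshdP R N o.
Let C1 x : pball x -> 1 < cosh x. Proof. exact: coshd_gt1. Qed.
Let c1 : 1 <= c := half_dim_ge1 R hN.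
Let J0p : 0 < J0 := J0_gt0 o1 hN muP.

Let Q0 : 0 <= Q.
Proof. by rewrite subr_ge0 expr2 ler_peMl// (le_trans _ c1). Qed.

(* On a logarithmic scale of length [k] the energy is [O(1/k)] while the mass is
   at least proportional to [k]. *)
Lemma energy_lt_mass (d : R) : 0 < d -> exists2 k, 0 < k & forall c0, energy c0 k < d * mass c0 k.
Proof.
move=> d0; have [M M0 sM] := step'_bounded R.
(* The bounds [2 M J0 / k] and [k J0 / M] require [2 M^2 < d k^2]; here [d k = d + 2 M^2] and
   [k > 1], whatever the value of [c0]. *)
pose k : R := 1 + 2 * M ^+ 2 / d.
have q0 : 0 < 2 * M ^+ 2 / d by rewrite divr_gt0// mulr_gt0// exprn_gt0.
have k1 : 1 < k by rewrite ltrDl.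
have k0 : 0 < k by exact: lt_trans k1.
exists k => // c0.
have h1 := rint_wgt_psi'_le o1 muP c0 k0 M0 sM.
have h2 := rint_wgt_psi_ge o1 muP c0 k0 M0 sM.
apply: le_lt_trans h1 _.
move: h2; move: (mass _ _) => m h2.
apply: (@lt_le_trans _ _ (d * (k * J0 / M))); last first.
  by rewrite ler_wpM2l ?(ltW d0)// ler_pdivrMr// [leRHS]mulrC.
move: J0p; move: (rint _) => j j0.
have dk : d * k = d + 2 * M ^+ 2 by rewrite /k; field; rewrite gt_eqF.
rewrite ltr_pdivrMr//.
have -> : d * (k * j / M) * k = (d * k) * k * j / M by field; rewrite gt_eqF.
rewrite ltr_pdivlMr// mulrAC ltr_pM2r// dk.
have : (d + 2 * M ^+ 2) * 1 < (d + 2 * M ^+ 2) * k.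
  by rewrite ltr_pM2l// addr_gt0// mulr_gt0// exprn_gt0.
rewrite mulr1; apply: le_lt_trans.
have -> : 2 * M * M = 2 * M ^+ 2 by ring.
by rewrite lerDr ltW.
Qed.

Lemma borel_fun_measurable (W : E -> R) : borel_fun W -> measurable_fun setT (W : BE -> R).
Proof.
move=> bW; apply: (measurability _ (RGenOInfty.measurableE R)).
move=> _ [_ [a ->] <-]; rewrite setTI.
have -> : W @^-1` `]a, +oo[%classic = W @^-1` [set y | a < y].
  by apply/seteqP; split=> x /=; rewrite in_itv /= andbT.
exact: bW.
Qed.

Lemma critical_form : form_ge (test_punct o) (fun x => (N%:R - 1) ^+ 2 / 4 + 1 / (4 * hdist x o ^+ 2)
  + (N%:R - 1) * (N%:R - 3) / 4 / sinh (hdist x o) ^+ 2).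
Proof.
move=> u /test_punct_H tu; have [Su _] := test_smooth tu.
rewrite (hint_potential o1 hN muP Su) (hintE muP).
- exact: hardy.
- by apply/measurable_EFinP; have /integrableP[] := integrable_hgrad2 muP tu.
- by move=> x _; exact: hgrad2_ge0.
Qed.

(** Tested on the cut-off ground states [v n], the improved inequality leaves [int W (v n)^2] below
    an energy that tends to 0. The plateaus exhaust the punctured ball, so Fatou's lemma gives
    [int W phi^2 = 0], and [phi > 0] forces [W = 0] almost everywhere. *)
Lemma no_extra_weight (W : E -> R) : borel_fun W ->
  (forall x, in_ball x -> x != o -> 0 <= W x) ->
  form_ge (test_punct o) (fun x => (N%:R - 1) ^+ 2 / 4 + 1 / (4 * hdist x o ^+ 2)
    + (N%:R - 1) * (N%:R - 3) / 4 / sinh (hdist x o) ^+ 2 + W x) ->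
  hint (fun x => if x == o then 0%E else (W x)%:E) = 0%E.
Proof.
move=> bW W0 fW; have mW := borel_fun_measurable bW.
have WP x : pball x -> 0 <= W x by move=> [hx xo]; exact: W0.
have mWg (g : E -> R) : (forall x, pball x -> {for x, continuous g}) ->
    measurable_fun setT (fun x : BE => hdens x * (W x * g x)).
  move=> cg; have -> : (fun x => hdens x * (W x * g x)) = (fun x => W x * (hdens x * g x)).
    by apply/funext => x; rewrite mulrCA.
  by apply: measurable_funM => //; exact: measurable_hdens cg.
have cS (g : E -> R) : smooth_on pball g -> forall x, pball x -> {for x, continuous g}.
  by move=> Sg x px; exact: (smooth_on_continuous Sg px).
have [M M0 sM] := step'_bounded R.
pose k (n : nat) : R := n.+1%:R.
have k0 n : 0 < k n by rewrite ltr0n.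
(* Centres the window at [log r = 0]: the plateau is the interval from [- k n / 2] to [k n / 2]. *)
pose c0 n : R := - (3 / 2 * k n).
pose v n := radial o (flux (c0 n) (k n)).
have Sv n : smooth_on setT (v n) by exact: flux_smooth.
have SvP n : smooth_on pball (v n) by exact: smooth_on_sub (subsetT _) (Sv n).
have v0 n x : ~ pball x -> v n x = 0.
  by move=> px; apply/eqP/negPn/negP => /(flux_supp (k0 n))[].
have Wv0 n x : 0 <= W x * v n x ^+ 2.
  have [px|px] := pselect (pball x); first by rewrite mulr_ge0 ?sqr_ge0 ?WP.
  by rewrite v0// expr0n mulr0.
have XE n : (\int[mu]_x (hdens x * (W x * v n x ^+ 2))%:E <= (2 * M * J0 / k n)%:E)%E.
  have tv : test_punct o (v n) by exact: flux_test_punct.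
  have := fW _ tv; rewrite (hint_hgrad2_flux o1 hN muP (c0 n) (k0 n)).
  have Sp : smooth_on pball (fun x => pot (cosh x) * v n x ^+ 2).
    by apply: smooth_onM => //; [exact: smooth_on_gpot|exact: smooth_onX].
  have mp : measurable_fun setT (fun x : BE => hdens x * (pot (cosh x) * v n x ^+ 2)).
    by apply: (@measurable_hdens _ _ o); exact: cS.
  have mv : measurable_fun setT (fun x : BE => hdens x * (W x * v n x ^+ 2)).
    by apply: mWg; apply: cS; exact: smooth_onX.
  have pv0 x : 0 <= hdens x * (pot (cosh x) * v n x ^+ 2).
    have [hx|hx] := ltP (enorm2 x) 1; last by rewrite hdens_out ?mul0r.
    apply: mulr_ge0; first exact: hdens_ge0.
    by apply: mulr_ge0; [apply: (gpot_ge0 hN); exact: coshd_ge1|exact: sqr_ge0].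
  have Ex : (fun x => hdens x * (((N%:R - 1) ^+ 2 / 4 + 1 / (4 * hdist x o ^+ 2)
     + (N%:R - 1) * (N%:R - 3) / 4 / sinh (hdist x o) ^+ 2 + W x) * v n x ^+ 2)) =
     (fun x => hdens x * (pot (cosh x) * v n x ^+ 2) + hdens x * (W x * v n x ^+ 2)).
    apply/funext => x; have [hx|hx] := ltP (enorm2 x) 1; first by rewrite gpot_coshd//; ring.
    by rewrite hdens_out ?mul0r ?addr0.
  rewrite (hintE muP); last 2 first.
  - by rewrite Ex; exact: measurable_funD.
  - move=> x hx; rewrite gpot_coshd// mulrDl addr_ge0//.
    by apply: mulr_ge0; [apply: (gpot_ge0 hN); exact: coshd_ge1|exact: sqr_ge0].
  have -> : (\int[mu]_x (hdens x * (((N%:R - 1) ^+ 2 / 4 + 1 / (4 * hdist x o ^+ 2)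
     + (N%:R - 1) * (N%:R - 3) / 4 / sinh (hdist x o) ^+ 2 + W x) * v n x ^+ 2))%:E =
     \int[mu]_x (hdens x * (pot (cosh x) * v n x ^+ 2))%:E + \int[mu]_x (hdens x * (W x * v n x ^+ 2))%:E)%E.
    rewrite -ge0_integralD//.
    - by apply: eq_integral => x _; have := congr1 (@^~ x) Ex => /= ->.
    - by move=> x _; rewrite lee_fin.
    - exact/measurable_EFinP.
    - by move=> x _; rewrite lee_fin mulr_ge0 ?hdens_ge0.
    - exact/measurable_EFinP.
  have -> : (\int[mu]_x (hdens x * (pot (cosh x) * v n x ^+ 2))%:E)%E = (rint (fun s => pot s * flux (c0 n) (k n) s ^+ 2))%:E.
    rewrite -(hint_flux o1 muP (c0 n) (k0 n) (P := pot) (f := fun x => pot (cosh x)))//.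
    - rewrite (hintE muP)// => x hx.
      by apply: mulr_ge0; [apply: (gpot_ge0 hN); exact: coshd_ge1|exact: sqr_ge0].
    - exact: smooth_on_gpot.
    - by move=> s s1; apply: (gpot_ge0 hN); exact: ltW.
  (* The potential term is the integral of a profile, hence finite, and cancels from both sides. *)
  rewrite EFinD leeD2lE// => /le_trans; apply; rewrite lee_fin.
  exact: (rint_wgt_psi'_le o1 muP (c0 n) (k0 n) M0 sM).
pose G x := radial o (fun s => gphi c s ^+ 2) x.
have SG : smooth_on pball G.
  apply: (@smooth_on_eq _ _ _ (fun x => gphi c (cosh x) ^+ 2)) => //; first by move=> x px; rewrite /G radial_pball.
  by apply: smooth_onX => //; exact: smooth_on_gphi.
have mZ : measurable_fun setT (fun x : BE => hdens x * (W x * G x)) by apply: mWg; exact: cS.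
have Z0 x : 0 <= hdens x * (W x * G x).
  apply: mulr_ge0; first exact: hdens_ge0.
  rewrite /G /radial; case: ifP => [/andP[hx xo]|_]; last by rewrite mulr0.
  by rewrite mulr_ge0 ?sqr_ge0// W0.
have ZI : (\int[mu]_x (hdens x * (W x * G x))%:E <= 0%:E)%E.
  apply: (@fatou_le _ _ _ mu (fun n x => hdens x * (W x * v n x ^+ 2)) _ (fun n => 2 * M * J0 / k n)) => //.
  - by move=> n; apply: mWg; apply: cS; exact: smooth_onX.
  - by move=> n x; rewrite mulr_ge0 ?hdens_ge0.
  (* At a fixed point the sequence is eventually constant, as soon as the plateau contains
     [log r]. *)
  - move=> x; apply: cvg_near_cst.
    have [px|px] := pselect (pball x); last first.
      apply: nearW => n; rewrite v0// expr0n mulr0 /G /radial; case: ifP => [/andP[hx xo]|_]; last by rewrite !mulr0.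
      by exfalso; apply: px; split.
    exists (Num.truncn (2 * `|tlog (cosh x)|)) => // n /= hn.
    have hk : 2 * `|tlog (cosh x)| <= k n.
      by apply: (le_trans (ltW (truncnS_gt _))); rewrite /k ler_nat ltnS.
    have := ler_norm (tlog (cosh x)); have := ler_norm (- tlog (cosh x)); rewrite normrN => h1 h2.
    rewrite /v /G !radial_pball// /gflux psi_in ?k0// ?mulr1// /c0.
    by apply/andP; split; lra.
  - rewrite -[X in _ --> X](mulr0 (2 * M * J0)); apply: cvgMr; exact: cvg_harmonic.
have mZE : measurable_fun setT (fun x : BE => (hdens x * (W x * G x))%:E) by exact/measurable_EFinP.
have aeZ : ae_eq mu setT (fun x : BE => (hdens x * (W x * G x))%:E) (cst 0%E).
  apply/(ae_eq_integral_abs mu measurableT mZE).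
  apply/eqP; rewrite eq_le; apply/andP; split; last by apply: integral_ge0.
  apply: le_trans ZI; rewrite le_eqVlt; apply/orP; left; apply/eqP.
  by apply: eq_integral => x _; rewrite gee0_abs// lee_fin.
(* The indicator of the punctured ball, used to bring the integrand of the conclusion under
   [mWg]. *)
pose I1 x := radial o (fun=> 1) x.
have SI : smooth_on pball I1.
  apply: (@smooth_on_eq _ _ _ (fun=> 1)) => //; last exact: smooth_on_cst.
  by move=> x px; rewrite /I1 radial_pball.
have mI : measurable_fun setT (fun x : BE => hdens x * (W x * I1 x)) by apply: mWg; exact: cS.
have EI : (fun x => hdens x * (W x * I1 x)) = (fun x => hdens x * (if x == o then 0 else W x)).
  apply/funext => x; have [hx|hx] := ltP (enorm2 x) 1; last by rewrite hdens_out ?mul0r.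
  by rewrite /I1 /radial /in_ball hx; case: eqP; rewrite ?mulr0 ?mulr1.
have -> : (fun x => if x == o then 0%E else (W x)%:E) = (fun x => (if x == o then 0 else W x)%:E).
  by apply/funext => x; case: ifP.
rewrite (hintE muP); last 2 first.
- by rewrite -EI.
- by move=> x hx; case: ifPn => // xo; exact: W0.
rewrite -[RHS](integral0 mu setT); apply: ae_eq_integral => //.
- by apply/measurable_EFinP; rewrite -EI.
apply: filterS aeZ => x /= /(_ I) [Zx] _; congr EFin.
have := congr1 (@^~ x) EI => /= <-.
have [px|px] := pselect (pball x); last first.
  rewrite /I1 /radial; case: ifP => [/andP[hx xo]|_]; last by rewrite !mulr0.
  by exfalso; apply: px; split.
have gp : 0 < G x by rewrite /G radial_pball// exprn_gt0// expR_gt0.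
move/eqP: Zx; rewrite mulrA mulf_eq0 (gt_eqF gp) orbF => /eqP Zx.
by rewrite mulrA Zx mul0r.
Qed.

Lemma hint_flux_terms (c0 k : R) : 0 < k -> let u := radial o (flux c0 k) in
  [/\ hint (fun x => (u x ^+ 2)%:E) = (rint (fun s => 1 * flux c0 k s ^+ 2))%:E,
      hint (fun x => (u x ^+ 2 / hdist x o ^+ 2)%:E) = (mass c0 k)%:E &
      hint (fun x => (u x ^+ 2 / sinh (hdist x o) ^+ 2)%:E) =
        (rint (fun s => (sh s)^-1 ^+ 2 * flux c0 k s ^+ 2))%:E].
Proof.
move=> k0 u; split.
- rewrite -(hint_flux o1 muP c0 k0 (P := fun=> 1) (f := fun=> 1))//.
    by congr hint; apply/funext => x; rewrite mul1r.
  exact: smooth_on_cst.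
- rewrite -(hint_flux o1 muP c0 k0 (P := fun s => (acosh s)^-1 ^+ 2) (f := fun x => (hdist x o)^-1 ^+ 2))//.
  + by congr hint; apply/funext => x; rewrite exprVn mulrC.
  + by apply: smooth_onX => //; exact: smooth_on_acosh_inv.
  + by move=> s s1; exact: sqr_ge0.
- rewrite -(hint_flux o1 muP c0 k0 (P := fun s => (sh s)^-1 ^+ 2) (f := fun x => (sinh (hdist x o))^-1 ^+ 2))//.
  + by congr hint; apply/funext => x; rewrite exprVn mulrC.
  + by apply: smooth_onX => //; exact: smooth_on_sh_inv.
  + by move=> s s1; exact: sqr_ge0.
  + by move=> x px; rewrite hdistE sinh_acosh//; exact/ltW/C1.
Qed.

Let cE : (N%:R - 1) ^+ 2 / 4 = c ^+ 2 :> R. Proof. by field. Qed.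
Let QE : (N%:R - 1) * (N%:R - 3) / 4 = Q :> R. Proof. by field. Qed.

(** From [exp r >= 1 + r^2 / 2] one gets [sinh r >= r^2 / 4]. Beyond the distance [r0], the weight
    [1 / sinh^2 r] is thus at most [16 / r0^2] times [1 / r^2]. *)
Lemma sqr_acosh_le (r0 s : R) : 1 < s -> 0 < r0 -> r0 <= acosh s ->
  r0 ^+ 2 * acosh s ^+ 2 <= 16 * sh s ^+ 2.
Proof.
move=> s1 r00 hr; have [rp sp] := (acosh_gt0 s1, sh_gt0 s1).
have h := expR_ge1Dxn 1 (ltW rp).
have sE := sinh_acosh (ltW s1).
have e1 : expR (- acosh s) <= 1 by rewrite expR_le1 oppr_le0 ltW.
have h2 : acosh s ^+ 2 <= 4 * sh s.
  rewrite -sE /sinh; move: h; rewrite (_ : 2`!%:R = 2 :> R)//.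
  by move: (expR _) (expR _) e1 => p q; lra.
have h3 : r0 ^+ 2 * acosh s ^+ 2 <= (acosh s ^+ 2) ^+ 2.
  rewrite [leRHS]expr2 ler_wpM2r ?sqr_ge0//.
  by apply: lerXn2r; rewrite ?nnegrE// ltW.
apply: le_trans h3 _; have -> : 16 * sh s ^+ 2 = (4 * sh s) ^+ 2 by ring.
by apply: lerXn2r; rewrite ?nnegrE ?sqr_ge0// mulr_ge0// ltW.
Qed.

(** For [r <= 1/2], [exp r <= 1 / (1 - r) <= 1 + 2 r] and [exp (- r) >= 1 - r], whence
    [sinh r <= 2 r]. *)
Lemma sqr_sh_le s : 1 < s -> acosh s <= 2^-1 -> sh s ^+ 2 <= 4 * acosh s ^+ 2.
Proof.
move=> s1 hr; have [rp sp] := (acosh_gt0 s1, sh_gt0 s1).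
have sE := sinh_acosh (ltW s1).
have h1 : 1 - acosh s <= expR (- acosh s) by exact: expR_ge1Dx.
have h2 : expR (acosh s) <= 1 + 2 * acosh s.
  have r1 : 0 < 1 - acosh s by lra.
  have -> : expR (acosh s) = (expR (- acosh s))^-1 by rewrite expRN invrK.
  apply: (@le_trans _ _ (1 - acosh s)^-1); first by rewrite lef_pV2 ?posrE ?expR_gt0.
  rewrite -[leLHS]mul1r ler_pdivrMr//; move: hr rp; move: (acosh s) => r; nra.
have h3 : sh s <= 2 * acosh s by rewrite -sE /sinh; lra.
have -> : 4 * acosh s ^+ 2 = (2 * acosh s) ^+ 2 by ring.
by apply: lerXn2r; rewrite ?nnegrE ?mulr_ge0// ltW.
Qed.

(** Write [c' = 1/4 + 2 d]. The length [k] makes the energy smaller than [d] times the mass wherever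
    the window lies; the window is then moved so far out that the [sinh] term costs at most another
    [d] times the mass. *)
Lemma sharp_quarter (c' : R) : 1 / 4 < c' ->
  ~ (forall u, test_H u ->
       (((N%:R - 1) ^+ 2 / 4)%:E * hint (fun x => (u x ^+ 2)%:E)
         + c'%:E * hint (fun x => (u x ^+ 2 / hdist x o ^+ 2)%:E)
        <= hint (fun x => (hgrad2 u x)%:E))%E).
Proof.
move=> hc H; pose d := (c' - 1 / 4) / 2.
have d0 : 0 < d by rewrite divr_gt0// subr_gt0.
have [k k0 Hk] := energy_lt_mass d0.
(* Ensures [r0 >= 1] and [16 * Q <= d * r0 ^+ 2], as [sqr_acosh_le] demands. *)
pose r0 := 1 + 16 * Q / d.
have q0 : 0 <= 16 * Q / d by rewrite divr_ge0 ?(ltW d0)// mulr_ge0.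
have r01 : 1 <= r0 by rewrite lerDl.
have r0p : 0 < r0 by exact: lt_le_trans r01.
have r02 : 16 * Q <= d * r0 ^+ 2.
  have h : r0 * 1 <= r0 * r0 by rewrite ler_wpM2l// ltW.
  have h2 : 16 * Q / d <= r0 ^+ 2 by rewrite expr2; apply: le_trans h; rewrite mulr1 lerDr.
  by rewrite [leRHS]mulrC -ler_pdivrMr.
pose c0 := ln r0.
have [E0 E1 E2] := hint_flux_terms c0 k0.
have := H _ (flux_test_H o1 c0 k0); rewrite E0 E1 (hint_hgrad2_flux o1 hN muP c0 k0).
rewrite (rint_gpot o1 muP c0 k0) -!EFinM -!EFinD lee_fin cE.
have h2 : profile (fun s => (sh s)^-1 ^+ 2 * flux c0 k s ^+ 2).
  apply: (profile_flux_sqr o1 c0 k0 (P := fun s => (sh s)^-1 ^+ 2)).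
  by apply: smooth_onX => //; exact: smooth_on_sh_inv.
have h1 : profile (fun s => (acosh s)^-1 ^+ 2 * flux c0 k s ^+ 2).
  apply: (profile_flux_sqr o1 c0 k0 (P := fun s => (acosh s)^-1 ^+ 2)).
  by apply: smooth_onX => //; exact: smooth_on_acosh_inv.
have h3 : Q * rint (fun s => (sh s)^-1 ^+ 2 * flux c0 k s ^+ 2) <= d * mass c0 k.
  rewrite -(rintZ o1 muP Q h2) -(rintZ o1 muP d h1).
  apply: (rint_le o1 muP); [exact: profileZ|exact: profileZ|].
  move=> s s1; have [rp sp] := (acosh_gt0 s1, sh_gt0 s1).
  have [ts|ts] := leP (tlog s) c0.
    by rewrite /gflux psi_out; [rewrite mulr0 expr0n !mulr0|exact: k0|left].
  have hr : r0 <= acosh s by move: ts; rewrite /c0 /tlog ltr_ln ?posrE// => /ltW.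
  rewrite [leLHS]mulrA [leRHS]mulrA; apply: ler_wpM2r; first exact: sqr_ge0.
  rewrite !exprVn ler_pdivrMr ?exprn_gt0//.
  rewrite mulrAC ler_pdivlMr ?exprn_gt0//.
  have h4 := sqr_acosh_le s1 r0p hr.
  have h5 : 16 * (Q * acosh s ^+ 2) <= d * (r0 ^+ 2 * acosh s ^+ 2).
    by rewrite [leLHS]mulrA [leRHS]mulrA; apply: ler_wpM2r => //; exact: sqr_ge0.
  have h6 : d * (r0 ^+ 2 * acosh s ^+ 2) <= d * (16 * sh s ^+ 2) by rewrite ler_wpM2l// ltW.
  by move: (le_trans h5 h6); rewrite [leRHS]mulrCA ler_pM2l.
have h4 := Hk c0.
have hd : c' = 1 / 4 + 2 * d by rewrite /d; field.
rewrite hd; move: h3 h4; move: (Q * _) (mass _ _) (energy _ _) (c ^+ 2 * _) => A B D F.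
by move=> *; lra.
Qed.

(** Write [c' = Q + 4 d]. Near the pole [1 / r^2 <= 4 / sinh^2 r], so the surplus [4 d] times the
    [sinh] integral is at least [d] times the mass, which exceeds the energy. *)
Lemma sharp_sinh (eps c' : R) : 0 < eps -> (N%:R - 1) * (N%:R - 3) / 4 < c' ->
  ~ (forall u, test_ball o eps u ->
       (((N%:R - 1) ^+ 2 / 4)%:E * hint (fun x => (u x ^+ 2)%:E)
         + (1 / 4)%:E * hint (fun x => (u x ^+ 2 / hdist x o ^+ 2)%:E)
         + c'%:E * hint (fun x => (u x ^+ 2 / sinh (hdist x o) ^+ 2)%:E)
        <= hint (fun x => (hgrad2 u x)%:E))%E).
Proof.
rewrite QE => eps0 hc H; pose d := (c' - Q) / 4.
have d0 : 0 < d by rewrite divr_gt0// subr_gt0.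
have [k k0 Hk] := energy_lt_mass d0.
pose r0 := Num.min 2^-1 (eps / 2).
have r0p : 0 < r0 by rewrite lt_min invr_gt0 divr_gt0// ltr0n.
have r02 : r0 <= 2^-1 by rewrite ge_min lexx.
have r0e : r0 < eps.
  by rewrite gt_min; apply/orP; right; rewrite ltr_pdivrMr// ltr_pMr// ltr1n.
(* Puts the outer end of the window at [log r0], inside the prescribed ball; [k] was fixed
   beforehand, so the inner end may be arbitrarily close to the pole. *)
pose c0 := ln r0 - 3 * k.
have c3 : c0 + 3 * k = ln r0 by rewrite /c0 subrK.
have [E0 E1 E2] := hint_flux_terms c0 k0.
have tb : test_ball o eps (radial o (flux c0 k)).
  by apply: flux_test_ball => //; rewrite c3 lnK ?posrE.
have := H _ tb; rewrite E0 E1 E2 (hint_hgrad2_flux o1 hN muP c0 k0).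
rewrite (rint_gpot o1 muP c0 k0) -!EFinM -!EFinD lee_fin cE.
have h2 : profile (fun s => (sh s)^-1 ^+ 2 * flux c0 k s ^+ 2).
  apply: (profile_flux_sqr o1 c0 k0 (P := fun s => (sh s)^-1 ^+ 2)).
  by apply: smooth_onX => //; exact: smooth_on_sh_inv.
have h1 : profile (fun s => (acosh s)^-1 ^+ 2 * flux c0 k s ^+ 2).
  apply: (profile_flux_sqr o1 c0 k0 (P := fun s => (acosh s)^-1 ^+ 2)).
  by apply: smooth_onX => //; exact: smooth_on_acosh_inv.
have h3 : mass c0 k <= 4 * rint (fun s => (sh s)^-1 ^+ 2 * flux c0 k s ^+ 2).
  rewrite -(rintZ o1 muP 4 h2).
  apply: (rint_le o1 muP); [exact: h1|exact: profileZ|].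
  move=> s s1; have [rp sp] := (acosh_gt0 s1, sh_gt0 s1).
  have [ts|ts] := leP (c0 + 3 * k) (tlog s).
    by rewrite /gflux psi_out; [rewrite mulr0 expr0n !mulr0|exact: k0|right].
  have hr : acosh s <= 2^-1.
    by move: ts; rewrite c3 /tlog ltr_ln ?posrE// => /ltW/le_trans; apply.
  rewrite [leRHS]mulrA; apply: ler_wpM2r; first exact: sqr_ge0.
  rewrite !exprVn ler_pdivlMr ?exprn_gt0//.
  by rewrite mulrC ler_pdivrMr ?exprn_gt0// sqr_sh_le.
have h4 := Hk c0.
have hd : c' = Q + 4 * d by rewrite /d; field.
have key (A B D F q : R) : B <= 4 * A -> D < d * B ->
    F + 1 / 4 * B + (q + 4 * d) * A <= F + 1 / 4 * B + q * A + D -> False.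
  move=> k1 k2 k3; have : d * B <= d * (4 * A) by apply: ler_wpM2l => //; exact: ltW.
  by move: k3; rewrite mulrDl; clearbody d; lra.
by rewrite hd; exact: key h3 h4.
Qed.

End Criticality.

Theorem theorem2p1 (R : realType) (N : nat) (o : 'rV[R]_N) :
  (3 <= N)%N -> enorm2 o < 1 ->
  [/\
   (* the Hardy-type inequality on C_c^infty(H^N) *)
   (forall u : 'rV[R]_N -> R, test_H u ->
      (hint (fun x => (hgrad2 u x)%:E) >=
         ((N%:R - 1) ^+ 2 / 4)%:E * hint (fun x => (u x ^+ 2)%:E)
       + (1 / 4)%:E * hint (fun x => (u x ^+ 2 / hdist x o ^+ 2)%:E)
       + ((N%:R - 1) * (N%:R - 3) / 4)%:E
           * hint (fun x => (u x ^+ 2 / sinh (hdist x o) ^+ 2)%:E))%E),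
   (* criticality of H in H^N \ {o} *)
   critical_punct o (fun x => (N%:R - 1) ^+ 2 / 4 + 1 / (4 * hdist x o ^+ 2)
                     + (N%:R - 1) * (N%:R - 3) / 4 / sinh (hdist x o) ^+ 2),
   (* sharpness of the constant 1/4 *)
   (forall c : R, 1 / 4 < c ->
      ~ (forall u : 'rV[R]_N -> R, test_H u ->
           (hint (fun x => (hgrad2 u x)%:E) >=
              ((N%:R - 1) ^+ 2 / 4)%:E * hint (fun x => (u x ^+ 2)%:E)
            + c%:E * hint (fun x => (u x ^+ 2 / hdist x o ^+ 2)%:E))%E)) &
   (* sharpness of (N-1)(N-3)/4 on every small geodesic ball *)
   (forall eps c : R, 0 < eps -> (N%:R - 1) * (N%:R - 3) / 4 < c ->
      ~ (forall u : 'rV[R]_N -> R, test_ball o eps u ->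
           (hint (fun x => (hgrad2 u x)%:E) >=
              ((N%:R - 1) ^+ 2 / 4)%:E * hint (fun x => (u x ^+ 2)%:E)
            + (1 / 4)%:E * hint (fun x => (u x ^+ 2 / hdist x o ^+ 2)%:E)
            + c%:E * hint (fun x => (u x ^+ 2 / sinh (hdist x o) ^+ 2)%:E))%E))].
Proof.
move=> hN o1; have [mu muP] := is_lebesgue_upto_exists R (leqnn N).
split.
- by move=> u; exact: (hardy_hint o1 hN muP).
- split; first exact: (critical_form o1 hN muP).
  move=> [W [bW [W0 [Wp fW]]]].
  by move: Wp; rewrite (no_extra_weight o1 hN muP bW W0 fW) ltxx.
- exact: (sharp_quarter o1 hN muP).
- exact: (sharp_sinh o1 hN muP).
Qed.
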